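(* If $f$ is analytic in the right half-plane, $|f(z)|\leq\mathcal{K}|z|^{\sigma}$ for some $\sigma\in\mathbb{R}$ as $z\rightarrow\infty$ (with $\mathcal{K}$ a positive constant), and $|f(z)|\leq\mathcal{M}$ for some $\mathcal{M}>0$ as $z\rightarrow0$, then for $\Re(\mu)>-1$, $$\int_{0}^{\infty} f(x)\, x^{\mu} e^{\mathrm{i}\omega x}\,\mathrm{d}x = e^{(\mu+1)\pi\mathrm{i}/2}\int_{0}^{\infty} f(\mathrm{i}x)\, x^{\mu} e^{-\omega x}\,\mathrm{d}x,$$ and for $\Re(\mu\pm\nu)>-1$ (both signs), $$\int_{0}^{\infty} f(x)\, x^{\mu} J_{\nu}(\omega x)\,\mathrm{d}x = \int_{0}^{\infty} \widehat{f}(\mathrm{i}x)\, x^{\mu} K_{\nu}(\omega x)\,\mathrm{d}x,$$ where $$\widehat{f}(x)=\frac{1}{\pi}\left(e^{(\mu-\nu)\pi\mathrm{i}/2}f(x)+e^{(\nu-\mu)\pi\mathrm{i}/2}f(-x)\right).$$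
   Context: $\omega>0$ is the frequency of oscillations. $J_\nu$ is the Bessel function of the first kind of order $\nu$, and $K_\nu$ is the modified Bessel function of the second kind of order $\nu$. Every improper integral $\int_0^\infty g(x)\,\mathrm{d}x$ is defined as its Abel limit $\lim_{s\to 0^+}\int_0^\infty g(x)e^{-sx}\,\mathrm{d}x$, which is the improper integral itself when the latter exists. *)

(* Defs.v *)
From Stdlib Require Import Reals Factorial.
From Coquelicot Require Import Coquelicot.

Open Scope R_scope.

Definition Cexp (z : C) : C := (exp (Re z) * (cos (Im z), sin (Im z)))%C.

Definition Csin (z : C) : C := ((Cexp (Ci * z) - Cexp (- (Ci * z))) / (2 * Ci))%C.

(* Principal power x^a; only meaningful for x > 0. *)
Definition cpow (x : R) (a : C) : C := Cexp (a * ln x)%C.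

(* Relational limits made total by [iota]; the value is unspecified when the
   limit does not exist.  Limits at a point are Coquelicot's [C_lim]. *)
Definition C_lim_seq (u : nat -> C) : C :=
  iota (T := C_CompleteNormedModule)
    (fun l : C => filterlim u eventually (locally (T := C_UniformSpace) l)).

Definition C_Series (a : nat -> C) : C :=
  iota (T := C_CompleteNormedModule)
    (fun l : C => is_series (V := C_NormedModule) a l).

(* Rising factorial z (z + 1) ... (z + n - 1). *)
Fixpoint rising (z : C) (n : nat) : C :=
  match n with
  | O => RtoC 1
  | S m => (rising z m * (z + INR m))%C
  end.

(* The entire function 1 / Gamma, by Euler's limit
   1 / Gamma(z) = lim z (z + 1) ... (z + n) / (n! n^z);
   it vanishes at the poles 0, -1, -2, ... of Gamma. *)
Definition rGamma (z : C) : C :=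
  C_lim_seq (fun n : nat => (rising z (S n) / (INR (fact n) * cpow (INR n) z))%C).

(* The Bessel functions below have complex order and are only meaningful at
   arguments x > 0. *)
Definition besselJ (nu : C) (x : R) : C :=
  (cpow (x / 2) nu *
   C_Series (fun k : nat =>
     ((-1) ^ k * (x / 2) ^ (2 * k) / INR (fact k))%R * rGamma (nu + INR k + 1)))%C.

Definition besselI (nu : C) (x : R) : C :=
  (cpow (x / 2) nu *
   C_Series (fun k : nat =>
     ((x / 2) ^ (2 * k) / INR (fact k))%R * rGamma (nu + INR k + 1)))%C.

Definition besselK_quot (nu : C) (x : R) : C :=
  (PI / 2 * (besselI (- nu) x - besselI nu x) / Csin (nu * PI))%C.

(* At integer orders, where sin (nu PI) = 0, K is defined by the limit in the
   order. *)
Definition besselK (nu : C) (x : R) : C :=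
  if Ceq_dec (Csin (nu * PI)%C) (RtoC 0)
  then C_lim (fun nu' : C => besselK_quot nu' x) nu
  else besselK_quot nu x.

Definition analytic_at (f : C -> C) (z0 : C) : Prop :=
  exists (r : R) (a : nat -> C), 0 < r /\
    forall z : C, Cmod (z - z0) < r ->
      is_pseries (K := C_AbsRing) (V := C_NormedModule) a (z - z0)%C (f z).

(* Analytic in the open right half-plane, with boundary values f(i y), y <> 0,
   attained continuously.  Nothing is required at the origin. *)
Definition analytic_right_half_plane (f : C -> C) : Prop :=
  (forall z : C, 0 < Re z -> analytic_at f z) /\
  (forall z : C, Re z = 0 -> z <> RtoC 0 ->
     filterlim f
       (within (fun w : C => 0 <= Re w) (locally (T := C_UniformSpace) z))
       (locally (T := C_UniformSpace) (f z))).

(* [is_abel_int g l]: the integral of g over (0, +oo) has the Abel value l.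
   The integral at each s > 0 is improper at both 0 and +oo. *)
Definition is_abel_int (g : R -> C) (l : C) : Prop :=
  exists G : R -> C,
    (forall s : R, 0 < s ->
       is_RInt_gen (V := C_R_NormedModule)
         (fun x : R => (g x * exp (- (s * x)))%C)
         (at_right 0) (Rbar_locally p_infty) (G s)) /\
    filterlim G (at_right 0) (locally (T := C_UniformSpace) l).

Definition fhat (f : C -> C) (mu nu : C) (z : C) : C :=
  (/ PI * (Cexp ((mu - nu) * PI * Ci / 2) * f z
           + Cexp ((nu - mu) * PI * Ci / 2) * f (- z)))%C.

(* Main.v *)
(* For s > 0 the factor exp (- s x) makes the path of integration movable from the positive
   to the imaginary half-axis: in the variable x = exp t the rotation is Cauchy's theorem on
   a horizontal strip. On the imaginary axis the kernel itself decays, so the limit s -> 0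
   can be taken under the integral sign. For the Bessel kernel, J is split into two Hankel
   functions. Each is rotated with two integral representations, one valid in
   the right half-plane and one (that of K) valid in an upper or lower half-plane; they agree
   on the open quadrant, and the path is rotated by pi/4 with the first and by pi/4 with the
   second. The representations are tied to the power series through Hankel's loop integral
   for 1/Gamma, whose value is identified with Euler's limit by the saddle point of the
   integrand on the circle of radius n. *)
Require Import Defs.
From Stdlib Require Import Reals Lra Lia Factorial ClassicalEpsilon.
From Coquelicot Require Import Coquelicot.

Open Scope R_scope.

Set Bullet Behavior "Strict Subproofs".

(** The obstacle is the Bessel kernel. The integral over the real half-line for the Hankel function
    loses absolute convergence on the imaginary axis, and the one for K loses it on the real axis,
    so neither formula bounds the kernel on a closed quadrant; the ray of angle pi/4 lies well
    inside both domains. On the first half of the quadrant the Abel factor has modulus at most exp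
    (- s |z| / 2) and beats both f and the kernel; on the second half the decay of K beats f. Near
    the origin the kernel is bounded by |z|^(-kappa) with |Re nu| < kappa < Re mu + 1: the strict
    inequalities make all integrands decay exponentially in log |z|, and avoid the logarithm of K at
    order 0. Differentiability is taken strict, so that derivatives are continuous and Cauchy's
    theorem on a rectangle reduces to differentiation under the integral sign. For 1/Gamma,
    Stirling's bound costs a factor sqrt n, while comparison with the exact value at n + 1 gains a
    factor 1/n, so crude constants are enough. *)

(** * The complex exponential and the modulus *)

Lemma Cexp_plus (a b : C) : Cexp (a + b) = (Cexp a * Cexp b)%C.
Proof.
  destruct a as [a1 a2], b as [b1 b2]. unfold Cexp, Re, Im; simpl.
  rewrite exp_plus, cos_plus, sin_plus.
  unfold Cmult, RtoC; simpl. f_equal; ring.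
Qed.

Lemma Cexp_RtoC (x : R) : Cexp (RtoC x) = RtoC (exp x).
Proof.
  unfold Cexp, RtoC, Re, Im, Cmult; simpl. rewrite cos_0, sin_0.
  f_equal; ring.
Qed.

Lemma Cexp_0 : Cexp 0 = RtoC 1.
Proof. rewrite Cexp_RtoC, exp_0. reflexivity. Qed.

Lemma Cmod_Cexp (z : C) : Cmod (Cexp z) = exp (Re z).
Proof.
  unfold Cexp. rewrite Cmod_mult, Cmod_R, Rabs_pos_eq by (left; apply exp_pos).
  replace (Cmod (cos (Im z), sin (Im z))) with 1; [ring|].
  unfold Cmod; cbn [fst snd]. symmetry.
  replace (cos (Im z) ^ 2 + sin (Im z) ^ 2) with 1; [apply sqrt_1|].
  pose proof (sin2_cos2 (Im z)) as H. unfold Rsqr in H. lra.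
Qed.

Lemma Cexp_neq_0 (z : C) : Cexp z <> 0.
Proof.
  apply Cmod_gt_0. rewrite Cmod_Cexp. apply exp_pos.
Qed.

Lemma Cexp_opp (z : C) : Cexp (- z) = (/ Cexp z)%C.
Proof.
  assert (H : (Cexp z * Cexp (- z))%C = RtoC 1).
  { rewrite <- Cexp_plus. replace (z + - z)%C with (RtoC 0) by ring. apply Cexp_0. }
  pose proof (Cexp_neq_0 z).
  replace (Cexp (- z)) with (/ Cexp z * (Cexp z * Cexp (- z)))%C by (field; assumption).
  rewrite H. ring.
Qed.

Lemma Re_plus (a b : C) : Re (a + b) = Re a + Re b.
Proof. reflexivity. Qed.
Lemma Im_plus (a b : C) : Im (a + b) = Im a + Im b.
Proof. reflexivity. Qed.
Lemma Re_opp (a : C) : Re (- a) = - Re a.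
Proof. reflexivity. Qed.
Lemma Im_opp (a : C) : Im (- a) = - Im a.
Proof. reflexivity. Qed.
Lemma Re_mult (a b : C) : Re (a * b) = Re a * Re b - Im a * Im b.
Proof. reflexivity. Qed.
Lemma Im_mult (a b : C) : Im (a * b) = Re a * Im b + Im a * Re b.
Proof. reflexivity. Qed.
Lemma Re_RtoC (x : R) : Re (RtoC x) = x.
Proof. reflexivity. Qed.
Lemma Im_RtoC (x : R) : Im (RtoC x) = 0.
Proof. reflexivity. Qed.

Lemma im_le_Cmod (c : C) : Rabs (Im c) <= Cmod c.
Proof.
  pose proof (Rmax_Cmod c). pose proof (Rmax_r (Rabs (fst c)) (Rabs (snd c))).
  unfold Im. lra.
Qed.

Lemma Cmod_le_Re_Im (c : C) : Cmod c <= Rabs (Re c) + Rabs (Im c).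
Proof.
  replace c with (RtoC (Re c) + Ci * RtoC (Im c))%C at 1.
  - eapply Rle_trans; [apply Cmod_triangle|].
    rewrite Cmod_mult, Cmod_Ci, !Cmod_R. lra.
  - destruct c as [a b]. unfold RtoC, Ci, Cplus, Cmult, Re, Im; simpl. f_equal; ring.
Qed.

Lemma Cmod_minus_sym (a b : C) : Cmod (a - b) = Cmod (b - a).
Proof. rewrite <- Cmod_opp. f_equal. ring. Qed.

Lemma Cmod_small_eq (a b : C) : (forall eps, 0 < eps -> Cmod (a - b) <= eps) -> a = b.
Proof.
  intros H.
  assert (E : (a - b)%C = RtoC 0).
  { apply Cmod_eq_0. apply Rle_antisym; [|apply Cmod_ge_0].
    apply le_epsilon. intros e He. rewrite Rplus_0_l. apply H, He. }
  replace a with ((a - b) + b)%C by ring. rewrite E. ring.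
Qed.

(** * Continuity *)

(** Pins the structure of the target, since a pair of reals carries several canonical ones. *)
Definition ccont {U : UniformSpace} (F : U -> C) (x : U) : Prop :=
  continuous (T := U) (U := C_UniformSpace) F x.

(** The balls of [C_UniformSpace] are squares; passing to discs costs a factor sqrt 2, paid here so
    that later estimates can use [Cmod]. *)
Lemma filterlim_C_iff {T : Type} (Fi : (T -> Prop) -> Prop) (HF : Filter Fi)
  (F : T -> C) (l : C) :
  filterlim F Fi (locally (T := C_UniformSpace) l) <->
  (forall eps, 0 < eps -> Fi (fun t => Cmod (F t - l) < eps)).
Proof.
  split.
  - intros H eps He.
    assert (Hs : 0 < eps / sqrt 2) by (apply Rdiv_lt_0_compat; [lra|apply Rlt_sqrt2_0]).
    apply (H (fun y => Cmod (y - l) < eps)).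
    exists (mkposreal _ Hs). intros y Hy.
    apply C_NormedModule_mixin_compat2 in Hy. simpl in Hy.
    replace (sqrt 2 * (eps / sqrt 2)) with eps in Hy; [exact Hy|].
    field. apply Rgt_not_eq, Rlt_sqrt2_0.
  - intros H P [d Hd].
    apply filter_imp with (2 := H d (cond_pos d)).
    intros t Ht. apply Hd. apply C_NormedModule_mixin_compat1, Ht.
Qed.

Lemma ccont_iff_loc {U : UniformSpace} (F : U -> C) (x : U) :
  ccont F x <-> (forall eps, 0 < eps -> locally x (fun y => Cmod (F y - F x) < eps)).
Proof. apply filterlim_C_iff, locally_filter. Qed.

Lemma ccont_pair {U : UniformSpace} (F : U -> C) (x : U) :
  continuous (fun y => Re (F y)) x -> continuous (fun y => Im (F y)) x -> ccont F x.
Proof.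
  intros H1 H2. apply ccont_iff_loc. intros eps He.
  assert (H3 : 0 < eps / 2) by lra.
  generalize (proj1 (filterlim_locally _ _) H1 (mkposreal _ H3)).
  generalize (proj1 (filterlim_locally _ _) H2 (mkposreal _ H3)).
  intros A B. generalize (filter_and _ _ A B). apply filter_imp.
  intros y [Hy1 Hy2]. eapply Rle_lt_trans; [apply Cmod_le_Re_Im|].
  change (Rabs (Im (F y) - Im (F x)) < eps / 2) in Hy1.
  change (Rabs (Re (F y) - Re (F x)) < eps / 2) in Hy2.
  unfold Cminus. rewrite Re_plus, Im_plus, Re_opp, Im_opp.
  fold (Re (F y) - Re (F x)) (Im (F y) - Im (F x)). unfold Rminus in *. lra.
Qed.

Lemma ccont_Re {U : UniformSpace} (F : U -> C) (x : U) :
  ccont F x -> continuous (fun y => Re (F y)) x.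
Proof.
  intros H. apply filterlim_locally. intros eps.
  generalize (proj1 (ccont_iff_loc F x) H eps (cond_pos eps)). apply filter_imp.
  intros y Hy. eapply Rle_lt_trans; [|exact Hy].
  apply (re_le_Cmod (F y - F x)).
Qed.

Lemma ccont_Im {U : UniformSpace} (F : U -> C) (x : U) :
  ccont F x -> continuous (fun y => Im (F y)) x.
Proof.
  intros H. apply filterlim_locally. intros eps.
  generalize (proj1 (ccont_iff_loc F x) H eps (cond_pos eps)). apply filter_imp.
  intros y Hy. eapply Rle_lt_trans; [|exact Hy].
  apply (im_le_Cmod (F y - F x)).
Qed.

Lemma ccont_const {U : UniformSpace} (c : C) (x : U) : ccont (fun _ => c) x.
Proof. apply continuous_const. Qed.

Lemma ccont_RtoC {U : UniformSpace} (f : U -> R) (x : U) :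
  continuous f x -> ccont (fun y => RtoC (f y)) x.
Proof. intros H. apply ccont_pair; [exact H|apply continuous_const]. Qed.

Lemma ccont_plus {U : UniformSpace} (F G : U -> C) (x : U) :
  ccont F x -> ccont G x -> ccont (fun y => (F y + G y)%C) x.
Proof.
  intros H1 H2. apply ccont_pair.
  - apply (continuous_plus (V := R_NormedModule)); apply ccont_Re; assumption.
  - apply (continuous_plus (V := R_NormedModule)); apply ccont_Im; assumption.
Qed.

Lemma ccont_opp {U : UniformSpace} (F : U -> C) (x : U) :
  ccont F x -> ccont (fun y => (- F y)%C) x.
Proof.
  intros H1. apply ccont_pair.
  - apply (continuous_opp (V := R_NormedModule)); apply ccont_Re; assumption.
  - apply (continuous_opp (V := R_NormedModule)); apply ccont_Im; assumption.
Qed.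

Lemma ccont_minus {U : UniformSpace} (F G : U -> C) (x : U) :
  ccont F x -> ccont G x -> ccont (fun y => (F y - G y)%C) x.
Proof.
  intros H1 H2. apply (ccont_plus F (fun y => - G y)%C); [exact H1|].
  apply ccont_opp, H2.
Qed.

Lemma ccont_mult {U : UniformSpace} (F G : U -> C) (x : U) :
  ccont F x -> ccont G x -> ccont (fun y => (F y * G y)%C) x.
Proof.
  intros H1 H2.
  pose proof (ccont_Re _ _ H1). pose proof (ccont_Im _ _ H1).
  pose proof (ccont_Re _ _ H2). pose proof (ccont_Im _ _ H2).
  apply ccont_pair; unfold Cmult; simpl.
  - apply (continuous_minus (V := R_NormedModule)); apply (continuous_mult (K := R_AbsRing)); assumption.
  - apply (continuous_plus (V := R_NormedModule)); apply (continuous_mult (K := R_AbsRing)); assumption.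
Qed.

Lemma ccont_comp {U V : UniformSpace} (f : U -> V) (G : V -> C) (x : U) :
  continuous f x -> ccont G (f x) -> ccont (fun y => G (f y)) x.
Proof. intros H1 H2. apply (continuous_comp f G); assumption. Qed.

Lemma ccont_id (z : C) : ccont (U := C_UniformSpace) (fun y => y) z.
Proof. apply continuous_id. Qed.

Lemma ccont_RtoC_id (t : R) : ccont (U := R_UniformSpace) RtoC t.
Proof. apply (ccont_RtoC (U := R_UniformSpace) (fun y => y)). apply continuous_id. Qed.

Lemma ccont_Cexp {U : UniformSpace} (F : U -> C) (x : U) :
  ccont F x -> ccont (fun y => Cexp (F y)) x.
Proof.
  intros H. pose proof (ccont_Re _ _ H) as H1. pose proof (ccont_Im _ _ H) as H2.
  assert (E : continuous (fun y => exp (Re (F y))) x).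
  { apply (continuous_comp (fun y => Re (F y)) exp); [exact H1|].
    apply continuity_pt_filterlim, derivable_continuous_pt, derivable_pt_exp. }
  unfold Cexp. apply (ccont_mult (fun y => RtoC (exp (Re (F y))))).
  - apply ccont_RtoC, E.
  - apply ccont_pair.
    + apply (continuous_comp (fun y => Im (F y)) cos); [exact H2|].
      apply continuous_cos.
    + apply (continuous_comp (fun y => Im (F y)) sin); [exact H2|].
      apply continuous_sin.
Qed.

Lemma ccont_ext_loc {U : UniformSpace} (F G : U -> C) (x : U) :
  locally x (fun y => F y = G y) -> ccont F x -> ccont G x.
Proof.
  intros H HF. apply ccont_iff_loc. intros eps He.
  pose proof (locally_singleton _ _ H) as Hx. simpl in Hx.
  generalize (filter_and _ _ H (proj1 (ccont_iff_loc _ _) HF eps He)).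
  apply filter_imp. intros y [H1 H2]. rewrite <- H1, <- Hx. exact H2.
Qed.

Ltac cc :=
  lazymatch goal with
  | |- ccont (fun _ => Cplus _ _) _ => apply ccont_plus; cc
  | |- ccont (fun _ => Cminus _ _) _ => apply ccont_minus; cc
  | |- ccont (fun _ => Copp _) _ => apply ccont_opp; cc
  | |- ccont (fun _ => Cmult _ _) _ => apply ccont_mult; cc
  | |- ccont (fun _ => Cexp _) _ => apply ccont_Cexp; cc
  | |- ccont (fun _ => ?c) _ => apply ccont_const
  | |- ccont (fun y => y) _ => apply ccont_id
  | |- ccont (fun y => RtoC y) _ => apply ccont_RtoC_id
  | |- ccont RtoC _ => apply ccont_RtoC_id
  | _ => try assumption
  end.

(** * Integrals of complex-valued functions over compact intervals *)

(** Componentwise, so that the real theorems on primitives, substitution and parameters transfer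
    through [Re] and [Im]. *)
Definition CInt (F : R -> C) (a b : R) : C :=
  (RInt (fun t => Re (F t)) a b, RInt (fun t => Im (F t)) a b).

Definition cont_on (F : R -> C) (a b : R) : Prop :=
  forall t, Rmin a b <= t <= Rmax a b -> ccont F t.

Lemma CInt_correct_parts (F : R -> C) (a b : R) : cont_on F a b ->
  is_RInt (fun t => Re (F t)) a b (Re (CInt F a b)) /\
  is_RInt (fun t => Im (F t)) a b (Im (CInt F a b)).
Proof.
  intros H; split; apply (RInt_correct (V := R_CompleteNormedModule)), ex_RInt_continuous;
    intros t Ht; [apply ccont_Re|apply ccont_Im]; apply H, Ht.
Qed.

Lemma CInt_correct (F : R -> C) (a b : R) : cont_on F a b ->
  is_RInt (V := C_R_NormedModule) F a b (CInt F a b).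
Proof.
  intros H. destruct (CInt_correct_parts F a b H) as [H1 H2].
  apply (is_RInt_fct_extend_pair (U := R_NormedModule) (V := R_NormedModule) F a b _ _ H1 H2).
Qed.

Lemma CInt_unique (F : R -> C) (a b : R) (l : C) :
  is_RInt (fun t => Re (F t)) a b (Re l) -> is_RInt (fun t => Im (F t)) a b (Im l) ->
  CInt F a b = l.
Proof.
  intros H1 H2. unfold CInt.
  rewrite (is_RInt_unique _ _ _ _ H1), (is_RInt_unique _ _ _ _ H2).
  destruct l; reflexivity.
Qed.

Lemma CInt_ext (F G : R -> C) (a b : R) :
  (forall t, Rmin a b < t < Rmax a b -> F t = G t) -> CInt F a b = CInt G a b.
Proof.
  intros H. unfold CInt. f_equal; apply RInt_ext; intros t Ht; rewrite H; auto.
Qed.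

Lemma CInt_plus (F G : R -> C) (a b : R) : cont_on F a b -> cont_on G a b ->
  CInt (fun t => F t + G t)%C a b = (CInt F a b + CInt G a b)%C.
Proof.
  intros HF HG. destruct (CInt_correct_parts _ _ _ HF), (CInt_correct_parts _ _ _ HG).
  apply CInt_unique; apply (is_RInt_plus (V := R_NormedModule)); assumption.
Qed.

Lemma CInt_scal (c : C) (F : R -> C) (a b : R) : cont_on F a b ->
  CInt (fun t => c * F t)%C a b = (c * CInt F a b)%C.
Proof.
  intros HF. destruct (CInt_correct_parts _ _ _ HF) as [H1 H2].
  apply CInt_unique.
  - apply (is_RInt_minus (V := R_NormedModule));
      apply (is_RInt_scal (V := R_NormedModule)); assumption.
  - apply (is_RInt_plus (V := R_NormedModule));
      apply (is_RInt_scal (V := R_NormedModule)); assumption.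
Qed.

Lemma cont_on_scal (c : C) (F : R -> C) (a b : R) : cont_on F a b ->
  cont_on (fun t => c * F t)%C a b.
Proof. intros H t Ht. apply ccont_mult; [apply ccont_const|apply H, Ht]. Qed.

Lemma CInt_minus (F G : R -> C) (a b : R) : cont_on F a b -> cont_on G a b ->
  CInt (fun t => F t - G t)%C a b = (CInt F a b - CInt G a b)%C.
Proof.
  intros HF HG.
  rewrite (CInt_ext _ (fun t => F t + (-(1)) * G t)%C) by (intros; ring).
  rewrite CInt_plus, CInt_scal; [ring| | |apply cont_on_scal]; assumption.
Qed.

Lemma CInt_Chasles (F : R -> C) (a b c : R) : cont_on F a b -> cont_on F b c ->
  (CInt F a b + CInt F b c)%C = CInt F a c.
Proof.
  intros HF HG. destruct (CInt_correct_parts _ _ _ HF), (CInt_correct_parts _ _ _ HG).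
  symmetry. apply CInt_unique; eapply (is_RInt_Chasles (V := R_NormedModule)); eassumption.
Qed.

Lemma CInt_point (F : R -> C) (a : R) : CInt F a a = 0.
Proof. unfold CInt. rewrite !RInt_point. reflexivity. Qed.

Lemma norm_C_R (z : C) : norm (K := R_AbsRing) (V := C_R_NormedModule) z = Cmod z.
Proof.
  unfold Cmod. rewrite <- (pow2_abs (fst z)), <- (pow2_abs (snd z)). reflexivity.
Qed.

Lemma CInt_bound (F : R -> C) (g : R -> R) (a b lg : R) : a <= b -> cont_on F a b ->
  (forall t, a <= t <= b -> Cmod (F t) <= g t) -> is_RInt g a b lg ->
  Cmod (CInt F a b) <= lg.
Proof.
  intros Hab HF Hb Hg. rewrite <- norm_C_R.
  apply (norm_RInt_le (V := C_R_NormedModule) F g a b); try assumption.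
  - intros t Ht. rewrite norm_C_R. apply Hb, Ht.
  - apply CInt_correct, HF.
Qed.

Lemma CInt_bound_const (F : R -> C) (M a b : R) : a <= b -> cont_on F a b ->
  (forall t, a <= t <= b -> Cmod (F t) <= M) -> Cmod (CInt F a b) <= (b - a) * M.
Proof.
  intros Hab HF Hb. apply (CInt_bound F (fun _ => M) a b); try assumption.
  apply (is_RInt_const (V := R_NormedModule)).
Qed.

Definition cderiv (F : R -> C) (t : R) (l : C) : Prop :=
  is_derive (fun u => Re (F u)) t (Re l) /\ is_derive (fun u => Im (F u)) t (Im l).

Lemma CInt_FTC (F dF : R -> C) (a b : R) :
  (forall t, Rmin a b <= t <= Rmax a b -> cderiv F t (dF t)) -> cont_on dF a b ->
  CInt dF a b = (F b - F a)%C.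
Proof.
  intros H Hc. apply CInt_unique.
  - apply (is_RInt_derive (V := R_CompleteNormedModule) (fun u => Re (F u)));
      intros t Ht; [apply H, Ht|apply ccont_Re, Hc, Ht].
  - apply (is_RInt_derive (V := R_CompleteNormedModule) (fun u => Im (F u)));
      intros t Ht; [apply H, Ht|apply ccont_Im, Hc, Ht].
Qed.

Lemma CInt_comp_lin (F : R -> C) (u v a b : R) : cont_on F (u * a + v) (u * b + v) ->
  CInt (fun t => RtoC u * F (u * t + v)%R)%C a b = CInt F (u * a + v) (u * b + v).
Proof.
  intros HF. destruct (CInt_correct_parts _ _ _ HF) as [H1 H2].
  apply CInt_unique.
  - apply is_RInt_ext with (2 := is_RInt_comp_lin (V := R_NormedModule) _ _ _ _ _ _ H1).
    intros t _. unfold Re, scal; simpl. unfold mult; simpl. ring.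
  - apply is_RInt_ext with (2 := is_RInt_comp_lin (V := R_NormedModule) _ _ _ _ _ _ H2).
    intros t _. unfold Im, scal; simpl. unfold mult; simpl. ring.
Qed.

Lemma cderiv_plus F G t l m : cderiv F t l -> cderiv G t m ->
  cderiv (fun u => F u + G u)%C t (l + m)%C.
Proof.
  intros [H1 H2] [H3 H4]; split; apply (is_derive_plus (V := R_NormedModule)); assumption.
Qed.

Lemma cderiv_mult F G t l m : cderiv F t l -> cderiv G t m ->
  cderiv (fun u => F u * G u)%C t (l * G t + F t * m)%C.
Proof.
  intros [H1 H2] [H3 H4]; split.
  - replace (Re (l * G t + F t * m)%C) with
      (minus (plus (mult (Re l) (Re (G t))) (mult (Re (F t)) (Re m)))
             (plus (mult (Im l) (Im (G t))) (mult (Im (F t)) (Im m)))).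
    + apply (is_derive_minus (V := R_NormedModule));
        apply (is_derive_mult (K := R_AbsRing)); try assumption; intros; apply Rmult_comm.
    + rewrite Re_plus, !Re_mult. unfold minus, plus, opp, mult; simpl. ring.
  - replace (Im (l * G t + F t * m)%C) with
      (plus (plus (mult (Re l) (Im (G t))) (mult (Re (F t)) (Im m)))
             (plus (mult (Im l) (Re (G t))) (mult (Im (F t)) (Re m)))).
    + apply (is_derive_plus (V := R_NormedModule));
        apply (is_derive_mult (K := R_AbsRing)); try assumption; intros; apply Rmult_comm.
    + rewrite Im_plus, !Im_mult. unfold plus, mult; simpl. ring.
Qed.

Lemma cderiv_const c t : cderiv (fun _ => c) t 0.
Proof. split; apply (is_derive_const (K := R_AbsRing) (V := R_NormedModule)). Qed.

Lemma cderiv_RtoC (r : R -> R) (t l : R) : is_derive r t l -> cderiv (fun u => RtoC (r u)) t (RtoC l).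
Proof.
  intros H; split; [exact H|].
  apply (is_derive_const (K := R_AbsRing) (V := R_NormedModule) 0 t).
Qed.

Lemma cderiv_eq F t l m : cderiv F t l -> l = m -> cderiv F t m.
Proof. intros H <-; exact H. Qed.

Lemma cderiv_ext F G t l : (forall u, F u = G u) -> cderiv F t l -> cderiv G t l.
Proof.
  intros E [H1 H2]; split; eapply is_derive_ext; try eassumption;
    intros u; simpl; rewrite E; reflexivity.
Qed.

Lemma cderiv_Cexp F t l : cderiv F t l -> cderiv (fun u => Cexp (F u)) t (l * Cexp (F t))%C.
Proof.
  intros [H1 H2].
  assert (A : forall g dg, is_derive g t dg -> is_derive (fun u => exp (g u)) t (dg * exp (g t))).
  { intros g dg Hg. apply (is_derive_comp exp g t); [apply is_derive_exp|exact Hg]. }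
  unfold Cexp.
  apply cderiv_eq with
    (RtoC (Re l * exp (Re (F t))) * (cos (Im (F t)), sin (Im (F t))) +
     RtoC (exp (Re (F t))) * ((- (Im l * sin (Im (F t))))%R, (Im l * cos (Im (F t)))%R))%C.
  - apply (cderiv_mult (fun u => RtoC (exp (Re (F u)))) (fun u => (cos (Im (F u)), sin (Im (F u))))).
    + apply cderiv_RtoC, A, H1.
    + split; simpl.
      * replace (- (Im l * sin (Im (F t)))) with (scal (Im l) (- sin (Im (F t))))
          by (unfold scal; simpl; unfold mult; simpl; ring).
        apply (is_derive_comp cos (fun u => Im (F u)) t); [apply is_derive_cos|exact H2].
      * apply (is_derive_comp sin (fun u => Im (F u)) t); [apply is_derive_sin|exact H2].
  - destruct l as [l1 l2]. destruct (F t) as [a b].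
    unfold RtoC, Cplus, Cmult, Re, Im; simpl. f_equal; ring.
Qed.

Lemma cderiv_lin (w : C) t : cderiv (fun u => RtoC u * w)%C t w.
Proof.
  eapply cderiv_eq.
  - apply cderiv_mult; [apply cderiv_RtoC, (is_derive_id (K := R_AbsRing))|apply cderiv_const].
  - unfold one; simpl. ring.
Qed.

(** * Taylor polynomials of the exponential and their remainders *)

Fixpoint etaylor (N : nat) (w : C) : C :=
  match N with
  | O => RtoC 1
  | S m => (etaylor m w + / INR (fact (S m)) * w ^ S m)%C
  end.

Lemma ccont_Cpow {U : UniformSpace} (F : U -> C) n x : ccont F x -> ccont (fun y => F y ^ n)%C x.
Proof.
  intros H; induction n as [|n IH]; [apply ccont_const|].
  apply (ccont_mult F (fun y => F y ^ n)%C); assumption.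
Qed.

Lemma ccont_etaylor {U : UniformSpace} (F : U -> C) n x :
  ccont F x -> ccont (fun y => etaylor n (F y)) x.
Proof.
  intros H; induction n as [|n IH]; [apply ccont_const|].
  apply (ccont_plus (fun y => etaylor n (F y))); [exact IH|].
  apply ccont_mult; [apply ccont_const|apply ccont_Cpow, H].
Qed.

Lemma INR_fact_pos n : 0 < INR (fact n).
Proof. apply INR_fact_lt_0. Qed.

Lemma RtoC_neq_0 x : x <> 0 -> RtoC x <> RtoC 0.
Proof. intros H E. apply H. injection E; auto. Qed.

Lemma cderiv_etaylor (w : C) N t :
  cderiv (fun u => etaylor (S N) (RtoC u * w)) t (w * etaylor N (RtoC t * w))%C.
Proof.
  induction N as [|N IH].
  - eapply cderiv_eq.
    + simpl etaylor. apply cderiv_plus; [apply cderiv_const|].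
      apply cderiv_mult; [apply cderiv_const|].
      apply (cderiv_mult (fun u => RtoC u * w)%C); [apply cderiv_lin|apply cderiv_const].
    + simpl. field.
  - eapply cderiv_eq.
    + change (fun u => etaylor (S (S N)) (RtoC u * w)) with
        (fun u => etaylor (S N) (RtoC u * w) + / INR (fact (S (S N))) * (RtoC u * w) ^ S (S N))%C.
      apply cderiv_plus; [exact IH|].
      apply cderiv_mult; [apply cderiv_const|].
      apply cderiv_ext with (fun u => RtoC (u ^ S (S N)) * w ^ S (S N))%C.
      { intros u. rewrite Cpow_mult_l, RtoC_pow. reflexivity. }
      apply cderiv_mult; [|apply cderiv_const].
      apply (cderiv_RtoC (fun u => u ^ S (S N)) t (INR (S (S N)) * t ^ S N)).
      auto_derive; [exact I|]. simpl. ring.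
    +      change (etaylor (S N) (RtoC t * w)) with (etaylor N (RtoC t * w) + / INR (fact (S N)) * (RtoC t * w) ^ S N)%C.
      rewrite Cpow_mult_l.
      rewrite (fact_simpl (S N)), mult_INR.
      pose proof (INR_fact_pos (S N)) as Hf.
      assert (Hn : INR (S (S N)) <> 0) by (apply not_0_INR; discriminate).
      rewrite !RtoC_mult, !RtoC_pow.
      change (w ^ S (S N))%C with (w * w ^ S N)%C.
      apply RtoC_neq_0 in Hn. field. split; [apply RtoC_neq_0; lra|exact Hn].
Qed.

Lemma etaylor_0 N : etaylor N 0 = RtoC 1.
Proof.
  induction N as [|N IH]; [reflexivity|]. simpl. rewrite IH. ring.
Qed.

(** [E w] is the integral of its derivative along the segment from 0 to [w]. Integrating t^n yields
    the divisor n + 1, which is how the factorial builds up in [etaylor_remainder]. *)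
Lemma segment_bound (E dE : C -> C) (w : C) M n : E 0 = 0 ->
  (forall t, cderiv (fun u => E (RtoC u * w)%C) t (w * dE (RtoC t * w))%C) ->
  (forall t, ccont (U := R_UniformSpace) (fun u => dE (RtoC u * w)%C) t) ->
  (forall t, 0 <= t <= 1 -> Cmod (dE (RtoC t * w)%C) <= t ^ n * M) ->
  Cmod (E w) <= Cmod w * (M / INR (S n)).
Proof.
  intros E0 HE Hc HB.
  assert (Hco : cont_on (fun t => w * dE (RtoC t * w))%C 0 1).
  { intros t _. apply ccont_mult; [apply ccont_const|apply Hc]. }
  replace (E w) with (CInt (fun t => w * dE (RtoC t * w))%C 0 1).
  - apply (CInt_bound _ (fun t => Cmod w * (t ^ n * M))); [lra|exact Hco| |].
    + intros t Ht. rewrite Cmod_mult. apply Rmult_le_compat_l; [apply Cmod_ge_0|apply HB, Ht].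
    + assert (Hn : INR (S n) <> 0) by (apply not_0_INR; discriminate).
      replace (Cmod w * (M / INR (S n))) with
        (minus (Cmod w * (M / INR (S n)) * 1 ^ S n) (Cmod w * (M / INR (S n)) * 0 ^ S n)).
      2:{ rewrite pow1, pow_ne_zero by discriminate. unfold minus, plus, opp; simpl. ring. }
      apply (is_RInt_derive (V := R_CompleteNormedModule) (fun t => Cmod w * (M / INR (S n)) * t ^ S n)).
      * intros t _. auto_derive; [exact I|]. simpl pred. field. exact Hn.
      * intros t _. apply (ex_derive_continuous (V := R_NormedModule)). auto_derive. exact I.
  - rewrite (CInt_FTC (fun t => E (RtoC t * w)%C)); [|intros; apply HE|exact Hco].
    replace (RtoC 1 * w)%C with w by ring. replace (RtoC 0 * w)%C with (RtoC 0) by ring.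
    rewrite E0. ring.
Qed.

Lemma exp_mono x y : x <= y -> exp x <= exp y.
Proof. intros [H|H]; [left; apply exp_increasing, H|right; f_equal; exact H]. Qed.

Lemma Cmod_Cexp_le (v : C) : Cmod (Cexp v) <= exp (Cmod v).
Proof.
  rewrite Cmod_Cexp. apply exp_mono. eapply Rle_trans; [apply Rle_abs|apply re_le_Cmod].
Qed.

Lemma Cmod_scal_le (t : R) (w : C) : 0 <= t <= 1 -> Cmod (RtoC t * w) <= Cmod w.
Proof.
  intros Ht. rewrite Cmod_mult, Cmod_R, Rabs_pos_eq by lra.
  pose proof (Cmod_ge_0 w). nra.
Qed.

(** Along the segment, the derivative of the remainder of order N + 1 is [w] times the remainder of
    order N, so [segment_bound] carries the induction. *)
Lemma etaylor_remainder N (w : C) :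
  Cmod (Cexp w - etaylor N w) <= Cmod w ^ S N / INR (fact (S N)) * exp (Cmod w).
Proof.
  revert w; induction N as [|N IH]; intros w.
  - eapply Rle_trans.
    + apply (segment_bound (fun v => Cexp v - etaylor 0 v)%C Cexp w (exp (Cmod w)) 0%nat).
      * rewrite Cexp_0. simpl. ring.
      * intros t. eapply cderiv_eq.
        -- apply cderiv_plus; [apply cderiv_Cexp, cderiv_lin|apply (cderiv_const (- RtoC 1))].
        -- cbv beta; ring.
      * intros t. cc.
      * intros t Ht. eapply Rle_trans; [apply Cmod_Cexp_le|]. rewrite pow_O, Rmult_1_l.
        apply exp_mono, Cmod_scal_le, Ht.
    + simpl. lra.
  - eapply Rle_trans.
    + apply (segment_bound (fun v => Cexp v - etaylor (S N) v)%C (fun v => Cexp v - etaylor N v)%C w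
               (Cmod w ^ S N / INR (fact (S N)) * exp (Cmod w)) (S N)).
      * rewrite Cexp_0, etaylor_0. ring.
      * intros t. apply cderiv_eq with (w * Cexp (RtoC t * w) + (- RtoC 1) * (w * etaylor N (RtoC t * w)))%C.
        2: ring.
        apply cderiv_ext with (fun u => Cexp (RtoC u * w) + (- RtoC 1) * etaylor (S N) (RtoC u * w))%C.
        { intros u. ring. }
        apply cderiv_plus; [apply cderiv_Cexp, cderiv_lin|].
        eapply cderiv_eq; [apply cderiv_mult; [apply cderiv_const|apply cderiv_etaylor]|cbv beta; ring].
      * intros t. apply ccont_minus; [cc|]. apply ccont_etaylor. cc.
      * intros t Ht. eapply Rle_trans; [apply IH|].
        rewrite Cmod_mult, Cmod_R, Rabs_pos_eq, Rpow_mult_distr by lra.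
        unfold Rdiv. rewrite !Rmult_assoc.
        apply Rmult_le_compat_l; [apply pow_le; lra|].
        apply Rmult_le_compat_l; [apply pow_le, Cmod_ge_0|].
        apply Rmult_le_compat_l; [left; apply Rinv_0_lt_compat, INR_fact_pos|].
        apply exp_mono. pose proof (Cmod_ge_0 w). nra.
    + right. rewrite (fact_simpl (S N)), mult_INR.
      assert (Hn : INR (S (S N)) <> 0) by (apply not_0_INR; discriminate).
      pose proof (INR_fact_pos (S N)).
      simpl pow. field. split; [lra|exact Hn].
Qed.

Lemma Cexp_minus_1_bound (w : C) : Cmod (Cexp w - 1) <= Cmod w * exp (Cmod w).
Proof.
  pose proof (etaylor_remainder 0 w) as H. simpl in H. lra.
Qed.

Lemma Cexp_minus_lin_bound (w : C) : Cmod (Cexp w - 1 - w) <= Cmod w ^ 2 * exp (Cmod w).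
Proof.
  pose proof (etaylor_remainder 1 w) as H.
  replace (Cexp w - 1 - w)%C with (Cexp w - etaylor 1 w)%C.
  - eapply Rle_trans; [exact H|]. apply Rmult_le_compat_r; [left; apply exp_pos|].
    simpl. nra.
  - simpl. field.
Qed.

Lemma Cexp_diff_bound (u v : C) :
  Cmod (Cexp u - Cexp v) <= Cmod (u - v) * exp (Re v + Cmod (u - v)).
Proof.
  replace (Cexp u - Cexp v)%C with (Cexp v * (Cexp (u - v) - 1))%C.
  - rewrite Cmod_mult, Cmod_Cexp, exp_plus.
    pose proof (Cexp_minus_1_bound (u - v)). pose proof (exp_pos (Re v)). nra.
  - replace (Cexp u) with (Cexp (v + (u - v))) by (f_equal; ring).
    rewrite Cexp_plus. ring.
Qed.

(** * Strict complex differentiability *)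

(* Strict differentiability at every point of an open set contains the continuity
   of the derivative, and is stable under products and compositions. *)
Definition sdiff (g : C -> C) (z l : C) : Prop :=
  forall eps, 0 < eps -> exists d, 0 < d /\ forall u v : C,
    Cmod (u - z) < d -> Cmod (v - z) < d ->
    Cmod (g u - g v - l * (u - v)) <= eps * Cmod (u - v).

Definition hol (g : C -> C) (z : C) : Prop := exists l, sdiff g z l.

Lemma Cmod_minus_self (z : C) d : 0 < d -> Cmod (z - z) < d.
Proof. intros H. replace (z - z)%C with (RtoC 0) by ring. rewrite Cmod_0. exact H. Qed.

Lemma sdiff_lip g z l : sdiff g z l -> exists d, 0 < d /\ forall u v : C,
  Cmod (u - z) < d -> Cmod (v - z) < d -> Cmod (g u - g v) <= (Cmod l + 1) * Cmod (u - v).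
Proof.
  intros H. destruct (H 1 Rlt_0_1) as [d [Hd Hu]]. exists d; split; [exact Hd|].
  intros u v H1 H2. specialize (Hu u v H1 H2).
  pose proof (Cmod_triangle (g u - g v - l * (u - v)) (l * (u - v))) as T.
  replace (g u - g v - l * (u - v) + l * (u - v))%C with (g u - g v)%C in T by ring.
  rewrite Cmod_mult in T. lra.
Qed.

Lemma locally_Cmod (z : C) (P : C -> Prop) :
  locally (T := C_UniformSpace) z P <-> exists d, 0 < d /\ forall w, Cmod (w - z) < d -> P w.
Proof.
  split.
  - intros H.
    assert (F : filterlim (fun w : C => w) (locally (T := C_UniformSpace) z) (locally (T := C_UniformSpace) z))
      by apply filterlim_id.
    destruct H as [d Hd].
    assert (Hs : 0 < d / 2) by (apply Rdiv_lt_0_compat; [apply cond_pos|lra]).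
    exists (d / 2); split; [exact Hs|]. intros w Hw. apply Hd.
    apply C_NormedModule_mixin_compat1.
    change (Cmod (w - z) < d). lra.
  - intros [d [Hd H]].
    assert (Hs : 0 < d / sqrt 2) by (apply Rdiv_lt_0_compat; [lra|apply Rlt_sqrt2_0]).
    exists (mkposreal _ Hs). intros y Hy. apply H.
    apply C_NormedModule_mixin_compat2 in Hy. simpl in Hy.
    replace (sqrt 2 * (d / sqrt 2)) with d in Hy; [exact Hy|].
    field. apply Rgt_not_eq, Rlt_sqrt2_0.
Qed.

Lemma sdiff_close g z l : sdiff g z l -> forall eps, 0 < eps ->
  exists d, 0 < d /\ forall u, Cmod (u - z) < d -> Cmod (g u - g z) < eps.
Proof.
  intros H eps He. destruct (sdiff_lip _ _ _ H) as [d [Hd Hu]].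
  pose proof (Cmod_ge_0 l) as Hl.
  assert (Hp : 0 < eps / (Cmod l + 1)) by (apply Rdiv_lt_0_compat; lra).
  exists (Rmin d (eps / (Cmod l + 1))); split; [apply Rmin_pos; assumption|].
  intros u Hdu.
  pose proof (Rmin_l d (eps / (Cmod l + 1))). pose proof (Rmin_r d (eps / (Cmod l + 1))).
  eapply Rle_lt_trans; [apply Hu; [lra|apply Cmod_minus_self, Hd]|].
  apply Rlt_le_trans with ((Cmod l + 1) * (eps / (Cmod l + 1))).
  - apply Rmult_lt_compat_l; lra.
  - right. field. lra.
Qed.

Lemma hol_ccont g z : hol g z -> ccont g z.
Proof.
  intros [l H]. apply (ccont_iff_loc (U := C_UniformSpace)). intros eps He.
  apply locally_Cmod. apply (sdiff_close g z l H eps He).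
Qed.

Lemma hol_ext_loc g h z :
  (exists d, 0 < d /\ forall w, Cmod (w - z) < d -> g w = h w) -> hol g z -> hol h z.
Proof.
  intros [d [Hd E]] [l H]. exists l. intros eps He.
  destruct (H eps He) as [d' [Hd' A]]. exists (Rmin d d'); split; [apply Rmin_pos; assumption|].
  intros u v Hu Hv. pose proof (Rmin_l d d'). pose proof (Rmin_r d d').
  rewrite <- !E by lra. apply A; lra.
Qed.

Lemma hol_const c z : hol (fun _ => c) z.
Proof.
  exists 0. intros eps He. exists 1; split; [lra|]. intros u v _ _.
  replace (c - c - 0 * (u - v))%C with (RtoC 0) by ring. rewrite Cmod_0.
  apply Rmult_le_pos; [lra|apply Cmod_ge_0].
Qed.

Lemma hol_id z : hol (fun w => w) z.
Proof.
  exists 1. intros eps He. exists 1; split; [lra|]. intros u v _ _.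
  replace (u - v - 1 * (u - v))%C with (RtoC 0) by ring. rewrite Cmod_0.
  apply Rmult_le_pos; [lra|apply Cmod_ge_0].
Qed.

Lemma hol_plus g h z : hol g z -> hol h z -> hol (fun w => g w + h w)%C z.
Proof.
  intros [l H1] [m H2]. exists (l + m)%C. intros eps He.
  assert (He2 : 0 < eps / 2) by lra.
  destruct (H1 _ He2) as [d1 [Hd1 A1]]. destruct (H2 _ He2) as [d2 [Hd2 A2]].
  exists (Rmin d1 d2); split; [apply Rmin_pos; assumption|]. intros u v Hu Hv.
  pose proof (Rmin_l d1 d2). pose proof (Rmin_r d1 d2).
  replace (g u + h u - (g v + h v) - (l + m) * (u - v))%C with
    ((g u - g v - l * (u - v)) + (h u - h v - m * (u - v)))%C by ring.
  eapply Rle_trans; [apply Cmod_triangle|].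
  specialize (A1 u v ltac:(lra) ltac:(lra)). specialize (A2 u v ltac:(lra) ltac:(lra)). lra.
Qed.

Lemma hol_mult g h z : hol g z -> hol h z -> hol (fun w => g w * h w)%C z.
Proof.
  intros [l H1] [m H2]. exists (l * h z + g z * m)%C. intros eps He.
  (* The error splits into four terms, each at most [e * N * Cmod (u - v)]; the summand 2 in [N]
     leaves room for the variation of [g] and [h] near [z]. *)
  set (N := Cmod l + Cmod m + Cmod (g z) + Cmod (h z) + 2).
  pose proof (Cmod_ge_0 l). pose proof (Cmod_ge_0 m).
  pose proof (Cmod_ge_0 (g z)). pose proof (Cmod_ge_0 (h z)).
  assert (HN : 0 < N) by (unfold N; lra).
  set (e := Rmin 1 (eps / (4 * N))).
  assert (He' : 0 < e) by (apply Rmin_pos; [lra|apply Rdiv_lt_0_compat; lra]).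
  assert (He1 : e <= 1) by apply Rmin_l.
  assert (He2 : 4 * (e * N) <= eps).
  { assert (e <= eps / (4 * N)) by apply Rmin_r.
    replace eps with (4 * (eps / (4 * N) * N)) by (field; lra).
    apply Rmult_le_compat_l; [lra|]. apply Rmult_le_compat_r; lra. }
  destruct (H1 _ He') as [d1 [Hd1 A1]]. destruct (H2 _ He') as [d2 [Hd2 A2]].
  destruct (sdiff_close _ _ _ H1 _ He') as [d3 [Hd3 A3]].
  destruct (sdiff_close _ _ _ H2 _ He') as [d4 [Hd4 A4]].
  exists (Rmin (Rmin d1 d2) (Rmin d3 d4)); split; [repeat apply Rmin_pos; assumption|].
  intros u v Hu Hv.
  pose proof (Rmin_l d1 d2). pose proof (Rmin_r d1 d2).
  pose proof (Rmin_l d3 d4). pose proof (Rmin_r d3 d4).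
  pose proof (Rmin_l (Rmin d1 d2) (Rmin d3 d4)). pose proof (Rmin_r (Rmin d1 d2) (Rmin d3 d4)).
  specialize (A1 u v ltac:(lra) ltac:(lra)). specialize (A2 u v ltac:(lra) ltac:(lra)).
  pose proof (A3 v ltac:(lra)) as A3v.
  pose proof (A4 u ltac:(lra)) as A4u.
  assert (Bh : Cmod (h u) <= N).
  { pose proof (Cmod_triangle (h u - h z) (h z)) as T.
    replace (h u - h z + h z)%C with (h u) in T by ring. unfold N; lra. }
  assert (Bg : Cmod (g v) <= N).
  { pose proof (Cmod_triangle (g v - g z) (g z)) as T.
    replace (g v - g z + g z)%C with (g v) in T by ring. unfold N; lra. }
  replace (g u * h u - g v * h v - (l * h z + g z * m) * (u - v))%C with
    ((g u - g v - l * (u - v)) * h u + (h u - h z) * (l * (u - v))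
     + (h u - h v - m * (u - v)) * g v + (g v - g z) * (m * (u - v)))%C by ring.
  set (D := Cmod (u - v)) in *. assert (HD : 0 <= D) by apply Cmod_ge_0.
  assert (T1 : Cmod ((g u - g v - l * (u - v)) * h u) <= e * D * N).
  { rewrite Cmod_mult. apply Rmult_le_compat; try apply Cmod_ge_0; assumption. }
  assert (T2 : Cmod ((h u - h z) * (l * (u - v))) <= e * (N * D)).
  { rewrite !Cmod_mult. apply Rmult_le_compat; try apply Cmod_ge_0; [|lra|].
    - apply Rmult_le_pos; apply Cmod_ge_0.
    - apply Rmult_le_compat_r; [exact HD|unfold N; lra]. }
  assert (T3 : Cmod ((h u - h v - m * (u - v)) * g v) <= e * D * N).
  { rewrite Cmod_mult. apply Rmult_le_compat; try apply Cmod_ge_0; assumption. }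
  assert (T4 : Cmod ((g v - g z) * (m * (u - v))) <= e * (N * D)).
  { rewrite !Cmod_mult. apply Rmult_le_compat; try apply Cmod_ge_0; [|lra|].
    - apply Rmult_le_pos; apply Cmod_ge_0.
    - apply Rmult_le_compat_r; [exact HD|unfold N; lra]. }
  eapply Rle_trans; [apply Cmod_triangle|].
  eapply Rle_trans; [apply Rplus_le_compat_r, Cmod_triangle|].
  eapply Rle_trans; [apply Rplus_le_compat_r, Rplus_le_compat_r, Cmod_triangle|].
  apply Rle_trans with (4 * (e * N) * D); [lra|]. apply Rmult_le_compat_r; assumption.
Qed.

Lemma hol_opp g z : hol g z -> hol (fun w => - g w)%C z.
Proof.
  intros H. apply hol_ext_loc with (fun w => (- RtoC 1) * g w)%C.
  - exists 1; split; [lra|]. intros; ring.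
  - apply hol_mult; [apply hol_const|exact H].
Qed.

Lemma hol_minus g h z : hol g z -> hol h z -> hol (fun w => g w - h w)%C z.
Proof. intros H1 H2. apply (hol_plus g (fun w => - h w)%C); [exact H1|apply hol_opp, H2]. Qed.

Lemma hol_comp f g z : hol f (g z) -> hol g z -> hol (fun w => f (g w)) z.
Proof.
  intros [L H1] [l H2]. exists (L * l)%C. intros eps He.
  pose proof (Cmod_ge_0 L). pose proof (Cmod_ge_0 l).
  assert (He1 : 0 < eps / 2 / (Cmod l + 1)) by (apply Rdiv_lt_0_compat; lra).
  assert (He2 : 0 < eps / 2 / (Cmod L + 1)) by (apply Rdiv_lt_0_compat; lra).
  destruct (H1 _ He1) as [d1 [Hd1 A1]]. destruct (H2 _ He2) as [d2 [Hd2 A2]].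
  destruct (sdiff_close _ _ _ H2 _ Hd1) as [d3 [Hd3 A3]].
  destruct (sdiff_lip _ _ _ H2) as [d4 [Hd4 A4]].
  exists (Rmin d2 (Rmin d3 d4)); split; [repeat apply Rmin_pos; assumption|].
  intros u v Hu Hv.
  pose proof (Rmin_l d3 d4). pose proof (Rmin_r d3 d4).
  pose proof (Rmin_l d2 (Rmin d3 d4)). pose proof (Rmin_r d2 (Rmin d3 d4)).
  specialize (A1 (g u) (g v) (A3 u ltac:(lra)) (A3 v ltac:(lra))).
  specialize (A2 u v ltac:(lra) ltac:(lra)). specialize (A4 u v ltac:(lra) ltac:(lra)).
  replace (f (g u) - f (g v) - L * l * (u - v))%C with
    ((f (g u) - f (g v) - L * (g u - g v)) + L * (g u - g v - l * (u - v)))%C by ring.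
  eapply Rle_trans; [apply Cmod_triangle|]. rewrite Cmod_mult.
  set (D := Cmod (u - v)) in *.
  assert (T1 : Cmod (f (g u) - f (g v) - L * (g u - g v)) <= eps / 2 * D).
  { eapply Rle_trans; [exact A1|].
    apply Rle_trans with (eps / 2 / (Cmod l + 1) * ((Cmod l + 1) * D)).
    - apply Rmult_le_compat_l; lra.
    - right. field. lra. }
  assert (T2 : Cmod L * Cmod (g u - g v - l * (u - v)) <= eps / 2 * D).
  { apply Rle_trans with ((Cmod L + 1) * (eps / 2 / (Cmod L + 1) * D)).
    - apply Rmult_le_compat; try apply Cmod_ge_0; lra.
    - right. field. lra. }
  lra.
Qed.

Lemma hol_Cexp z : hol Cexp z.
Proof.
  exists (Cexp z). intros eps He.
  set (A := exp (Re z)). assert (HA : 0 < A) by apply exp_pos.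
  set (B := A * exp 2 * exp 2 * 4 + 1).
  pose proof (exp_pos 2) as E2.
  assert (HAE : 0 < A * exp 2) by (apply Rmult_lt_0_compat; assumption).
  assert (HAEE : 0 < A * exp 2 * exp 2) by (apply Rmult_lt_0_compat; assumption).
  assert (HB : 0 < B) by (unfold B; lra).
  exists (Rmin 1 (eps / B)).
  assert (Hd : 0 < eps / B) by (apply Rdiv_lt_0_compat; assumption).
  split; [apply Rmin_pos; lra|]. intros u v Hu Hv.
  pose proof (Rmin_l 1 (eps / B)). pose proof (Rmin_r 1 (eps / B)).
  set (w := (u - v)%C).
  assert (Hw : Cmod w <= 2 * Rmin 1 (eps / B)).
  { unfold w. replace (u - v)%C with ((u - z) + - (v - z))%C by ring.
    eapply Rle_trans; [apply Cmod_triangle|]. rewrite Cmod_opp. lra. }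
  (* The first term is quadratic in [w]; in the second, [Cexp v - Cexp z] is small because [v] is
     close to [z]. *)
  replace (Cexp u - Cexp v - Cexp z * w)%C with
    (Cexp v * (Cexp w - 1 - w) + (Cexp v - Cexp z) * w)%C.
  2:{ replace (Cexp u) with (Cexp (v + w)) by (f_equal; unfold w; ring). rewrite Cexp_plus. ring. }
  eapply Rle_trans; [apply Cmod_triangle|]. rewrite !Cmod_mult, Cmod_Cexp.
  pose proof (Cmod_ge_0 w) as Hw0.
  assert (Ev : exp (Re v) <= A * exp 2).
  { unfold A. rewrite <- exp_plus. apply exp_mono.
    pose proof (re_le_Cmod (v - z)) as T. pose proof (Rle_abs (Re (v - z))).
    unfold Cminus in *. rewrite Re_plus, Re_opp in *. lra. }
  assert (T1 : Cmod (Cexp w - 1 - w) <= Cmod w ^ 2 * exp 2).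
  { eapply Rle_trans; [apply Cexp_minus_lin_bound|].
    apply Rmult_le_compat_l; [apply pow2_ge_0|]. apply exp_mono. lra. }
  assert (T2 : Cmod (Cexp v - Cexp z) <= Cmod (v - z) * (A * exp 2)).
  { eapply Rle_trans; [apply Cexp_diff_bound|].
    apply Rmult_le_compat_l; [apply Cmod_ge_0|]. unfold A. rewrite <- exp_plus. apply exp_mono. lra. }
  pose proof (Cmod_ge_0 (Cexp w - 1 - w)).
  pose proof (exp_pos (Re v)).
  assert (E3 : 1 <= exp 2) by (pose proof (exp_ineq1_le 2); lra).
  apply Rle_trans with (A * exp 2 * (Cmod w * (2 * (eps / B)) * exp 2) + (eps / B) * (A * exp 2) * Cmod w).
  - apply Rplus_le_compat.
    + apply Rmult_le_compat; try lra. eapply Rle_trans; [exact T1|].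
      apply Rmult_le_compat_r; [lra|]. simpl. rewrite Rmult_1_r. apply Rmult_le_compat_l; lra.
    + apply Rmult_le_compat_r; [lra|]. eapply Rle_trans; [exact T2|].
      apply Rmult_le_compat_r; lra.
  - apply Rle_trans with (eps / B * B * Cmod w); [|right; field; lra].
    replace (A * exp 2 * (Cmod w * (2 * (eps / B)) * exp 2) + eps / B * (A * exp 2) * Cmod w)
      with (eps / B * (2 * (A * exp 2 * exp 2) + A * exp 2) * Cmod w) by ring.
    apply Rmult_le_compat_r; [lra|]. apply Rmult_le_compat_l; [lra|].
    unfold B. nra.
Qed.

Ltac hh :=
  lazymatch goal with
  | |- hol (fun _ => Cplus _ _) _ => apply hol_plus; hh
  | |- hol (fun _ => Cminus _ _) _ => apply hol_minus; hh
  | |- hol (fun _ => Copp _) _ => apply hol_opp; hh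
  | |- hol (fun _ => Cmult _ _) _ => apply hol_mult; hh
  | |- hol (fun w => Cexp (@?g w)) ?z => refine (hol_comp Cexp g z (hol_Cexp _) _); hh
  | |- hol (fun _ => ?c) _ => apply hol_const
  | |- hol (fun y => y) _ => apply hol_id
  | |- hol (Cmult ?a) ?z => apply (hol_mult (fun _ => a) (fun y => y)); hh
  | _ => try assumption
  end.

(** Chosen pointwise, which turns the derivative into a total function whose continuity can be
    discussed. *)
Definition cder (g : C -> C) (z : C) : C := epsilon (inhabits (RtoC 0)) (fun l => sdiff g z l).

Lemma sdiff_cder g z : hol g z -> sdiff g z (cder g z).
Proof. intros H. apply (epsilon_spec (inhabits (RtoC 0)) _ H). Qed.

(** Strictness at [z] applies to the pair [w + r], [w], and so does differentiability at [w]. Both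
    derivatives are then within eps/4 of the same difference quotient. *)
Lemma ccont_cder g z : locally (T := C_UniformSpace) z (hol g) -> ccont (cder g) z.
Proof.
  intros H. pose proof (locally_singleton _ _ H) as Hz.
  apply (ccont_iff_loc (U := C_UniformSpace)). intros eps He.
  apply locally_Cmod in H. destruct H as [d0 [Hd0 H]].
  assert (He2 : 0 < eps / 4) by lra.
  destruct (sdiff_cder g z Hz _ He2) as [d [Hd A]].
  apply locally_Cmod. exists (Rmin d0 (d / 2)); split; [apply Rmin_pos; lra|].
  intros w Hw. pose proof (Rmin_l d0 (d / 2)). pose proof (Rmin_r d0 (d / 2)).
  destruct (sdiff_cder g w (H w ltac:(lra)) _ He2) as [d' [Hd' B]].
  (* A real increment small enough for [w + r] to lie in the disc of [w] and in that of [z]. *)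
  set (r := Rmin d' (d / 2) / 2).
  pose proof (Rmin_l d' (d / 2)). pose proof (Rmin_r d' (d / 2)).
  assert (Hr : 0 < r) by (unfold r; assert (0 < Rmin d' (d / 2)) by (apply Rmin_pos; lra); lra).
  assert (Hh : Cmod (RtoC r) = r) by (rewrite Cmod_R; apply Rabs_pos_eq; lra).
  assert (E : Cmod (w + r - w) = r) by (transitivity (Cmod r); [f_equal; ring|exact Hh]).
  specialize (B (w + r)%C w ltac:(unfold r in *; lra) (Cmod_minus_self _ _ Hd')).
  assert (E2 : Cmod (w + r - z) < d).
  { replace (w + r - z)%C with ((w - z) + r)%C by ring.
    eapply Rle_lt_trans; [apply Cmod_triangle|]. unfold r in *; lra. }
  specialize (A (w + r)%C w E2 ltac:(lra)).
  rewrite E in A, B.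
  pose proof (Cmod_triangle (g (w + r)%C - g w - cder g z * (w + r - w)) (- (g (w + r)%C - g w - cder g w * (w + r - w)))) as T.
  rewrite Cmod_opp in T.
  replace (g (w + r)%C - g w - cder g z * (w + r - w) + - (g (w + r)%C - g w - cder g w * (w + r - w)))%C
    with ((cder g w - cder g z) * r)%C in T by ring.
  rewrite Cmod_mult, Hh in T.
  apply Rle_lt_trans with (eps / 2); [|lra].
  apply Rmult_le_reg_r with r; lra.
Qed.

Lemma sdiff_cderiv g (A w l : C) t0 : sdiff g (A + RtoC t0 * w)%C l ->
  cderiv (fun t => g (A + RtoC t * w)%C) t0 (w * l)%C.
Proof.
  intros H.
  (* Real and imaginary parts are treated together, through a contracting real-linear map [pr]. *)
  assert (K : forall (pr : C -> R), (forall c, Rabs (pr c) <= Cmod c) ->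
    (forall a b : C, pr (a - b)%C = pr a - pr b) -> (forall (r : R) (a : C), pr (r * a)%C = r * pr a) ->
    is_derive (fun t => pr (g (A + RtoC t * w)%C)) t0 (pr (w * l)%C)).
  { intros pr Hle Hm Hs. apply is_derive_Reals. intros eps He.
    pose proof (Cmod_ge_0 w) as Hw.
    assert (He2 : 0 < eps / 2 / (Cmod w + 1)) by (apply Rdiv_lt_0_compat; lra).
    destruct (H _ He2) as [d [Hd B]].
    assert (Hp : 0 < d / (Cmod w + 1)) by (apply Rdiv_lt_0_compat; lra).
    exists (mkposreal _ Hp). intros h Hh0 Hh. simpl in Hh.
    assert (Hha : 0 < Rabs h) by (apply Rabs_pos_lt, Hh0).
    assert (E1 : Cmod (A + RtoC (t0 + h) * w - (A + RtoC t0 * w)) = Rabs h * Cmod w).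
    { rewrite <- (Cmod_R h), <- Cmod_mult. f_equal. rewrite RtoC_plus. ring. }
    assert (E2 : Rabs h * Cmod w < d).
    { apply Rle_lt_trans with (Rabs h * (Cmod w + 1)); [apply Rmult_le_compat_l; lra|].
      apply Rlt_le_trans with (d / (Cmod w + 1) * (Cmod w + 1)).
      - apply Rmult_lt_compat_r; lra.
      - right; field; lra. }
    specialize (B (A + RtoC (t0 + h) * w)%C (A + RtoC t0 * w)%C ltac:(lra) (Cmod_minus_self _ _ Hd)).
    rewrite E1 in B.
    replace (l * (A + RtoC (t0 + h) * w - (A + RtoC t0 * w)))%C with (RtoC h * (w * l))%C in B
      by (rewrite RtoC_plus; ring).
    pose proof (Rle_trans _ _ _ (Hle _) B) as B2. rewrite !Hm, Hs in B2.
    replace ((pr (g (A + RtoC (t0 + h) * w)%C) - pr (g (A + RtoC t0 * w)%C)) / h - pr (w * l)%C)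
      with ((pr (g (A + RtoC (t0 + h) * w)%C) - pr (g (A + RtoC t0 * w)%C) - h * pr (w * l)%C) / h)
      by (field; exact Hh0).
    unfold Rdiv at 1. rewrite Rabs_mult, Rabs_inv.
    apply Rle_lt_trans with (eps / 2 / (Cmod w + 1) * (Rabs h * Cmod w) * / Rabs h).
    - apply Rmult_le_compat_r; [left; apply Rinv_0_lt_compat, Hha|exact B2].
    - replace (eps / 2 / (Cmod w + 1) * (Rabs h * Cmod w) * / Rabs h) with
        (eps / 2 / (Cmod w + 1) * Cmod w) by (field; lra).
      apply Rle_lt_trans with (eps / 2 / (Cmod w + 1) * (Cmod w + 1)); [apply Rmult_le_compat_l; lra|].
      replace (eps / 2 / (Cmod w + 1) * (Cmod w + 1)) with (eps / 2) by (field; lra). lra. }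
  split.
  - apply (K Re); [apply re_le_Cmod|reflexivity|].
    intros r a. rewrite Re_mult, Re_RtoC, Im_RtoC. ring.
  - apply (K Im); [apply im_le_Cmod|reflexivity|].
    intros r a. rewrite Im_mult, Re_RtoC, Im_RtoC. ring.
Qed.

Lemma cderiv_path g (F : R -> C) t0 (w l : C) (A : C) :
  (forall t, F t = (A + RtoC t * w)%C) -> sdiff g (F t0) l ->
  cderiv (fun t => g (F t)) t0 (w * l)%C.
Proof.
  intros E H. rewrite E in H.
  apply cderiv_ext with (fun t => g (A + RtoC t * w)%C).
  - intros u. rewrite E. reflexivity.
  - apply sdiff_cderiv, H.
Qed.

Lemma ccont_path g (F : R -> C) t0 : ccont F t0 -> ccont g (F t0) ->
  ccont (fun t => g (F t)) t0.
Proof. intros H1 H2. apply (ccont_comp (U := R_UniformSpace) (V := C_UniformSpace) F g); assumption. Qed.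

(** The direction [j] is a parameter because the rotation goes upwards for one Hankel function and
    downwards for the other: [j] is later i or -i. *)
Definition strip_hol (j : C) (al be : R) (g : C -> C) : Prop :=
  forall t th : R, al < th < be -> hol g (t + j * th)%C.

Lemma cont_on_all (F : R -> C) a b : (forall t, ccont F t) -> cont_on F a b.
Proof. intros H t _. apply H. Qed.

Lemma strip_cont j al be g th : strip_hol j al be g -> al < th < be ->
  forall t, ccont (fun t : R => g (t + j * th)%C) t.
Proof.
  intros H Hth t. apply (ccont_path g (fun t : R => (t + j * th)%C)); [cc|].
  apply hol_ccont, H, Hth.
Qed.

(* [locally] here is in the plane, so the strip must be open in C: j is not real. *)
Lemma strip_cder_cont (eta : R) al be g th : eta <> 0 -> strip_hol (0, eta) al be g -> al < th < be ->
  forall t : R, ccont (cder g) (t + (0, eta) * th)%C.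
Proof.
  intros He H Hth t. apply ccont_cder, locally_Cmod.
  set (d := Rmin (th - al) (be - th)).
  assert (Hd : 0 < d) by (apply Rmin_pos; lra).
  assert (Ha : 0 < Rabs eta) by (apply Rabs_pos_lt, He).
  exists (Rabs eta * d). split; [apply Rmult_lt_0_compat; assumption|].
  intros w Hw.
  replace w with (RtoC (Re w) + (0, eta) * RtoC (Im w / eta))%C.
  - apply H.
    assert (B : Rabs (Im w / eta - th) < d).
    { apply Rmult_lt_reg_l with (Rabs eta); [exact Ha|].
      rewrite <- Rabs_mult. eapply Rle_lt_trans; [|exact Hw].
      eapply Rle_trans; [|apply im_le_Cmod].
      right. f_equal. unfold Im, Cminus, Cplus, Copp, Cmult, RtoC; simpl. field. exact He. }
    pose proof (Rmin_l (th - al) (be - th)). pose proof (Rmin_r (th - al) (be - th)).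
    fold d in H0, H1.
    destruct (Rabs_def2 _ _ B). lra.
  - destruct w as [x y]. unfold RtoC, Cplus, Cmult, Re, Im; simpl. f_equal; field; exact He.
Qed.

(** Differentiation under the integral sign requires the derivative to be jointly continuous in the
    two real variables, which is what strict differentiability provides through [ccont_cder]. *)
Lemma strip_param_Re (eta : R) al be g a b th : eta <> 0 ->
  strip_hol (0, eta) al be g -> al < th < be ->
  is_derive (fun th : R => Re (CInt (fun t : R => g (t + (0, eta) * th)%C) a b)) th
    (Re ((0, eta) * (g (b + (0, eta) * th)%C - g (a + (0, eta) * th)%C))).
Proof.
  intros He H Hth. set (j := (0, eta) : C).
  set (f := fun th t : R => Re (g (t + j * th)%C)).
  assert (Hder : forall u t : R, al < u < be -> is_derive (fun z => f z t) u (Re (j * cder g (t + j * u)))).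
  { intros u t Hu.
    destruct (cderiv_path g (fun z : R => (t + j * z)%C) u j (cder g (t + j * u)) t) as [K _].
    - intros z; ring.
    - apply sdiff_cder, H, Hu.
    - exact K. }
  set (d := Rmin (th - al) (be - th)).
  assert (Hd : 0 < d) by (apply Rmin_pos; lra).
  pose proof (Rmin_l (th - al) (be - th)). pose proof (Rmin_r (th - al) (be - th)).
  fold d in H0, H1.
  assert (Hloc : locally th (fun u => al < u < be)).
  { exists (mkposreal _ Hd). intros u Hu.
    change (Rabs (u - th) < d) in Hu. destruct (Rabs_def2 _ _ Hu). lra. }
  assert (K : is_derive (fun th => RInt (fun t => f th t) a b) th
             (RInt (fun t => Derive (fun u => f u t) th) a b)).
  { apply is_derive_RInt_param.
    - apply filter_imp with (2 := Hloc). intros u Hu t _. eexists. apply Hder, Hu.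
    - intros t _. apply continuity_2d_pt_ext_loc with (fun u v => Re (j * cder g (v + j * u))).
      + exists (mkposreal _ Hd). simpl. intros u v Hu Hv. symmetry. apply is_derive_unique, Hder.
        destruct (Rabs_def2 _ _ Hu). lra.
      + apply continuity_2d_pt_filterlim.
        assert (HF : ccont (U := prod_UniformSpace R_UniformSpace R_UniformSpace)
                       (fun z : R * R => j * cder g (snd z + j * fst z))%C (th, t)).
        { apply ccont_mult; [apply ccont_const|].
          apply (ccont_comp (U := prod_UniformSpace R_UniformSpace R_UniformSpace) (V := C_UniformSpace)
            (fun z : R * R => (snd z + j * fst z)%C) (cder g)).
          - apply ccont_plus; [|apply ccont_mult; [apply ccont_const|]]; apply ccont_RtoC;
              [apply continuous_snd|apply continuous_fst].
          - apply (strip_cder_cont eta al be); assumption. }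
        exact (ccont_Re _ _ HF).
    - apply filter_imp with (2 := Hloc). intros u Hu.
      apply (ex_RInt_continuous (V := R_CompleteNormedModule)). intros t _.
      apply ccont_Re. apply (strip_cont j al be g u H Hu). }
  eapply is_derive_ext; [intros u; reflexivity|].
  replace (Re (j * (g (b + j * th)%C - g (a + j * th)%C))) with
    (RInt (fun t => Derive (fun u => f u t) th) a b); [exact K|].
  assert (Hc : cont_on (fun t : R => j * cder g (t + j * th))%C a b).
  { apply cont_on_all. intros t. apply ccont_mult; [apply ccont_const|].
    apply (ccont_path (cder g) (fun t : R => (t + j * th)%C)); [cc|].
    apply (strip_cder_cont eta al be); assumption. }
  (* The derivative in the height is [j] times the derivative in [t], so the integral over [t] can
     be evaluated by a primitive. *)
  transitivity (Re (CInt (fun t : R => j * cder g (t + j * th))%C a b)).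
  - apply RInt_ext. intros t _. apply is_derive_unique, Hder, Hth.
  - rewrite (CInt_FTC (fun t : R => j * g (t + j * th))%C); [f_equal; ring| |exact Hc].
    intros t _. eapply cderiv_eq.
    + apply (cderiv_mult (fun _ => j) (fun t : R => g (t + j * th)%C)); [apply cderiv_const|].
      apply (cderiv_path g (fun t : R => (t + j * th)%C) t 1 (cder g (t + j * th)) (j * th)%C).
      * intros u; ring.
      * apply sdiff_cder, H, Hth.
    + cbv beta. ring.
Qed.

(* As a function of the height d, the left side has derivative the integral over t of j g',
   that is, j times the difference of the values of g at the two ends. *)
Lemma cauchy_rectangle (eta : R) al be g a b c d : eta <> 0 ->
  strip_hol (0, eta) al be g -> al < c -> c <= d -> d < be ->
  (CInt (fun t : R => g (t + (0, eta) * d)) a b - CInt (fun t : R => g (t + (0, eta) * c)) a b =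
  (0, eta) * CInt (fun th : R => g (b + (0, eta) * th) - g (a + (0, eta) * th)) c d)%C.
Proof.
  intros He H Hc Hcd Hd. set (j := (0, eta) : C).
  assert (Hv : forall t u : R, al < u < be -> ccont (fun th : R => g (t + j * th)%C) u).
  { intros t u Hu. apply (ccont_path g (fun th : R => (t + j * th)%C)); [cc|].
    apply hol_ccont, H, Hu. }
  assert (Hco : cont_on (fun th : R => g (b + j * th)%C - g (a + j * th)%C)%C c d).
  { intros u Hu. rewrite Rmin_left, Rmax_right in Hu by exact Hcd.
    apply ccont_minus; apply Hv; lra. }
  rewrite <- CInt_scal by exact Hco.
  symmetry.
  apply (CInt_FTC (fun th : R => CInt (fun t : R => g (t + j * th)%C) a b)).
  2: apply cont_on_scal, Hco.
  intros u Hu. rewrite Rmin_left, Rmax_right in Hu by exact Hcd.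
  assert (Hu' : al < u < be) by lra.
  split.
  - apply (strip_param_Re eta al be); assumption.
  (* The imaginary part of g is the real part of -i g. *)
  - assert (H' : strip_hol j al be (fun z => (- Ci) * g z)%C).
    { intros t th Hth. apply hol_mult; [apply hol_const|apply H, Hth]. }
    pose proof (strip_param_Re eta al be _ a b u He H' Hu') as K. fold j in K.
    replace (Im (j * (g (b + j * u)%C - g (a + j * u)%C))) with
      (Re (j * (- Ci * g (b + j * u)%C - - Ci * g (a + j * u)%C))).
    + eapply is_derive_ext_loc; [|exact K].
      assert (Hdd : 0 < Rmin (u - al) (be - u)) by (apply Rmin_pos; lra).
      exists (mkposreal _ Hdd). intros th Hth.
      change (Rabs (th - u) < Rmin (u - al) (be - u)) in Hth.
      pose proof (Rmin_l (u - al) (be - u)). pose proof (Rmin_r (u - al) (be - u)).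
      destruct (Rabs_def2 _ _ Hth).
      rewrite CInt_scal.
      * unfold Ci, Copp, Cmult, Re, Im; simpl. ring.
      * apply cont_on_all, (strip_cont j al be g th H). lra.
    + unfold Ci, Copp, Cmult, Cminus, Cplus, Re, Im; simpl. ring.
Qed.

(** * Power series *)

Lemma Cpow_diff_bound (u v : C) (d : R) n : Cmod u <= d -> Cmod v <= d ->
  Cmod (u ^ S n - v ^ S n) <= INR (S n) * d ^ n * Cmod (u - v).
Proof.
  intros Hu Hv.
  induction n as [|n IH].
  - simpl. replace (u * 1 - v * 1)%C with (u - v)%C by ring. lra.
  - replace (u ^ S (S n) - v ^ S (S n))%C with (u * (u ^ S n - v ^ S n) + (u - v) * v ^ S n)%C
      by (simpl; ring).
    eapply Rle_trans; [apply Cmod_triangle|]. rewrite !Cmod_mult, Cmod_pow.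
    assert (T1 : Cmod u * Cmod (u ^ S n - v ^ S n) <= d * (INR (S n) * d ^ n * Cmod (u - v))).
    { apply Rmult_le_compat; try apply Cmod_ge_0; assumption. }
    assert (T2 : Cmod (u - v) * Cmod v ^ S n <= Cmod (u - v) * d ^ S n).
    { apply Rmult_le_compat_l; [apply Cmod_ge_0|]. apply pow_incr. split; [apply Cmod_ge_0|exact Hv]. }
    rewrite (S_INR (S n)). simpl pow in *. lra.
Qed.

Lemma pow_n_Cpow (z : C) n : pow_n (K := C_Ring) z n = (z ^ n)%C.
Proof. induction n as [|n IH]; [reflexivity|]. simpl. rewrite <- IH. reflexivity. Qed.

Lemma is_series_C (a : nat -> C) (l : C) : is_series (V := C_NormedModule) a l <->
  forall eps, 0 < eps -> exists N, forall n, (N <= n)%nat ->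
    Cmod (sum_n (G := C_AbelianMonoid) a n - l) < eps.
Proof.
  unfold is_series.
  rewrite (filterlim_C_iff eventually (filter_filter (F := eventually)) (sum_n (G := C_AbelianMonoid) a) l).
  reflexivity.
Qed.

Lemma eventually_bounded (u : nat -> R) N B : (forall n, (N <= n)%nat -> u n <= B) ->
  exists B', forall n, u n <= B'.
Proof.
  revert B; induction N as [|N IH]; intros B H.
  - exists B. intros n. apply H. lia.
  - apply (IH (Rmax B (u N))). intros n Hn.
    destruct (Nat.eq_dec n N) as [->|Hne]; [apply Rmax_r|].
    eapply Rle_trans; [apply H; lia|apply Rmax_l].
Qed.

Lemma is_series_terms_bounded (a : nat -> C) (l : C) : is_series (V := C_NormedModule) a l ->
  exists B, forall n, Cmod (a n) <= B.
Proof.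
  intros H. destruct (proj1 (is_series_C a l) H 1 Rlt_0_1) as [N HN].
  apply (eventually_bounded _ (S N) 2). intros n Hn.
  destruct n as [|n]; [lia|].
  pose proof (HN (S n) ltac:(lia)) as H1. pose proof (HN n ltac:(lia)) as H2.
  rewrite sum_Sn in H1. unfold plus in H1; simpl in H1.
  replace (a (S n)) with ((sum_n (G := C_AbelianMonoid) a n + a (S n) - l) + - (sum_n (G := C_AbelianMonoid) a n - l))%C
    by ring.
  eapply Rle_trans; [apply Cmod_triangle|]. rewrite Cmod_opp.
  simpl in *. lra.
Qed.

Lemma is_pseries_C (a : nat -> C) (w l : C) :
  is_pseries (K := C_AbsRing) (V := C_NormedModule) a w l ->
  is_series (V := C_NormedModule) (fun k => w ^ k * a k)%C l.
Proof.
  intros H. eapply is_series_ext; [|exact H].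
  intros n. cbv beta. unfold scal; simpl. change (mult (pow_n (K := C_Ring) w n) (a n)) with (pow_n (K := C_Ring) w n * a n)%C.
  rewrite pow_n_Cpow. reflexivity.
Qed.

Lemma INR_le_pow2 n : INR (S n) <= 2 ^ n.
Proof.
  induction n as [|n IH]; [simpl; lra|].
  rewrite S_INR. simpl pow. assert (1 <= 2 ^ n) by (apply pow_R1_Rle; lra). lra.
Qed.

(** After the constant and linear terms are removed, the k-th term of the difference is at most k
    d^(k-1) |a_k| |x - y|. Convergence at distance [rho] bounds |a_k| by B / rho^k, so these bounds
    sum like a geometric series. *)
Lemma sdiff_pseries (f : C -> C) (z0 : C) (r : R) (a : nat -> C) : 0 < r ->
  (forall z, Cmod (z - z0) < r ->
     is_pseries (K := C_AbsRing) (V := C_NormedModule) a (z - z0)%C (f z)) ->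
  sdiff f z0 (a 1%nat).
Proof.
  intros Hr Hf. set (rho := r / 2). assert (Hrho : 0 < rho) by (unfold rho; lra).
  assert (HB : exists B, 0 < B /\ forall n, Cmod (a n) * rho ^ n <= B).
  { assert (E : Cmod (z0 + rho - z0) = rho).
    { replace (z0 + rho - z0)%C with (RtoC rho) by ring. rewrite Cmod_R, Rabs_pos_eq; lra. }
    assert (E2 : Cmod (z0 + rho - z0) < r) by (rewrite E; unfold rho; lra).
    destruct (is_series_terms_bounded _ _ (is_pseries_C _ _ _ (Hf _ E2))) as [B HB].
    exists (Rmax B 1). split; [apply Rlt_le_trans with 1; [lra|apply Rmax_r]|].
    intros n. eapply Rle_trans; [|apply Rmax_l]. eapply Rle_trans; [|apply (HB n)].
    rewrite Cmod_mult, Cmod_pow, E. lra. }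
  destruct HB as [B [HB0 HB]].
  intros eps He.
  set (q := Rmin (1 / 2) (eps * rho / (8 * B))).
  assert (Hq : 0 < q).
  { apply Rmin_pos; [lra|]. apply Rdiv_lt_0_compat; [apply Rmult_lt_0_compat; assumption|lra]. }
  assert (Hq2 : q <= 1 / 2) by apply Rmin_l.
  assert (Hq3 : 4 * B / rho * q <= eps).
  { assert (Q : q <= eps * rho / (8 * B)) by apply Rmin_r.
    apply Rle_trans with (4 * B / rho * (eps * rho / (8 * B))).
    - apply Rmult_le_compat_l; [|exact Q]. apply Rlt_le, Rdiv_lt_0_compat; lra.
    - replace (4 * B / rho * (eps * rho / (8 * B))) with (eps / 2) by (field; lra). lra. }
  (* The divisor 2 absorbs the factor k, which is at most 2^(k-1); what remains is geometric of
     ratio [q]. *)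
  set (d := q * rho / 2).
  assert (Hd : 0 < d) by (unfold d; assert (0 < q * rho) by (apply Rmult_lt_0_compat; assumption); lra).
  assert (Hdr : d < r) by (unfold d, rho; nra).
  exists d. split; [exact Hd|]. intros u v Hu Hv.
  pose proof (is_pseries_C _ _ _ (Hf u ltac:(lra))) as Su.
  pose proof (is_pseries_C _ _ _ (Hf v ltac:(lra))) as Sv.
  replace (u - v)%C with ((u - z0) - (v - z0))%C by ring.
  set (x := (u - z0)%C) in *. set (y := (v - z0)%C) in *.
  set (su := sum_n (G := C_AbelianMonoid) (fun k => x ^ k * a k)%C) in *.
  set (sv := sum_n (G := C_AbelianMonoid) (fun k => y ^ k * a k)%C) in *.
  set (D := Cmod (x - y)). assert (HD : 0 <= D) by apply Cmod_ge_0.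
  (* Since q <= 1/2, the quantity 2 q - 2 q^(N+1) grows by at least q^(N+1) at each step, and it
     stays below 2 q. *)
  assert (HS : forall N, Cmod (su (S N) - sv (S N) - a 1%nat * (x - y)) <=
     2 * B / rho * D * (2 * q - 2 * q ^ S N)).
  { induction N as [|N IH].
    - unfold su, sv. rewrite !sum_Sn, !sum_O. unfold plus; simpl.
      match goal with |- Cmod ?e <= _ => replace e with (RtoC 0) by ring end.
      rewrite Cmod_0. right. ring.
    - assert (Es : (su (S (S N)) - sv (S (S N)) - a 1%nat * (x - y) =
        (su (S N) - sv (S N) - a 1%nat * (x - y)) + (x ^ S (S N) - y ^ S (S N)) * a (S (S N)))%C).
      { unfold su, sv. rewrite (sum_Sn _ (S N)), (sum_Sn _ (S N)). unfold plus; simpl. ring. }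
      rewrite Es. eapply Rle_trans; [apply Cmod_triangle|]. rewrite Cmod_mult.
      assert (T : Cmod (x ^ S (S N) - y ^ S (S N)) * Cmod (a (S (S N))) <= 2 * B / rho * D * q ^ S N).
      { assert (Hrn : 0 < rho ^ S (S N)) by (apply pow_lt, Hrho).
        assert (Ha : Cmod (a (S (S N))) <= B / rho ^ S (S N)).
        { apply Rmult_le_reg_r with (rho ^ S (S N)); [exact Hrn|].
          replace (B / rho ^ S (S N) * rho ^ S (S N)) with B by (field; lra). apply HB. }
        eapply Rle_trans.
        - apply Rmult_le_compat; [apply Cmod_ge_0|apply Cmod_ge_0| |exact Ha].
          apply (Cpow_diff_bound x y d); lra.
        - fold D. assert (I2 : INR (S (S N)) <= 2 * 2 ^ S N).
          { pose proof (INR_le_pow2 (S N)). assert (0 < 2 ^ S N) by (apply pow_lt; lra). lra. }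
          apply Rle_trans with (2 * 2 ^ S N * d ^ S N * D * (B / rho ^ S (S N))).
          + apply Rmult_le_compat_r; [apply Rlt_le, Rdiv_lt_0_compat; lra|].
            apply Rmult_le_compat_r; [exact HD|].
            apply Rmult_le_compat_r; [apply pow_le; lra|exact I2].
          + right. unfold d.
            replace (q * rho / 2) with (q * rho * / 2) by reflexivity.
            rewrite !Rpow_mult_distr, pow_inv. simpl pow. field.
            repeat split; try lra; apply Rgt_not_eq, pow_lt; lra. }
      assert (P : 0 <= 2 * B / rho * D).
      { apply Rmult_le_pos; [|exact HD]. apply Rlt_le, Rdiv_lt_0_compat; lra. }
      assert (Qp : q ^ S (S N) <= / 2 * q ^ S N).
      { simpl pow. assert (0 <= q * q ^ N) by (apply Rmult_le_pos; [lra|apply pow_le; lra]). nra. }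
      eapply Rle_trans; [apply Rplus_le_compat; [exact IH|exact T]|].
      rewrite <- Rmult_plus_distr_l. apply Rmult_le_compat_l; [exact P|]. lra. }
  apply le_epsilon. intros e He'.
  assert (He2 : 0 < e / 2) by lra.
  destruct (proj1 (is_series_C _ _) Su _ He2) as [N1 HN1].
  destruct (proj1 (is_series_C _ _) Sv _ He2) as [N2 HN2].
  set (N := S (N1 + N2)). specialize (HN1 N ltac:(unfold N; lia)). specialize (HN2 N ltac:(unfold N; lia)).
  fold su in HN1. fold sv in HN2. specialize (HS (N1 + N2)%nat). fold N in HS.
  replace (f u - f v - a 1%nat * (x - y))%C with
    ((su N - sv N - a 1%nat * (x - y)) + (- (su N - f u) + (sv N - f v)))%C by ring.
  eapply Rle_trans; [apply Cmod_triangle|].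
  apply Rplus_le_compat.
  - eapply Rle_trans; [exact HS|].
    apply Rle_trans with (4 * B / rho * q * D); [|apply Rmult_le_compat_r; assumption].
    replace (4 * B / rho * q * D) with (2 * B / rho * D * (2 * q)) by (field; lra).
    apply Rmult_le_compat_l.
    + apply Rmult_le_pos; [|exact HD]. apply Rlt_le, Rdiv_lt_0_compat; lra.
    + assert (0 < q ^ N) by (apply pow_lt, Hq). lra.
  - eapply Rle_trans; [apply Cmod_triangle|]. rewrite Cmod_opp. lra.
Qed.

Lemma analytic_hol f z : analytic_at f z -> hol f z.
Proof. intros [r [a [Hr H]]]. exists (a 1%nat). apply (sdiff_pseries f z r a Hr H). Qed.

(** * Absolutely convergent integrals over half-lines *)

(** A limit along integer bounds is total by construction; [HInt_spec] recovers arbitrary real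
    bounds, with a rate, for integrands of exponential decay. *)
Definition HInt (F : R -> C) : C := C_lim_seq (fun n => CInt F 0 (INR n)).

Definition edecay (F : R -> C) (M d : R) : Prop :=
  0 < d /\ (forall t, ccont F t) /\ (forall t, 0 <= t -> Cmod (F t) <= M * exp (- (d * t))).

Lemma edecay_M_ge_0 F M d : edecay F M d -> 0 <= M.
Proof.
  intros [_ [_ H]]. specialize (H 0 (Rle_refl 0)).
  rewrite Rmult_0_r, Ropp_0, exp_0 in H. pose proof (Cmod_ge_0 (F 0)). lra.
Qed.

Lemma edecay_tail F M d a b : edecay F M d -> 0 <= a <= b ->
  Cmod (CInt F a b) <= M / d * exp (- (d * a)).
Proof.
  intros HF Hab. pose proof (edecay_M_ge_0 _ _ _ HF) as HM. destruct HF as [Hd [Hc Hb]].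
  apply Rle_trans with (- (M / d) * exp (- (d * b)) - - (M / d) * exp (- (d * a))).
  - apply (CInt_bound F (fun t => M * exp (- (d * t))) a b); [lra| | |].
    + apply cont_on_all, Hc.
    + intros t Ht. apply Hb. lra.
    + apply (is_RInt_derive (V := R_CompleteNormedModule) (fun t => - (M / d) * exp (- (d * t)))).
      * intros t _. auto_derive; [exact I|]. field. lra.
      * intros t _. apply (ex_derive_continuous (V := R_NormedModule)). auto_derive. exact I.
  - assert (0 <= M / d) by (apply Rdiv_le_0_compat; lra).
    pose proof (exp_pos (- (d * b))). nra.
Qed.

Lemma exp_decay_small d eps : 0 < d -> 0 < eps -> exists T0, 0 <= T0 /\
  forall T, T0 <= T -> exp (- (d * T)) < eps.
Proof.
  intros Hd He. exists (Rmax 0 (- ln eps / d + 1)). split; [apply Rmax_l|].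
  intros T HT. pose proof (Rmax_r 0 (- ln eps / d + 1)).
  rewrite <- (exp_ln eps) by exact He. apply exp_increasing.
  assert (H2 : - ln eps / d < T) by lra.
  apply Rmult_lt_compat_l with (r := d) in H2; [|exact Hd].
  replace (d * (- ln eps / d)) with (- ln eps) in H2 by (field; lra). lra.
Qed.

Lemma decay_small A d eps : 0 < d -> 0 < eps -> exists T0, 0 <= T0 /\
  forall T, T0 <= T -> A * exp (- (d * T)) < eps.
Proof.
  intros Hd He.
  assert (HA : 0 < Rabs A + 1) by (pose proof (Rabs_pos A); lra).
  destruct (exp_decay_small d (eps / (Rabs A + 1)) Hd) as [T0 [H0 H]];
    [apply Rdiv_lt_0_compat; assumption|].
  exists T0; split; [exact H0|]. intros T HT. specialize (H T HT).
  apply Rle_lt_trans with ((Rabs A + 1) * exp (- (d * T))).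
  - apply Rmult_le_compat_r; [left; apply exp_pos|]. pose proof (Rle_abs A). lra.
  - apply Rmult_lt_compat_l with (r := Rabs A + 1) in H; [|exact HA].
    replace ((Rabs A + 1) * (eps / (Rabs A + 1))) with eps in H by (field; lra). exact H.
Qed.

Lemma INR_eventually_ge x : exists N : nat, forall n, (N <= n)%nat -> x <= INR n.
Proof.
  destruct (nfloor_ex (Rmax x 0) (Rmax_r _ _)) as [N [_ HN]].
  exists (S N). intros n Hn. apply le_INR in Hn. rewrite S_INR in Hn.
  pose proof (Rmax_l x 0). lra.
Qed.

Lemma C_lim_seq_unique u (l : C) :
  filterlim u eventually (locally (T := C_UniformSpace) l) -> C_lim_seq u = l.
Proof.
  intros H. unfold C_lim_seq.
  apply (iota_filterlim_locally (V := C_CompleteNormedModule)); exact H.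
Qed.

Lemma C_cauchy (u : nat -> C) :
  (forall eps, 0 < eps -> exists N, forall n m, (N <= n)%nat -> (N <= m)%nat -> Cmod (u n - u m) < eps) ->
  exists l, filterlim u eventually (locally (T := C_UniformSpace) l).
Proof.
  intros H.
  assert (A : ex_finite_lim_seq (fun n => Re (u n))).
  { apply ex_lim_seq_cauchy_corr. intros eps. destruct (H eps (cond_pos eps)) as [N HN].
    exists N. intros n m Hn Hm. eapply Rle_lt_trans; [apply (re_le_Cmod (u n - u m))|apply HN; assumption]. }
  assert (B : ex_finite_lim_seq (fun n => Im (u n))).
  { apply ex_lim_seq_cauchy_corr. intros eps. destruct (H eps (cond_pos eps)) as [N HN].
    exists N. intros n m Hn Hm. eapply Rle_lt_trans; [apply (im_le_Cmod (u n - u m))|apply HN; assumption]. }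
  destruct A as [l1 A], B as [l2 B]. exists (l1, l2).
  apply (filterlim_C_iff eventually (filter_filter (F := eventually))).
  intros eps He. assert (He2 : 0 < eps / 2) by lra.
  apply is_lim_seq_spec in A. apply is_lim_seq_spec in B.
  generalize (filter_and _ _ (A (mkposreal _ He2)) (B (mkposreal _ He2))). apply filter_imp.
  intros n [H1 H2]. simpl in H1, H2. eapply Rle_lt_trans; [apply Cmod_le_Re_Im|].
  change (Re (u n - (l1, l2))) with (Re (u n) - l1). change (Im (u n - (l1, l2))) with (Im (u n) - l2). lra.
Qed.

Lemma HInt_spec F M d T : edecay F M d -> 0 <= T ->
  Cmod (HInt F - CInt F 0 T) <= M / d * exp (- (d * T)).
Proof.
  intros HF HT. pose proof HF as [Hd [Hc Hb]].
  assert (Hco : forall a b, cont_on F a b) by (intros; apply cont_on_all, Hc).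
  assert (Hdiff : forall a b, 0 <= a <= b -> Cmod (CInt F 0 b - CInt F 0 a) <= M / d * exp (- (d * a))).
  { intros a b Hab. rewrite <- (CInt_Chasles F 0 a b) by apply Hco.
    replace (CInt F 0 a + CInt F a b - CInt F 0 a)%C with (CInt F a b) by ring.
    apply edecay_tail; assumption. }
  assert (Hl : exists l, filterlim (fun n => CInt F 0 (INR n)) eventually (locally (T := C_UniformSpace) l)).
  { apply C_cauchy. intros eps He.
    destruct (decay_small (M / d) d eps Hd He) as [T0 [HT0 H]].
    destruct (INR_eventually_ge T0) as [N HN]. exists N.
    assert (S : forall n m, (N <= n)%nat -> (N <= m)%nat -> (n <= m)%nat ->
      Cmod (CInt F 0 (INR m) - CInt F 0 (INR n)) < eps).
    { intros n m Hn Hm Hnm. eapply Rle_lt_trans; [apply Hdiff|apply H, HN, Hn].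
      split; [apply pos_INR|apply le_INR, Hnm]. }
    intros n m Hn Hm. destruct (Nat.le_ge_cases n m) as [E|E].
    - rewrite Cmod_minus_sym. apply S; assumption.
    - apply S; assumption. }
  destruct Hl as [l Hl]. unfold HInt. rewrite (C_lim_seq_unique _ _ Hl).
  apply le_epsilon. intros eps He.
  destruct (proj1 (filterlim_C_iff eventually (filter_filter (F := eventually)) _ _) Hl eps He) as [N1 HN1].
  destruct (INR_eventually_ge T) as [N2 HN2].
  specialize (HN1 (N1 + N2)%nat ltac:(lia)). specialize (HN2 (N1 + N2)%nat ltac:(lia)).
  set (n := INR (N1 + N2)) in *.
  replace (l - CInt F 0 T)%C with (- (CInt F 0 n - l) + (CInt F 0 n - CInt F 0 T))%C by ring.
  eapply Rle_trans; [apply Cmod_triangle|]. rewrite Cmod_opp.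
  specialize (Hdiff T n ltac:(lra)). lra.
Qed.

Lemma HInt_lim F M d eps : edecay F M d -> 0 < eps -> exists T0, 0 <= T0 /\
  forall T, T0 <= T -> Cmod (HInt F - CInt F 0 T) < eps.
Proof.
  intros HF He. pose proof HF as [Hd _].
  destruct (decay_small (M / d) d eps Hd He) as [T0 [HT0 H]].
  exists T0; split; [exact HT0|]. intros T HT.
  eapply Rle_lt_trans; [apply (HInt_spec F M d T HF); lra|apply H, HT].
Qed.

Lemma HInt_unique F M d l : edecay F M d ->
  (forall eps, 0 < eps -> exists T0, forall T, T0 <= T -> Cmod (l - CInt F 0 T) <= eps) ->
  HInt F = l.
Proof.
  intros HF H. apply Cmod_small_eq. intros eps He. assert (He2 : 0 < eps / 2) by lra.
  destruct (HInt_lim F M d _ HF He2) as [T1 [_ H1]]. destruct (H _ He2) as [T2 H2].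
  specialize (H1 (Rmax T1 T2) (Rmax_l _ _)). specialize (H2 (Rmax T1 T2) (Rmax_r _ _)).
  set (T := Rmax T1 T2) in *.
  replace (HInt F - l)%C with ((HInt F - CInt F 0 T) + - (l - CInt F 0 T))%C by ring.
  eapply Rle_trans; [apply Cmod_triangle|]. rewrite Cmod_opp. lra.
Qed.

Lemma HInt_bound F M d : edecay F M d -> Cmod (HInt F) <= M / d.
Proof.
  intros HF. pose proof (HInt_spec F M d 0 HF (Rle_refl 0)) as H.
  rewrite CInt_point, Rmult_0_r, Ropp_0, exp_0 in H.
  replace (HInt F - 0)%C with (HInt F) in H by ring. lra.
Qed.

Lemma edecay_weaken F M d M' d' : edecay F M d -> M <= M' -> 0 < d' <= d -> edecay F M' d'.
Proof.
  intros HF HM Hd'. pose proof (edecay_M_ge_0 _ _ _ HF). destruct HF as [Hd [Hc Hb]].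
  split; [lra|]. split; [exact Hc|]. intros t Ht.
  eapply Rle_trans; [apply Hb, Ht|]. apply Rmult_le_compat; [lra|left; apply exp_pos|exact HM|].
  apply exp_mono. nra.
Qed.

Lemma edecay_plus F G M N d e : edecay F M d -> edecay G N e ->
  edecay (fun t => F t + G t)%C (M + N) (Rmin d e).
Proof.
  intros HF HG. pose proof HF as [Hd _]. pose proof HG as [He _].
  assert (Hm : 0 < Rmin d e) by (apply Rmin_pos; assumption).
  apply (edecay_weaken F M d M (Rmin d e)) in HF; [|lra|split; [exact Hm|apply Rmin_l]].
  apply (edecay_weaken G N e N (Rmin d e)) in HG; [|lra|split; [exact Hm|apply Rmin_r]].
  destruct HF as [_ [Hc1 Hb1]], HG as [_ [Hc2 Hb2]].
  split; [exact Hm|]. split; [intros t; apply ccont_plus; auto|].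
  intros t Ht. eapply Rle_trans; [apply Cmod_triangle|].
  specialize (Hb1 t Ht). specialize (Hb2 t Ht). lra.
Qed.

Lemma edecay_scal c F M d : edecay F M d -> edecay (fun t => c * F t)%C (Cmod c * M) d.
Proof.
  intros [Hd [Hc Hb]]. split; [exact Hd|].
  split; [intros t; apply ccont_mult; [apply ccont_const|apply Hc]|].
  intros t Ht. rewrite Cmod_mult, Rmult_assoc. apply Rmult_le_compat_l; [apply Cmod_ge_0|apply Hb, Ht].
Qed.

Definition hdecay (F : R -> C) : Prop := exists M d, edecay F M d.

Lemma hdecay_plus F G : hdecay F -> hdecay G -> hdecay (fun t => F t + G t)%C.
Proof.
  intros [M [d HF]] [N [e HG]]. do 2 eexists. apply edecay_plus; eassumption.
Qed.

Lemma hdecay_scal c F : hdecay F -> hdecay (fun t => c * F t)%C.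
Proof. intros [M [d HF]]. do 2 eexists. apply edecay_scal; eassumption. Qed.

Lemma HInt_plus F G : hdecay F -> hdecay G ->
  HInt (fun t => F t + G t)%C = (HInt F + HInt G)%C.
Proof.
  intros [M [d HF]] [N [e HG]].
  apply (HInt_unique _ _ _ _ (edecay_plus _ _ _ _ _ _ HF HG)). intros eps He.
  assert (He2 : 0 < eps / 2) by lra.
  destruct (HInt_lim F M d _ HF He2) as [T1 [_ H1]].
  destruct (HInt_lim G N e _ HG He2) as [T2 [_ H2]].
  exists (Rmax T1 T2). intros T HT.
  pose proof (Rmax_l T1 T2). pose proof (Rmax_r T1 T2).
  rewrite CInt_plus by (apply cont_on_all; first [apply HF|apply HG]).
  replace (HInt F + HInt G - (CInt F 0 T + CInt G 0 T))%C with
    ((HInt F - CInt F 0 T) + (HInt G - CInt G 0 T))%C by ring.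
  eapply Rle_trans; [apply Cmod_triangle|].
  specialize (H1 T ltac:(lra)). specialize (H2 T ltac:(lra)). lra.
Qed.

Lemma HInt_scal c F : hdecay F -> HInt (fun t => c * F t)%C = (c * HInt F)%C.
Proof.
  intros [M [d HF]]. apply (HInt_unique _ _ _ _ (edecay_scal c _ _ _ HF)). intros eps He.
  pose proof (Cmod_ge_0 c).
  assert (He2 : 0 < eps / (Cmod c + 1)) by (apply Rdiv_lt_0_compat; lra).
  destruct (HInt_lim F M d _ HF He2) as [T1 [_ H1]]. exists T1. intros T HT.
  rewrite CInt_scal by (apply cont_on_all, HF).
  replace (c * HInt F - c * CInt F 0 T)%C with (c * (HInt F - CInt F 0 T))%C by ring.
  rewrite Cmod_mult. specialize (H1 T HT).
  apply Rle_trans with ((Cmod c + 1) * (eps / (Cmod c + 1))).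
  - apply Rmult_le_compat; try apply Cmod_ge_0; lra.
  - right. field. lra.
Qed.

Lemma hdecay_eq F G : (forall t, F t = G t) -> hdecay F -> hdecay G.
Proof.
  intros E [M [d [Hd [Hc Hb]]]]. exists M, d. split; [exact Hd|]. split.
  - intros t. apply (ccont_ext_loc (U := R_UniformSpace) F G); [|apply Hc].
    apply filter_forall. exact E.
  - intros t Ht. rewrite <- E. apply Hb, Ht.
Qed.

Lemma HInt_eq F G : (forall t, F t = G t) -> hdecay F -> HInt F = HInt G.
Proof.
  intros E [M [d HF]]. apply (HInt_unique F M d _ HF). intros eps He.
  pose proof HF as [Hd [Hc Hb]].
  assert (HG : edecay G M d).
  { split; [exact Hd|]. split; [|intros t Ht; rewrite <- E; apply Hb, Ht].
    intros t. apply (ccont_ext_loc (U := R_UniformSpace) F G); [|apply Hc].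
    apply filter_forall. exact E. }
  destruct (HInt_lim G M d eps HG He) as [T0 [_ H]]. exists T0. intros T HT.
  rewrite (CInt_ext F G) by (intros; apply E). left. apply H, HT.
Qed.

Lemma HInt_minus F G : hdecay F -> hdecay G ->
  HInt (fun t => F t - G t)%C = (HInt F - HInt G)%C.
Proof.
  intros HF HG.
  rewrite <- (HInt_eq (fun t => F t + (- RtoC 1) * G t)%C).
  - rewrite HInt_plus, HInt_scal; [ring| | |apply hdecay_scal]; assumption.
  - intros t; ring.
  - apply hdecay_plus; [|apply hdecay_scal]; assumption.
Qed.

(** * Integrals over the line and the substitution x = exp t *)

Definition ldecay (F : R -> C) (M d : R) : Prop :=
  0 < d /\ (forall t, ccont F t) /\ (forall t, Cmod (F t) <= M * exp (- (d * Rabs t))).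

(** The line is folded at 0 so that everything reduces to [HInt]. *)
Definition LInt (F : R -> C) : C := HInt (fun t => F t + F (- t)%R)%C.

Lemma ccont_neg F t : ccont F (- t) -> ccont (U := R_UniformSpace) (fun t => F (- t)%R) t.
Proof.
  intros H. apply (ccont_comp (U := R_UniformSpace) (V := R_UniformSpace) (fun t => - t) F); [|exact H].
  apply (continuous_opp (V := R_NormedModule)), continuous_id.
Qed.

Lemma ldecay_half F M d : ldecay F M d -> edecay F M d /\ edecay (fun t => F (- t)%R) M d.
Proof.
  intros [Hd [Hc Hb]]. split; (split; [exact Hd|]); (split; [|]).
  - exact Hc.
  - intros t Ht. rewrite <- (Rabs_pos_eq t Ht) at 2. apply Hb.
  - intros t. apply ccont_neg, Hc.
  - intros t Ht. rewrite <- (Rabs_pos_eq t Ht) at 2. rewrite <- Rabs_Ropp. apply Hb.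
Qed.

Lemma ldecay_sum F M d : ldecay F M d -> edecay (fun t => F t + F (- t)%R)%C (M + M) d.
Proof.
  intros H. destruct (ldecay_half _ _ _ H) as [H1 H2].
  pose proof (edecay_plus _ _ _ _ _ _ H1 H2) as K.
  rewrite Rmin_left in K by lra. exact K.
Qed.

Lemma CInt_reflect F a b : (forall t, ccont F t) ->
  CInt (fun t => F (- t)%R) a b = CInt F (- b) (- a).
Proof.
  intros Hc.
  pose proof (CInt_comp_lin F (-1) 0 a b ltac:(apply cont_on_all, Hc)) as K.
  assert (Hn : cont_on (fun t => F (- t)%R) a b) by (apply cont_on_all; intros t; apply ccont_neg, Hc).
  rewrite (CInt_ext _ (fun t => (- RtoC 1) * F (- t)%R)%C) in K.
  2:{ intros t _. replace (-1 * t + 0) with (- t) by ring. ring. }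
  rewrite CInt_scal in K by exact Hn.
  replace (-1 * a + 0) with (- a) in K by ring. replace (-1 * b + 0) with (- b) in K by ring.
  pose proof (CInt_Chasles F (- a) (- b) (- a) ltac:(apply cont_on_all, Hc) ltac:(apply cont_on_all, Hc)) as K2.
  rewrite CInt_point in K2.
  replace (CInt (fun t => F (- t)%R) a b) with (- (- RtoC 1 * CInt (fun t => F (- t)%R) a b))%C by ring.
  rewrite K.
  replace (CInt F (- b) (- a)) with (CInt F (- a) (- b) + CInt F (- b) (- a) - CInt F (- a) (- b))%C by ring.
  rewrite K2. ring.
Qed.

Lemma CInt_symm F T : (forall t, ccont F t) ->
  CInt (fun t => F t + F (- t)%R)%C 0 T = CInt F (- T) T.
Proof.
  intros Hc.
  rewrite (CInt_plus F (fun t => F (- t)%R)).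
  - rewrite CInt_reflect by exact Hc. rewrite Ropp_0, Cplus_comm.
    apply CInt_Chasles; apply cont_on_all, Hc.
  - apply cont_on_all, Hc.
  - apply cont_on_all. intros t; apply ccont_neg, Hc.
Qed.

Lemma LInt_lim F M d eps : ldecay F M d -> 0 < eps -> exists T0, 0 <= T0 /\
  forall T, T0 <= T -> Cmod (LInt F - CInt F (- T) T) < eps.
Proof.
  intros HF He. destruct (HInt_lim _ _ _ eps (ldecay_sum _ _ _ HF) He) as [T0 [H0 H]].
  exists T0. split; [exact H0|]. intros T HT. rewrite <- CInt_symm by apply HF. apply H, HT.
Qed.

Lemma LInt_bound F M d : ldecay F M d -> Cmod (LInt F) <= (M + M) / d.
Proof. intros HF. apply HInt_bound, ldecay_sum, HF. Qed.

(** The improper integrals of [is_abel_int] have two ends that move independently; the two tails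
    outside [-T, T] are bounded separately. *)
Lemma LInt_lim2 F M d eps : ldecay F M d -> 0 < eps -> exists T0, 0 <= T0 /\
  forall a b, a <= - T0 -> T0 <= b -> Cmod (LInt F - CInt F a b) < eps.
Proof.
  intros HF He. assert (He3 : 0 < eps / 3) by lra.
  destruct (LInt_lim F M d _ HF He3) as [T1 [H1 HT1]].
  pose proof HF as [Hd [Hc _]].
  destruct (decay_small (M / d) d _ Hd He3) as [T2 [H2 HT2]].
  pose proof (Rmax_l T1 T2). pose proof (Rmax_r T1 T2). set (T := Rmax T1 T2) in *.
  exists T. split; [lra|]. intros a b Ha Hb.
  destruct (ldecay_half _ _ _ HF) as [D1 D2].
  assert (Hco : forall a b, cont_on F a b) by (intros; apply cont_on_all, Hc).
  rewrite <- (CInt_Chasles F a (- T) b), <- (CInt_Chasles F (- T) T b) by apply Hco.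
  pose proof (edecay_tail F M d T b D1 ltac:(lra)) as E1.
  pose proof (edecay_tail _ M d T (- a) D2 ltac:(lra)) as E2.
  rewrite CInt_reflect, Ropp_involutive in E2 by exact Hc.
  specialize (HT1 T ltac:(lra)). specialize (HT2 T ltac:(lra)).
  replace (LInt F - (CInt F a (- T) + (CInt F (- T) T + CInt F T b)))%C with
    ((LInt F - CInt F (- T) T) + (- CInt F a (- T) + - CInt F T b))%C by ring.
  eapply Rle_lt_trans; [apply Cmod_triangle|].
  eapply Rle_lt_trans; [apply Rplus_le_compat_l, Cmod_triangle|]. rewrite !Cmod_opp. lra.
Qed.

Lemma is_RInt_exp_subst (F g : R -> C) a b : 0 < a -> 0 < b -> (forall t, ccont F t) ->
  (forall t, F t = (g (exp t) * exp t)%C) ->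
  is_RInt (V := C_R_NormedModule) g a b (CInt F (ln a) (ln b)).
Proof.
  intros Ha Hb Hc E.
  assert (Hpos : forall x, Rmin a b <= x -> 0 < x).
  { intros x Hx. pose proof (Rmin_pos a b Ha Hb). lra. }
  assert (Eg : forall x, 0 < x -> g x = (RtoC (/ x) * F (ln x))%C).
  { intros x Hx. rewrite E, exp_ln by exact Hx. rewrite RtoC_inv by lra. field.
    apply RtoC_neq_0. lra. }
  assert (K : forall pr : C -> R, (forall t, continuous (fun t => pr (F t)) t) ->
    (forall (r : R) (c : C), pr (r * c)%C = r * pr c) ->
    is_RInt (fun x => pr (g x)) a b (RInt (fun t => pr (F t)) (ln a) (ln b))).
  { intros pr Hpr Hs.
    apply is_RInt_ext with (fun y => scal (/ y) (pr (F (ln y)))).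
    - intros x Hx. rewrite Eg by (apply Hpos; lra). rewrite Hs. reflexivity.
    - apply (is_RInt_comp (V := R_CompleteNormedModule) (fun t => pr (F t)) ln (fun y => / y)).
      + intros x _. apply Hpr.
      + intros x Hx. assert (0 < x) by (apply Hpos, Hx). split.
        * apply is_derive_ln. assumption.
        * apply (ex_derive_continuous (V := R_NormedModule)). auto_derive. lra. }
  apply (is_RInt_fct_extend_pair (U := R_NormedModule) (V := R_NormedModule) g a b).
  - apply (K Re).
    + intros t. apply ccont_Re, Hc.
    + intros r c. rewrite Re_mult, Re_RtoC, Im_RtoC. ring.
  - apply (K Im).
    + intros t. apply ccont_Im, Hc.
    + intros r c. rewrite Im_mult, Re_RtoC, Im_RtoC. ring.
Qed.

(** Under x = exp t the ends 0 and infinity become the two ends of the line, and exponential decay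
    in t gives convergence at both. *)
Lemma is_RInt_gen_exp_subst (F g : R -> C) M d : ldecay F M d ->
  (forall t, F t = (g (exp t) * exp t)%C) ->
  is_RInt_gen (V := C_R_NormedModule) g (at_right 0) (Rbar_locally p_infty) (LInt F).
Proof.
  intros HF E P HP.
  apply (proj1 (locally_Cmod (LInt F) P)) in HP. destruct HP as [eps [He HP]].
  destruct (LInt_lim2 F M d eps HF He) as [T0 [H0 HT]].
  apply Filter_prod with (fun a => 0 < a < exp (- T0)) (fun b => exp T0 < b).
  - exists (mkposreal _ (exp_pos (- T0))). intros y Hy Hy0.
    change (Rabs (y - 0) < exp (- T0)) in Hy. destruct (Rabs_def2 _ _ Hy). lra.
  - exists (exp T0). intros x Hx. exact Hx.
  - intros a b [Ha1 Ha2] Hb. simpl.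
    assert (Hb0 : 0 < b) by (pose proof (exp_pos T0); lra).
    exists (CInt F (ln a) (ln b)). split.
    + apply is_RInt_exp_subst; try assumption. apply HF.
    + apply HP. rewrite Cmod_minus_sym. apply HT.
      * rewrite <- (ln_exp (- T0)). left. apply ln_increasing; assumption.
      * rewrite <- (ln_exp T0). left. apply ln_increasing; [apply exp_pos|assumption].
Qed.

(** * Growth comparisons, and holomorphy of integrals depending on a parameter *)

(** With x = exp t, this is the domination of the power x^b by exp (p x). The maximum of b t - p exp
    t is at t = ln (b / p), whence the use of the tangent of exp there. *)
Lemma exp_le_exp_exp b p : 0 <= b -> 0 < p ->
  exists M, 0 < M /\ forall t, exp (b * t) <= M * exp (p * exp t).
Proof.
  intros Hb Hp. destruct Hb as [Hb|<-].
  - exists (exp (b * ln (b / p))). split; [apply exp_pos|]. intros t.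
    rewrite <- exp_plus. apply exp_mono.
    assert (Hq : 0 < b / p) by (apply Rdiv_lt_0_compat; assumption).
    pose proof (exp_ineq1_le (t - ln (b / p))) as H.
    unfold Rminus in H. rewrite exp_plus, exp_Ropp, exp_ln in H by exact Hq.
    assert (H2 : p * exp t = b * (exp t * / (b / p))) by (field; lra).
    rewrite H2. apply Rmult_le_compat_l with (r := b) in H; lra.
  - exists 1. split; [lra|]. intros t. rewrite Rmult_0_l, exp_0, Rmult_1_l.
    rewrite <- exp_0. apply exp_mono. pose proof (exp_pos t). nra.
Qed.

Lemma sqr_le_exp x : 0 <= x -> x ^ 2 <= 4 * exp x.
Proof.
  intros Hx. pose proof (exp_ineq1_le (x / 2)) as H.
  assert (E : exp x = exp (x / 2) * exp (x / 2)) by (rewrite <- exp_plus; f_equal; field).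
  rewrite E. nra.
Qed.

(** Strict differentiability of z -> exp (z s), uniformly in s. The second-order error carries a
    factor |s|^2, which is paid for by the margin [rho * Cmod s] in the exponent. *)
Lemma Cexp_param_diff rho eps : 0 < rho -> 0 < eps -> exists del, 0 < del <= rho /\
  forall (z0 u v s : C), Cmod (u - z0) < del -> Cmod (v - z0) < del ->
    Cmod (Cexp (u * s) - Cexp (v * s) - (u - v) * (s * Cexp (z0 * s))) <=
    eps * Cmod (u - v) * exp (Re (z0 * s)%C + rho * Cmod s).
Proof.
  intros Hrho He.
  assert (Hr2 : 0 < rho ^ 2) by (apply pow_lt, Hrho).
  (* The error is at most 3 del |w| |s|^2 exp (3 del |s|). The first bound gives 3 del <= rho / 2,
     the second cancels 3 del times 16 / rho^2, the constant in |s|^2 <= 16 / rho^2 exp (rho |s| /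
     2). *)
  set (del := Rmin (rho / 6) (eps * (rho ^ 2 / 48))).
  assert (Hdel : 0 < del).
  { apply Rmin_pos; [lra|]. apply Rmult_lt_0_compat; [exact He|apply Rdiv_lt_0_compat; lra]. }
  assert (Hdel1 : del <= rho / 6) by apply Rmin_l.
  assert (Hdel2 : 3 * del * (16 / rho ^ 2) <= eps).
  { apply Rle_trans with (3 * (eps * (rho ^ 2 / 48)) * (16 / rho ^ 2)).
    - apply Rmult_le_compat_r; [left; apply Rdiv_lt_0_compat; lra|].
      apply Rmult_le_compat_l; [lra|apply Rmin_r].
    - right. field. lra. }
  exists del. split; [lra|]. intros z0 u v s Hu Hv.
  set (w := (u - v)%C).
  assert (Hw : Cmod w <= 2 * del).
  { unfold w. replace (u - v)%C with ((u - z0) + - (v - z0))%C by ring.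
    eapply Rle_trans; [apply Cmod_triangle|]. rewrite Cmod_opp. lra. }
  pose proof (Cmod_ge_0 w) as Hw0.
  set (S := Cmod s). assert (HS : 0 <= S) by apply Cmod_ge_0.
  set (v' := ((v - z0) * s)%C). set (ws := (w * s)%C).
  replace (Cexp (u * s) - Cexp (v * s) - w * (s * Cexp (z0 * s)))%C with
    (Cexp (z0 * s) * (Cexp v' * (Cexp ws - 1 - ws) + (Cexp v' - 1) * ws))%C.
  2:{ replace (Cexp (u * s)) with (Cexp (z0 * s + (v' + ws))) by (f_equal; unfold v', ws, w; ring).
      replace (Cexp (v * s)) with (Cexp (z0 * s + v')) by (f_equal; unfold v'; ring).
      rewrite !Cexp_plus. unfold ws. ring. }
  assert (Hv1 : Cmod v' <= del * S).
  { unfold v'. rewrite Cmod_mult. apply Rmult_le_compat_r; [exact HS|lra]. }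
  assert (Hws : Cmod ws = Cmod w * S) by apply Cmod_mult.
  assert (Hws2 : Cmod ws <= 2 * del * S) by (rewrite Hws; apply Rmult_le_compat_r; assumption).
  set (Q := exp (3 * del * S)).
  assert (B : Cmod (Cexp v' * (Cexp ws - 1 - ws) + (Cexp v' - 1) * ws) <= 3 * del * Cmod w * S ^ 2 * Q).
  { eapply Rle_trans; [apply Cmod_triangle|]. rewrite !Cmod_mult.
    assert (B1 : Cmod (Cexp v') * Cmod (Cexp ws - 1 - ws) <= 2 * del * Cmod w * S ^ 2 * Q).
    { apply Rle_trans with (exp (del * S) * (Cmod ws ^ 2 * exp (2 * del * S))).
      - apply Rmult_le_compat; try apply Cmod_ge_0.
        + eapply Rle_trans; [apply Cmod_Cexp_le|]. apply exp_mono, Hv1.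
        + eapply Rle_trans; [apply Cexp_minus_lin_bound|].
          apply Rmult_le_compat_l; [apply pow2_ge_0|]. apply exp_mono, Hws2.
      - replace (exp (del * S) * (Cmod ws ^ 2 * exp (2 * del * S))) with (Cmod ws ^ 2 * Q).
        2:{ unfold Q. replace (3 * del * S) with (del * S + 2 * del * S) by ring. rewrite exp_plus. ring. }
        apply Rmult_le_compat_r; [left; apply exp_pos|].
        rewrite Hws. replace ((Cmod w * S) ^ 2) with (Cmod w * (Cmod w * S ^ 2)) by ring.
        replace (2 * del * Cmod w * S ^ 2) with (2 * del * (Cmod w * S ^ 2)) by ring.
        apply Rmult_le_compat_r; [|exact Hw].
        apply Rmult_le_pos; [exact Hw0|apply pow2_ge_0]. }
    assert (B2 : Cmod (Cexp v' - 1) * Cmod ws <= del * Cmod w * S ^ 2 * Q).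
    { apply Rle_trans with (del * S * Q * (Cmod w * S)).
      - rewrite Hws. apply Rmult_le_compat_r; [rewrite <- Hws; apply Cmod_ge_0|].
        eapply Rle_trans; [apply Cexp_minus_1_bound|].
        apply Rmult_le_compat; [apply Cmod_ge_0|left; apply exp_pos|exact Hv1|].
        apply exp_mono. assert (0 <= del * S) by (apply Rmult_le_pos; lra). lra.
      - right. ring. }
    lra. }
  rewrite Cmod_mult, Cmod_Cexp, exp_plus.
  assert (B3 : S ^ 2 * Q <= 16 / rho ^ 2 * exp (rho * S)).
  { pose proof (sqr_le_exp (rho * S / 2) ltac:(apply Rmult_le_pos; [apply Rmult_le_pos; lra|lra])) as X.
    assert (X2 : S ^ 2 <= 16 / rho ^ 2 * exp (rho * S / 2)).
    { replace (S ^ 2) with (4 / rho ^ 2 * (rho * S / 2) ^ 2) by (field; lra).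
      replace (16 / rho ^ 2 * exp (rho * S / 2)) with (4 / rho ^ 2 * (4 * exp (rho * S / 2))) by (field; lra).
      apply Rmult_le_compat_l; [|exact X]. apply Rlt_le, Rdiv_lt_0_compat; lra. }
    assert (X3 : Q <= exp (rho * S / 2)).
    { apply exp_mono. assert (3 * del * S <= rho / 2 * S) by (apply Rmult_le_compat_r; lra). lra. }
    apply Rle_trans with (16 / rho ^ 2 * exp (rho * S / 2) * exp (rho * S / 2)).
    - apply Rmult_le_compat; [apply pow2_ge_0|left; apply exp_pos|exact X2|exact X3].
    - rewrite Rmult_assoc, <- exp_plus. right. f_equal. f_equal. field. }
  pose proof (exp_pos (Re (z0 * s)%C)) as HE.
  replace (eps * Cmod w * (exp (Re (z0 * s)%C) * exp (rho * S))) with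
    (exp (Re (z0 * s)%C) * (eps * Cmod w * exp (rho * S))) by ring.
  apply Rmult_le_compat_l; [lra|]. eapply Rle_trans; [exact B|].
  apply Rle_trans with (3 * del * Cmod w * (16 / rho ^ 2 * exp (rho * S))).
  - rewrite Rmult_assoc. apply Rmult_le_compat_l; [|exact B3]. apply Rmult_le_pos; lra.
  - replace (3 * del * Cmod w * (16 / rho ^ 2 * exp (rho * S))) with
      (3 * del * (16 / rho ^ 2) * (Cmod w * exp (rho * S))) by ring.
    rewrite (Rmult_assoc eps). apply Rmult_le_compat_r; [|exact Hdel2].
    apply Rmult_le_pos; [exact Hw0|left; apply exp_pos].
Qed.

(** One decay hypothesis at [z0], with the margin [rho * Cmod (s t)], dominates the integrand for
    every z within [rho] of [z0], its derivative in z, and the error of [Cexp_param_diff]. *)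
Lemma hol_HInt_Cexp (s c : R -> C) (z0 : C) rho M d : 0 < rho -> 0 < d ->
  (forall t, ccont s t) -> (forall t, ccont c t) ->
  (forall t, 0 <= t -> Cmod (c t) * exp (Re (z0 * s t)%C + rho * Cmod (s t)) <= M * exp (- (d * t))) ->
  hol (fun z => HInt (fun t => Cexp (z * s t) * c t)%C) z0.
Proof.
  intros Hrho Hd Hs Hc Hb.
  assert (HM : 0 <= M).
  { specialize (Hb 0 (Rle_refl 0)). rewrite Rmult_0_r, Ropp_0, exp_0 in Hb.
    pose proof (Rmult_le_pos _ _ (Cmod_ge_0 (c 0)) (Rlt_le _ _ (exp_pos (Re (z0 * s 0)%C + rho * Cmod (s 0))))). lra. }
  assert (Hcz : forall z t, ccont (U := R_UniformSpace) (fun t => Cexp (z * s t) * c t)%C t).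
  { intros z t. apply ccont_mult; [|apply Hc]. apply ccont_Cexp, ccont_mult; [apply ccont_const|apply Hs]. }
  assert (HE : forall z, Cmod (z - z0) < rho -> hdecay (fun t => Cexp (z * s t) * c t)%C).
  { intros z Hz. exists M, d. split; [exact Hd|]. split; [apply Hcz|].
    intros t Ht. eapply Rle_trans; [|apply (Hb t Ht)].
    rewrite Cmod_mult, Cmod_Cexp, Rmult_comm. apply Rmult_le_compat_l; [apply Cmod_ge_0|].
    apply exp_mono. replace (z * s t)%C with (z0 * s t + (z - z0) * s t)%C by ring.
    rewrite Re_plus. apply Rplus_le_compat_l.
    eapply Rle_trans; [apply Rle_abs|]. eapply Rle_trans; [apply re_le_Cmod|].
    rewrite Cmod_mult. apply Rmult_le_compat_r; [apply Cmod_ge_0|lra]. }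
  (* The extra factor [s t] is absorbed by the margin, as rho |s| <= exp (rho |s|). *)
  assert (HD : hdecay (fun t => s t * (Cexp (z0 * s t) * c t))%C).
  { exists (M / rho), d. split; [exact Hd|]. split; [intros t; apply ccont_mult; [apply Hs|apply Hcz]|].
    intros t Ht. specialize (Hb t Ht). rewrite exp_plus in Hb.
    rewrite !Cmod_mult, Cmod_Cexp.
    pose proof (exp_ineq1_le (rho * Cmod (s t))) as H1.
    apply Rmult_le_reg_l with rho; [exact Hrho|].
    replace (rho * (M / rho * exp (- (d * t)))) with (M * exp (- (d * t))) by (field; lra).
    eapply Rle_trans; [|exact Hb].
    replace (rho * (Cmod (s t) * (exp (Re (z0 * s t)%C) * Cmod (c t)))) with
      (Cmod (c t) * exp (Re (z0 * s t)%C) * (rho * Cmod (s t))) by ring.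
    rewrite <- (Rmult_assoc _ (exp (Re (z0 * s t)%C))). apply Rmult_le_compat_l; [|lra].
    apply Rmult_le_pos; [apply Cmod_ge_0|left; apply exp_pos]. }
  exists (HInt (fun t => s t * (Cexp (z0 * s t) * c t))%C).
  intros eps He.
  assert (He' : 0 < eps * d / (M + 1)) by (apply Rdiv_lt_0_compat; [apply Rmult_lt_0_compat; assumption|lra]).
  destruct (Cexp_param_diff rho _ Hrho He') as [del [[Hdel Hdr] Hdiff]].
  exists del. split; [exact Hdel|]. intros u v Hu Hv.
  pose proof (HE u ltac:(lra)) as Eu. pose proof (HE v ltac:(lra)) as Ev.
  replace (HInt (fun t => Cexp (u * s t) * c t) - HInt (fun t => Cexp (v * s t) * c t) -
    HInt (fun t => s t * (Cexp (z0 * s t) * c t)) * (u - v))%C with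
    (HInt (fun t => (Cexp (u * s t) * c t + (- RtoC 1) * (Cexp (v * s t) * c t)) +
       (- (u - v)) * (s t * (Cexp (z0 * s t) * c t)))%C).
  2:{ rewrite HInt_plus, HInt_plus, !HInt_scal; try assumption; [ring| | |].
      - apply hdecay_scal, Ev.
      - apply hdecay_plus; [|apply hdecay_scal]; assumption.
      - apply hdecay_scal, HD. }
  pose proof (Cmod_ge_0 (u - v)) as Hw0.
  apply Rle_trans with (eps * d / (M + 1) * Cmod (u - v) * M / d).
  - apply HInt_bound. split; [exact Hd|]. split.
    + intros t. apply ccont_plus; [apply ccont_plus; [|apply ccont_mult; [apply ccont_const|]]; apply Hcz|].
      apply ccont_mult; [apply ccont_const|]. apply ccont_mult; [apply Hs|apply Hcz].
    + intros t Ht.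
      replace (Cexp (u * s t) * c t + (- RtoC 1) * (Cexp (v * s t) * c t) +
         (- (u - v)) * (s t * (Cexp (z0 * s t) * c t)))%C with
        (c t * (Cexp (u * s t) - Cexp (v * s t) - (u - v) * (s t * Cexp (z0 * s t))))%C by ring.
      rewrite Cmod_mult.
      eapply Rle_trans; [apply Rmult_le_compat_l; [apply Cmod_ge_0|apply (Hdiff z0 u v (s t) Hu Hv)]|].
      match goal with |- ?C * (?E * ?W * ?X) <= ?E * ?W * M * ?Y =>
        replace (C * (E * W * X)) with (E * W * (C * X)) by ring;
        replace (E * W * M * Y) with (E * W * (M * Y)) by ring end.
      apply Rmult_le_compat_l; [apply Rmult_le_pos; lra|apply Hb, Ht].
  - replace (eps * d / (M + 1) * Cmod (u - v) * M / d) with (eps * Cmod (u - v) * (M / (M + 1))) by (field; lra).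
    rewrite <- (Rmult_1_r (eps * Cmod (u - v))) at 2. apply Rmult_le_compat_l; [apply Rmult_le_pos; lra|].
    apply Rmult_le_reg_r with (M + 1); [lra|]. replace (M / (M + 1) * (M + 1)) with M by (field; lra). lra.
Qed.

Lemma hol_CInt_Cexp (s c : R -> C) (z0 : C) a b M : a <= b ->
  (forall t, ccont s t) -> (forall t, ccont c t) ->
  (forall t, a <= t <= b -> Cmod (c t) * exp (Re (z0 * s t)%C + 1 * Cmod (s t)) <= M) ->
  hol (fun z => CInt (fun t => Cexp (z * s t) * c t)%C a b) z0.
Proof.
  intros Hab Hs Hc Hb.
  assert (HM : 0 <= M).
  { eapply Rle_trans; [|apply (Hb a ltac:(lra))]. apply Rmult_le_pos; [apply Cmod_ge_0|left; apply exp_pos]. }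
  assert (Hcz : forall z t, ccont (U := R_UniformSpace) (fun t => Cexp (z * s t) * c t)%C t).
  { intros z t. apply ccont_mult; [|apply Hc]. apply ccont_Cexp, ccont_mult; [apply ccont_const|apply Hs]. }
  assert (Hczs : forall t, ccont (U := R_UniformSpace) (fun t => s t * (Cexp (z0 * s t) * c t))%C t).
  { intros t. apply ccont_mult; [apply Hs|apply Hcz]. }
  exists (CInt (fun t => s t * (Cexp (z0 * s t) * c t))%C a b).
  intros eps He.
  assert (HD : 0 < (b - a) * M + 1) by (assert (0 <= (b - a) * M) by (apply Rmult_le_pos; lra); lra).
  assert (He' : 0 < eps / ((b - a) * M + 1)) by (apply Rdiv_lt_0_compat; assumption).
  destruct (Cexp_param_diff 1 _ Rlt_0_1 He') as [del [[Hdel _] Hdiff]].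
  exists del. split; [exact Hdel|]. intros u v Hu Hv.
  assert (C1 : forall z, cont_on (fun t => Cexp (z * s t) * c t)%C a b) by (intros; apply cont_on_all, Hcz).
  assert (C2 : cont_on (fun t => s t * (Cexp (z0 * s t) * c t))%C a b) by (apply cont_on_all, Hczs).
  rewrite (Cmult_comm (CInt (fun t => s t * (Cexp (z0 * s t) * c t))%C a b)).
  rewrite <- CInt_minus; [|apply C1|apply C1]. rewrite <- CInt_scal by exact C2.
  rewrite <- CInt_minus; [|intros t Ht; apply ccont_minus; apply C1, Ht|apply cont_on_scal, C2].
  pose proof (Cmod_ge_0 (u - v)) as Hw0.
  apply Rle_trans with ((b - a) * (eps / ((b - a) * M + 1) * Cmod (u - v) * M)).
  - apply CInt_bound_const; [exact Hab| |].
    + intros t Ht. apply ccont_minus; [apply ccont_minus; apply C1, Ht|].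
      apply ccont_mult; [apply ccont_const|apply Hczs].
    + intros t Ht.
      replace (Cexp (u * s t) * c t - Cexp (v * s t) * c t - (u - v) * (s t * (Cexp (z0 * s t) * c t)))%C with
        (c t * (Cexp (u * s t) - Cexp (v * s t) - (u - v) * (s t * Cexp (z0 * s t))))%C by ring.
      rewrite Cmod_mult.
      eapply Rle_trans; [apply Rmult_le_compat_l; [apply Cmod_ge_0|apply (Hdiff z0 u v (s t) Hu Hv)]|].
      match goal with |- ?C * (?E * ?W * ?X) <= _ =>
        replace (C * (E * W * X)) with (E * W * (C * X)) by ring end.
      apply Rmult_le_compat_l; [apply Rmult_le_pos; lra|apply Hb, Ht].
  - replace ((b - a) * (eps / ((b - a) * M + 1) * Cmod (u - v) * M)) with
      (eps * Cmod (u - v) * ((b - a) * M / ((b - a) * M + 1))) by (field; lra).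
    rewrite <- (Rmult_1_r (eps * Cmod (u - v))) at 2. apply Rmult_le_compat_l; [apply Rmult_le_pos; lra|].
    apply Rmult_le_reg_r with ((b - a) * M + 1); [lra|].
    replace ((b - a) * M / ((b - a) * M + 1) * ((b - a) * M + 1)) with ((b - a) * M) by (field; lra). lra.
Qed.

(** * Rotation of the path of integration *)

Lemma uniform_continuity_C (g : R * R -> C) a b c d :
  (forall x y, a <= x <= b -> c <= y <= d ->
     ccont (U := prod_UniformSpace R_UniformSpace R_UniformSpace) g (x, y)) ->
  forall eps, 0 < eps -> exists del, 0 < del /\ forall x y u v,
    a <= x <= b -> c <= y <= d -> a <= u <= b -> c <= v <= d ->
    Rabs (u - x) < del -> Rabs (v - y) < del -> Cmod (g (u, v) - g (x, y)) < eps.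
Proof.
  intros H eps He. assert (He2 : 0 < eps / 2) by lra.
  assert (H1 : forall x y, a <= x <= b -> c <= y <= d -> continuity_2d_pt (fun x y => Re (g (x, y))) x y).
  { intros x y Hx Hy. apply continuity_2d_pt_filterlim.
    apply filterlim_ext with (fun z => Re (g z)); [intros [? ?]; reflexivity|].
    exact (ccont_Re _ _ (H x y Hx Hy)). }
  assert (H2 : forall x y, a <= x <= b -> c <= y <= d -> continuity_2d_pt (fun x y => Im (g (x, y))) x y).
  { intros x y Hx Hy. apply continuity_2d_pt_filterlim.
    apply filterlim_ext with (fun z => Im (g z)); [intros [? ?]; reflexivity|].
    exact (ccont_Im _ _ (H x y Hx Hy)). }
  destruct (uniform_continuity_2d _ a b c d H1 (mkposreal _ He2)) as [d1 K1].
  destruct (uniform_continuity_2d _ a b c d H2 (mkposreal _ He2)) as [d2 K2].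
  exists (Rmin d1 d2). split; [apply Rmin_pos; apply cond_pos|].
  intros x y u v Hx Hy Hu Hv Hux Hvy.
  pose proof (Rmin_l d1 d2). pose proof (Rmin_r d1 d2).
  specialize (K1 x y u v Hx Hy Hu Hv ltac:(lra) ltac:(lra)).
  specialize (K2 x y u v Hx Hy Hu Hv ltac:(lra) ltac:(lra)). simpl in K1, K2.
  eapply Rle_lt_trans; [apply Cmod_le_Re_Im|].
  change (Re (g (u, v) - g (x, y))) with (Re (g (u, v)) - Re (g (x, y))).
  change (Im (g (u, v) - g (x, y))) with (Im (g (u, v)) - Im (g (x, y))). lra.
Qed.

Lemma ccont_polar (j : C) (G : C -> C) (x y : R) : ccont G (x + j * y)%C ->
  ccont (U := prod_UniformSpace R_UniformSpace R_UniformSpace)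
    (fun z : R * R => G (fst z + j * snd z)%C) (x, y).
Proof.
  intros H.
  apply (ccont_comp (U := prod_UniformSpace R_UniformSpace R_UniformSpace) (V := C_UniformSpace)
    (fun z : R * R => (fst z + j * snd z)%C) G); [|exact H].
  apply ccont_plus; [|apply ccont_mult; [apply ccont_const|]]; apply ccont_RtoC;
    [apply continuous_fst|apply continuous_snd].
Qed.

(** Cauchy's theorem on [-T, T] times [al, be], where the uniform decay makes the vertical sides
    vanish as T grows. Holomorphy is available in the open strip only, so the rectangle is first
    shrunk by h and then extended by continuity. *)
Lemma rotation (eta al be : R) (G : C -> C) M d : eta <> 0 -> al < be -> 0 < d ->
  strip_hol (0, eta) al be G ->
  (forall t th : R, al <= th <= be -> ccont G (t + (0, eta) * th)%C) ->
  (forall t th : R, al <= th <= be -> Cmod (G (t + (0, eta) * th)%C) <= M * exp (- (d * Rabs t))) ->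
  LInt (fun t : R => G (t + (0, eta) * al)%C) = LInt (fun t : R => G (t + (0, eta) * be)%C).
Proof.
  intros He Hab Hd Hh Hc Hb. set (j := (0, eta) : C) in *.
  assert (Hcl : forall th t : R, al <= th <= be -> ccont (fun t : R => G (t + j * th)%C) t).
  { intros th t Hth. apply (ccont_path G (fun t : R => (t + j * th)%C)); [cc|apply Hc, Hth]. }
  assert (Hld : forall th, al <= th <= be -> ldecay (fun t : R => G (t + j * th)%C) M d).
  { intros th Hth. split; [exact Hd|]. split; [intros t; apply Hcl, Hth|intros t; apply Hb, Hth]. }
  assert (HM : 0 <= M).
  { specialize (Hb 0 al ltac:(lra)). rewrite Rabs_R0, Rmult_0_r, Ropp_0, exp_0 in Hb.
    pose proof (Cmod_ge_0 (G (0 + j * al)%C)). lra. }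
  assert (Hj : 0 <= Cmod j) by apply Cmod_ge_0.
  assert (Hcross : forall T, 0 <= T ->
    Cmod (CInt (fun t : R => G (t + j * be)%C) (- T) T - CInt (fun t : R => G (t + j * al)%C) (- T) T)
      <= Cmod j * ((be - al) * (2 * M * exp (- (d * T))))).
  { intros T HT. apply le_epsilon. intros eps Heps.
    (* The horizontal sides have length 2 T, so each displacement by h costs at most eps / 2. *)
    assert (Hp : 0 < eps / (4 * T + 4)) by (apply Rdiv_lt_0_compat; lra).
    destruct (uniform_continuity_C (fun z => G (fst z + j * snd z)%C) (- T) T al be
      (fun x y _ Hy => ccont_polar j G x y (Hc x y Hy)) _ Hp) as [del [Hdel U]].
    simpl in U.
    set (h := Rmin (del / 2) ((be - al) / 2)).
    assert (Hh0 : 0 < h) by (apply Rmin_pos; lra).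
    assert (Hh1 : h <= del / 2) by apply Rmin_l.
    assert (Hh2 : h <= (be - al) / 2) by apply Rmin_r.
    assert (Hnear : forall th th', al <= th <= be -> al <= th' <= be -> Rabs (th - th') < del ->
      Cmod (CInt (fun t : R => G (t + j * th)%C) (- T) T - CInt (fun t : R => G (t + j * th')%C) (- T) T) <= eps / 2).
    { intros th th' Hth Hth' Hd'.
      rewrite <- CInt_minus by (apply cont_on_all; intros t; apply Hcl; assumption).
      apply Rle_trans with ((T - - T) * (eps / (4 * T + 4))).
      - apply CInt_bound_const; [lra| |].
        + apply cont_on_all. intros t. apply ccont_minus; apply Hcl; assumption.
        + intros t Ht. left. apply U; try assumption.
          replace (t - t) with 0 by ring. rewrite Rabs_R0. exact Hdel.
      - apply Rmult_le_reg_r with (4 * T + 4); [lra|].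
        replace ((T - - T) * (eps / (4 * T + 4)) * (4 * T + 4)) with (2 * T * eps) by (field; lra). nra. }
    assert (N1 : Cmod (CInt (fun t : R => G (t + j * be)%C) (- T) T -
       CInt (fun t : R => G (t + j * (be - h)%R)%C) (- T) T) <= eps / 2).
    { apply Hnear; try lra. replace (be - (be - h)) with h by ring. rewrite Rabs_pos_eq; lra. }
    assert (N2 : Cmod (CInt (fun t : R => G (t + j * (al + h)%R)%C) (- T) T -
       CInt (fun t : R => G (t + j * al)%C) (- T) T) <= eps / 2).
    { apply Hnear; try lra. replace (al + h - al) with h by ring. rewrite Rabs_pos_eq; lra. }
    pose proof (cauchy_rectangle eta al be G (- T) T (al + h) (be - h) He Hh ltac:(lra) ltac:(lra) ltac:(lra)) as R0.
    fold j in R0.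
    assert (N3 : Cmod (CInt (fun t : R => G (t + j * (be - h)%R)%C) (- T) T -
       CInt (fun t : R => G (t + j * (al + h)%R)%C) (- T) T) <= Cmod j * ((be - al) * (2 * M * exp (- (d * T))))).
    { rewrite R0, Cmod_mult. apply Rmult_le_compat_l; [exact Hj|].
      assert (P0 : 0 <= 2 * M * exp (- (d * T))).
      { apply Rmult_le_pos; [lra|left; apply exp_pos]. }
      apply Rle_trans with ((be - h - (al + h)) * (2 * M * exp (- (d * T)))).
      - apply CInt_bound_const; [lra| |].
        + intros u Hu. rewrite Rmin_left, Rmax_right in Hu by lra.
          assert (Hvv : forall t : R, ccont (fun th : R => G (t + j * th)%C) u).
          { intros t. apply (ccont_path G (fun th : R => (t + j * th)%C)); [cc|apply Hc; lra]. }
          apply ccont_minus; apply Hvv.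
        + intros u Hu. unfold Cminus. eapply Rle_trans; [apply Cmod_triangle|]. rewrite Cmod_opp.
          pose proof (Hb T u ltac:(lra)) as B1. pose proof (Hb (- T) u ltac:(lra)) as B2.
          rewrite Rabs_Ropp in B2. rewrite Rabs_pos_eq in B1, B2 by exact HT. lra.
      - apply Rmult_le_compat_r; lra. }
    match type of N1 with Cmod (?A - ?B) <= _ => match type of N2 with Cmod (?B' - ?A') <= _ =>
      replace (A - A')%C with ((A - B) + ((B - B') + (B' - A')))%C by ring end end.
    eapply Rle_trans; [apply Cmod_triangle|].
    eapply Rle_trans; [apply Rplus_le_compat_l, Cmod_triangle|]. lra. }
  apply Cmod_small_eq. intros eps Heps. assert (He3 : 0 < eps / 3) by lra.
  destruct (LInt_lim _ M d _ (Hld al ltac:(lra)) He3) as [T1 [P1 H1]].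
  destruct (LInt_lim _ M d _ (Hld be ltac:(lra)) He3) as [T2 [P2 H2]].
  destruct (decay_small (Cmod j * ((be - al) * (2 * M))) d _ Hd He3) as [T3 [P3 H3]].
  set (T := T1 + T2 + T3).
  specialize (H1 T ltac:(unfold T; lra)). specialize (H2 T ltac:(unfold T; lra)).
  specialize (H3 T ltac:(unfold T; lra)). specialize (Hcross T ltac:(unfold T; lra)).
  match type of H1 with Cmod (?A - ?B) < _ => match type of H2 with Cmod (?A' - ?B') < _ =>
    replace (A - A')%C with ((A - B) + (- (A' - B') + - (B' - B)))%C by ring end end.
  eapply Rle_trans; [apply Cmod_triangle|].
  eapply Rle_trans; [apply Rplus_le_compat_l, Cmod_triangle|]. rewrite !Cmod_opp. lra.
Qed.

(** * Functions analytic in the right half-plane, in polar coordinates *)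

Definition clamp (th : R) : R := Rmax (- (PI / 2)) (Rmin (PI / 2) th).

Lemma clamp_range th : - (PI / 2) <= clamp th <= PI / 2.
Proof.
  pose proof PI_RGT_0. unfold clamp. split; [apply Rmax_l|].
  apply Rmax_lub; [lra|apply Rmin_l].
Qed.

Lemma clamp_id th : - (PI / 2) <= th <= PI / 2 -> clamp th = th.
Proof. intros H. unfold clamp. rewrite Rmin_right, Rmax_right by lra. reflexivity. Qed.

Lemma clamp_lip x y : Rabs (clamp x - clamp y) <= Rabs (x - y).
Proof.
  unfold clamp, Rmax, Rmin.
  repeat destruct Rle_dec; apply Rabs_le_between; pose proof (Rabs_maj2 (x - y)); pose proof (Rle_abs (x - y)); lra.
Qed.

(* The clamp makes f o polar continuous on the whole plane, although f has boundary values
   only from the right. *)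
Definition polar (w : C) : C := Cexp (RtoC (Re w) + Ci * RtoC (clamp (Im w))).

Lemma polar_eq (eta t th : R) : (eta = 1 \/ eta = -1) -> - (PI / 2) <= th <= PI / 2 ->
  polar (t + (0, eta) * th)%C = Cexp (t + (0, eta) * th).
Proof.
  intros He Hth. unfold polar. f_equal.
  assert (E1 : Re (t + (0, eta) * th)%C = t) by (unfold Re, Cplus, Cmult, RtoC; simpl; ring).
  assert (E2 : Im (t + (0, eta) * th)%C = eta * th) by (unfold Im, Cplus, Cmult, RtoC; simpl; ring).
  rewrite E1, E2, clamp_id by (destruct He as [->| ->]; lra).
  unfold Cplus, Cmult, RtoC, Ci; simpl. f_equal; ring.
Qed.

Lemma Re_Cexp_polar (t : R) (y : R) : Re (Cexp (RtoC t + Ci * RtoC y)) = exp t * cos y.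
Proof.
  unfold Cexp, Re, Im, Cplus, Cmult, RtoC, Ci; simpl.
  replace (t + (0 * y - 1 * 0)) with t by ring. replace (0 + (0 * 0 + 1 * y)) with y by ring. ring.
Qed.

Lemma Re_polar_ge_0 w : 0 <= Re (polar w).
Proof.
  unfold polar. rewrite Re_Cexp_polar. apply Rmult_le_pos; [left; apply exp_pos|].
  destruct (clamp_range (Im w)). apply cos_ge_0; lra.
Qed.

Lemma Cmod_polar w : Cmod (polar w) = exp (Re w).
Proof.
  unfold polar. rewrite Cmod_Cexp. f_equal.
  unfold Re, Cplus, Cmult, RtoC, Ci; simpl. ring.
Qed.

Lemma ccont_polar_map w : ccont polar w.
Proof.
  apply ccont_Cexp. apply ccont_plus; [|apply ccont_mult; [apply ccont_const|]]; apply ccont_RtoC.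
  - apply ccont_Re, ccont_id.
  - apply (continuous_comp (U := C_UniformSpace) (fun y => Im y) clamp).
    + apply ccont_Im, ccont_id.
    + apply filterlim_locally. intros eps. exists eps. intros y Hy.
      eapply Rle_lt_trans; [apply clamp_lip|exact Hy].
Qed.

(** Unifies the two clauses of the definition: analyticity at interior points, one-sided limits at
    boundary points other than 0. *)
Lemma right_half_plane_close f z eps : analytic_right_half_plane f -> 0 <= Re z -> z <> 0 -> 0 < eps ->
  exists d, 0 < d /\ forall w, 0 <= Re w -> Cmod (w - z) < d -> Cmod (f w - f z) < eps.
Proof.
  intros [Ha Hb] Hz Hz0 He. destruct Hz as [Hz|Hz].
  - destruct (analytic_hol f z (Ha z Hz)) as [l Hl].
    destruct (sdiff_close f z l Hl eps He) as [d [Hd K]].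
    exists d. split; [exact Hd|]. intros w _ Hw. apply K, Hw.
  - pose proof (Hb z (eq_sym Hz) Hz0) as K.
    assert (Fi : Filter (within (fun w : C => 0 <= Re w) (locally (T := C_UniformSpace) z))).
    { apply within_filter, locally_filter. }
    pose proof (proj1 (filterlim_C_iff _ Fi f (f z)) K eps He) as K2.
    unfold within in K2. apply (proj1 (locally_Cmod z _)) in K2.
    destruct K2 as [d [Hd K2]]. exists d. split; [exact Hd|]. intros w Hw Hd'. apply K2; assumption.
Qed.

Lemma ccont_f_polar f w : analytic_right_half_plane f -> ccont (fun w => f (polar w)) w.
Proof.
  intros Hf. apply (ccont_iff_loc (U := C_UniformSpace)). intros eps He.
  assert (Hn : polar w <> 0) by apply Cexp_neq_0.
  destruct (right_half_plane_close f (polar w) eps Hf (Re_polar_ge_0 w) Hn He) as [d [Hd K]].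
  generalize (proj1 (ccont_iff_loc (U := C_UniformSpace) polar w) (ccont_polar_map w) d Hd).
  apply filter_imp. intros y Hy. apply K; [apply Re_polar_ge_0|exact Hy].
Qed.

(** By uniform continuity the modulus grows by less than 1 at each step of size del / 2, and a fixed
    number of steps from the corner (a, c) reaches every point. *)
Lemma continuous_bounded_rectangle (g : R * R -> C) a b c d : a <= b -> c <= d ->
  (forall x y, a <= x <= b -> c <= y <= d ->
     ccont (U := prod_UniformSpace R_UniformSpace R_UniformSpace) g (x, y)) ->
  exists M, forall x y, a <= x <= b -> c <= y <= d -> Cmod (g (x, y)) <= M.
Proof.
  intros Hab Hcd H.
  destruct (uniform_continuity_C g a b c d H 1 Rlt_0_1) as [del [Hdel U]].
  assert (HB : forall n x y, a <= x <= b -> c <= y <= d -> x - a <= INR n * (del / 2) -> y - c <= INR n * (del / 2) ->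
     Cmod (g (x, y)) <= Cmod (g (a, c)) + INR n).
  { induction n as [|n IH]; intros x y Hx Hy Hx2 Hy2.
    - simpl in Hx2, Hy2. replace x with a by lra. replace y with c by lra. simpl. lra.
    - rewrite S_INR in *.
      set (x' := Rmax a (x - del / 2)). set (y' := Rmax c (y - del / 2)).
      assert (Hx' : a <= x' <= b) by (unfold x', Rmax; destruct Rle_dec; lra).
      assert (Hy' : c <= y' <= d) by (unfold y', Rmax; destruct Rle_dec; lra).
      assert (Dn : 0 <= INR n * (del / 2)) by (apply Rmult_le_pos; [apply pos_INR|lra]).
      assert (B : Cmod (g (x', y')) <= Cmod (g (a, c)) + INR n).
      { apply IH; try assumption; unfold x', y', Rmax; destruct Rle_dec; lra. }
      assert (U1 : Cmod (g (x, y) - g (x', y')) < 1).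
      { apply U; try assumption; apply Rabs_def1; unfold x', y', Rmax; destruct Rle_dec; lra. }
      pose proof (Cmod_triangle (g (x, y) - g (x', y')) (g (x', y'))) as T.
      replace (g (x, y) - g (x', y') + g (x', y'))%C with (g (x, y)) in T by ring. lra. }
  destruct (INR_eventually_ge (((b - a) + (d - c)) / (del / 2))) as [N HN].
  specialize (HN N (Nat.le_refl N)).
  assert (HN2 : (b - a) + (d - c) <= INR N * (del / 2)).
  { apply Rmult_le_compat_r with (r := del / 2) in HN; [|lra].
    replace (((b - a) + (d - c)) / (del / 2) * (del / 2)) with ((b - a) + (d - c)) in HN by (field; lra). exact HN. }
  exists (Cmod (g (a, c)) + INR N). intros x y Hx Hy. apply HB; try assumption; lra.
Qed.

(** Merges the power bound at infinity, the bound near 0 and compactness of the half-annulus in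
    between into f (z) = O (exp (eps |z|)) for every eps, on the closed half-plane without 0. This
    is the form in which the growth of f enters the rotation. *)
Lemma right_half_plane_subexp f sigma K M :
  analytic_right_half_plane f -> 0 < K ->
  (exists R0 : R, 0 < R0 /\ forall z : C, 0 < Re z -> R0 < Cmod z -> Cmod (f z) <= K * Rpower (Cmod z) sigma) ->
  (exists r0 : R, 0 < r0 /\ forall z : C, 0 < Re z -> Cmod z < r0 -> Cmod (f z) <= M) ->
  forall eps, 0 < eps -> exists B, 0 < B /\ forall w, Cmod (f (polar w)) <= B * exp (eps * exp (Re w)).
Proof.
  intros Hf HK [R0 [HR0 Hinf]] [r0 [Hr0 Hzero]] eps He.
  destruct (exp_le_exp_exp (Rabs sigma) eps (Rabs_pos _) He) as [A [HA HAt]].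
  (* From R1 >= 1 the logarithm of the modulus is nonnegative, so [sigma] can be replaced by its
     absolute value; with r1 <= 1 the annulus is also well formed. *)
  set (R1 := Rmax R0 1).
  assert (HR1 : R0 <= R1) by apply Rmax_l. assert (HR1' : 1 <= R1) by apply Rmax_r.
  set (r1 := Rmin r0 1). assert (Hr1 : r1 <= r0) by apply Rmin_l. assert (Hr1' : r1 <= 1) by apply Rmin_r.
  assert (Hr1p : 0 < r1) by (apply Rmin_pos; lra).
  destruct (continuous_bounded_rectangle (fun z => f (polar (fst z + Ci * snd z)%C)) (ln r1) (ln R1) (- (PI / 2)) (PI / 2))
    as [B1 HB1].
  { apply ln_le; lra. }
  { pose proof PI_RGT_0; lra. }
  { intros x y _ _. apply (ccont_polar Ci (fun w => f (polar w))), ccont_f_polar, Hf. }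
  set (B := Rabs M + Rabs B1 + K * A * exp eps + 1).
  assert (HB : 0 < K * A * exp eps).
  { apply Rmult_lt_0_compat; [apply Rmult_lt_0_compat; assumption|apply exp_pos]. }
  pose proof (Rabs_pos M). pose proof (Rabs_pos B1). pose proof (Rle_abs M). pose proof (Rle_abs B1).
  exists B. split; [unfold B; lra|]. intros w.
  set (z := polar w).
  assert (Hz : Cmod z = exp (Re w)) by apply Cmod_polar.
  assert (Hzr : 0 <= Re z) by apply Re_polar_ge_0.
  assert (Hz0 : z <> 0) by apply Cexp_neq_0.
  assert (E1 : 1 <= exp (eps * exp (Re w))).
  { rewrite <- exp_0. apply exp_mono. apply Rmult_le_pos; [lra|left; apply exp_pos]. }
  destruct (right_half_plane_close f z 1 Hf Hzr Hz0 Rlt_0_1) as [d [Hd Hclose]].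
  (* The two growth hypotheses concern the open half-plane. A point of the boundary is pushed inside
     by a small real h, which changes f by less than 1 and the modulus by at most h. *)
  assert (Hshift : forall h, 0 < h -> h < d -> Cmod (f z) <= Cmod (f (z + h)%C) + 1 /\ 0 < Re (z + h)%C /\
     Cmod (z + h) <= Cmod z + h /\ Cmod z - h <= Cmod (z + h)).
  { intros h Hh Hhd.
    assert (Eh : Cmod (RtoC h) = h) by (rewrite Cmod_R, Rabs_pos_eq; lra).
    assert (Ezh : Cmod (z + h - z) = h) by (rewrite <- Eh at 2; f_equal; ring).
    assert (Rzh : Re (z + h)%C = Re z + h) by reflexivity.
    specialize (Hclose (z + h)%C ltac:(rewrite Rzh; lra) ltac:(rewrite Ezh; lra)).
    rewrite Cmod_minus_sym in Hclose.
    pose proof (Cmod_triangle (f z - f (z + h)%C) (f (z + h)%C)) as T.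
    replace (f z - f (z + h)%C + f (z + h)%C)%C with (f z) in T by ring.
    split; [lra|]. split; [rewrite Rzh; lra|]. split.
    - eapply Rle_trans; [apply Cmod_triangle|]. rewrite Eh. lra.
    - pose proof (Cmod_triangle (z + h) (- RtoC h)) as T2. rewrite Cmod_opp, Eh in T2.
      replace (z + h + - RtoC h)%C with z in T2 by ring. lra. }
  destruct (Rlt_le_dec (exp (Re w)) r1) as [Hsm|Hsm].
  - set (h := Rmin (d / 2) ((r1 - exp (Re w)) / 2)).
    assert (Hh : 0 < h) by (apply Rmin_pos; lra).
    assert (h <= d / 2) by apply Rmin_l. assert (h <= (r1 - exp (Re w)) / 2) by apply Rmin_r.
    destruct (Hshift h Hh ltac:(lra)) as [S1 [S2 [S3 S4]]].
    specialize (Hzero (z + h)%C S2 ltac:(lra)).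
    apply Rle_trans with (B * 1); [unfold B; lra|]. apply Rmult_le_compat_l; [unfold B; lra|exact E1].
  - destruct (Rlt_le_dec R1 (exp (Re w))) as [Hlg|Hlg].
    (* The shifted point must stay beyond [R1]; h <= 1 limits the loss in exp (eps |z|) to a factor
       exp eps. *)
    + set (h := Rmin (d / 2) (Rmin 1 ((exp (Re w) - R1) / 2))).
      assert (Hh : 0 < h) by (repeat apply Rmin_pos; lra).
      assert (h <= d / 2) by apply Rmin_l.
      assert (h <= Rmin 1 ((exp (Re w) - R1) / 2)) by apply Rmin_r.
      pose proof (Rmin_l 1 ((exp (Re w) - R1) / 2)). pose proof (Rmin_r 1 ((exp (Re w) - R1) / 2)).
      destruct (Hshift h Hh ltac:(lra)) as [S1 [S2 [S3 S4]]].
      specialize (Hinf (z + h)%C S2 ltac:(lra)).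
      set (m := Cmod (z + h)) in *.
      assert (P : Rpower m sigma <= A * exp (eps * m)).
      { unfold Rpower. apply Rle_trans with (exp (Rabs sigma * ln m)).
        - apply exp_mono. apply Rmult_le_compat_r; [|apply Rle_abs].
          rewrite <- ln_1. apply ln_le; lra.
        - specialize (HAt (ln m)). rewrite exp_ln in HAt by lra. exact HAt. }
      assert (P2 : exp (eps * m) <= exp eps * exp (eps * exp (Re w))).
      { rewrite <- exp_plus. apply exp_mono. nra. }
      assert (P3 : K * Rpower m sigma <= K * A * exp eps * exp (eps * exp (Re w))).
      { rewrite !Rmult_assoc. apply Rmult_le_compat_l; [lra|]. eapply Rle_trans; [exact P|].
        apply Rmult_le_compat_l; [lra|exact P2]. }
      apply Rle_trans with (K * A * exp eps * exp (eps * exp (Re w)) + 1 * exp (eps * exp (Re w))); [lra|].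
      rewrite <- Rmult_plus_distr_r. apply Rmult_le_compat_r; [left; apply exp_pos|unfold B; lra].
    + specialize (HB1 (Re w) (clamp (Im w))). simpl in HB1.
      assert (Ez : polar (Re w + Ci * clamp (Im w))%C = z).
      { unfold z, polar.
        replace (Re (Re w + Ci * clamp (Im w))%C) with (Re w).
        2:{ unfold Re, Cplus, Cmult, RtoC, Ci; simpl; ring. }
        replace (Im (Re w + Ci * clamp (Im w))%C) with (clamp (Im w)).
        2:{ unfold Im at 2, Cplus, Cmult, RtoC, Ci; simpl; ring. }
        rewrite (clamp_id (clamp (Im w))) by apply clamp_range. reflexivity. }
      rewrite Ez in HB1.
      apply Rle_trans with (B * 1).
      * rewrite Rmult_1_r. apply Rle_trans with B1; [|unfold B; lra]. apply HB1; [|apply clamp_range].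
        rewrite <- (ln_exp (Re w)). split; apply ln_le; try lra; apply exp_pos.
      * apply Rmult_le_compat_l; [unfold B; lra|exact E1].
Qed.

(** This is x^a exp (- p x) in the variable t = ln x: the power gives the rate a at minus infinity,
    and the exponential more than that at plus infinity. *)
Lemma exp_ldecay a p : 0 < a -> 0 < p ->
  exists M, 0 < M /\ forall t, exp (a * t - p * exp t) <= M * exp (- (a * Rabs t)).
Proof.
  intros Ha Hp. destruct (exp_le_exp_exp (2 * a) p ltac:(lra) Hp) as [M [HM H]].
  exists (M + 1). split; [lra|]. intros t. pose proof (exp_pos t) as Et.
  pose proof (exp_pos (- (a * Rabs t))).
  destruct (Rle_dec 0 t) as [Ht|Ht].
  - rewrite Rabs_pos_eq in * by exact Ht.
    apply Rle_trans with (M * exp (- (a * t))); [|lra].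
    replace (a * t - p * exp t) with (2 * a * t + (- (p * exp t) + - (a * t))) by ring.
    rewrite !exp_plus. rewrite <- Rmult_assoc. apply Rmult_le_compat_r; [left; apply exp_pos|].
    rewrite exp_Ropp. apply Rmult_le_reg_r with (exp (p * exp t)); [apply exp_pos|].
    rewrite Rmult_assoc, Rinv_l by apply Rgt_not_eq, exp_pos. rewrite Rmult_1_r. apply H.
  - rewrite Rabs_left in * by lra.
    apply Rle_trans with (1 * exp (- (a * - t))).
    + rewrite Rmult_1_l. apply exp_mono. assert (0 < p * exp t) by (apply Rmult_lt_0_compat; assumption). lra.
    + apply Rmult_le_compat_r; lra.
Qed.

Lemma hol_f_polar f w : analytic_right_half_plane f -> Rabs (Im w) < PI / 2 ->
  hol (fun w => f (polar w)) w.
Proof.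
  intros [Hf _] Hw.
  assert (E : forall v, Rabs (Im v) < PI / 2 -> polar v = Cexp v).
  { intros v Hv. destruct (Rabs_def2 _ _ Hv). unfold polar. rewrite clamp_id by lra. f_equal.
    destruct v as [x y]. unfold Cplus, Cmult, RtoC, Ci, Re, Im; simpl. f_equal; ring. }
  apply hol_ext_loc with (fun w => f (Cexp w)).
  - exists (PI / 2 - Rabs (Im w)). split; [lra|]. intros v Hv. rewrite E; [reflexivity|].
    pose proof (im_le_Cmod (v - w)) as T. change (Im (v - w)) with (Im v - Im w) in T.
    pose proof (Rabs_triang (Im v - Im w) (Im w)) as T2.
    replace (Im v - Im w + Im w) with (Im v) in T2 by ring. lra.
  - apply (hol_comp f Cexp); [|apply hol_Cexp].
    apply analytic_hol, Hf. destruct (Rabs_def2 _ _ Hw).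
    unfold Cexp. rewrite Re_mult, Re_RtoC, Im_RtoC. unfold Re at 2; simpl.
    assert (0 < cos (Im w)) by (apply cos_gt_0; lra).
    pose proof (exp_pos (Re w)). nra.
Qed.

(** * Rotation of an Abel integral through a quarter turn *)

Definition is_unit_sign (eta : R) : Prop := eta = 1 \/ eta = -1.

Lemma Re_ray (eta t th : R) : Re (t + (0, eta) * th)%C = t.
Proof. unfold Re, Cplus, Cmult, RtoC; simpl; ring. Qed.

Lemma Im_ray (eta t th : R) : Im (t + (0, eta) * th)%C = eta * th.
Proof. unfold Im, Cplus, Cmult, RtoC; simpl; ring. Qed.

Lemma Re_Cexp (w : C) : Re (Cexp w) = exp (Re w) * cos (Im w).
Proof. unfold Cexp. rewrite Re_mult, Re_RtoC, Im_RtoC. unfold Re at 2; simpl. ring. Qed.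

Lemma Im_Cexp (w : C) : Im (Cexp w) = exp (Re w) * sin (Im w).
Proof. unfold Cexp. rewrite Im_mult, Re_RtoC, Im_RtoC. unfold Im at 1; simpl. ring. Qed.

Lemma cos_sign eta x : is_unit_sign eta -> cos (eta * x) = cos x.
Proof.
  intros [->| ->]; [f_equal; ring|]. replace (-1 * x) with (- x) by ring. apply cos_neg.
Qed.

Lemma sin_sign eta x : is_unit_sign eta -> sin (eta * x) = eta * sin x.
Proof.
  intros [->| ->]; [replace (1 * x) with x by ring; ring|].
  replace (-1 * x) with (- x) by ring. rewrite sin_neg. ring.
Qed.

Lemma sign_sqr eta : is_unit_sign eta -> eta * eta = 1.
Proof. intros [->| ->]; ring. Qed.

Lemma Re_Cexp_ray (eta t th : R) : is_unit_sign eta -> Re (Cexp (t + (0, eta) * th)) = exp t * cos th.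
Proof. intros H. rewrite Re_Cexp, Re_ray, Im_ray, cos_sign by exact H. reflexivity. Qed.

Lemma Re_rot_Cexp_ray (eta t th : R) : is_unit_sign eta ->
  Re (- (0, eta) * Cexp (t + (0, eta) * th))%C = exp t * sin th.
Proof.
  intros H. rewrite Re_mult, Im_Cexp, Re_ray, Im_ray, sin_sign by exact H.
  change (Re (- (0, eta))%C) with (- 0). change (Im (- (0, eta))%C) with (- eta).
  transitivity (eta * eta * (exp t * sin th)); [ring|].
  rewrite (sign_sqr eta H). ring.
Qed.

Lemma Cexp_quarter eta : is_unit_sign eta -> Cexp ((0, eta) * (PI / 2)%R) = (0, eta).
Proof.
  intros H. unfold Cexp.
  replace (Im ((0, eta) * (PI / 2)%R)%C) with (eta * (PI / 2)) by (unfold Im, Cmult, RtoC; simpl; ring).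
  replace (Re ((0, eta) * (PI / 2)%R)%C) with 0 by (unfold Re, Cmult, RtoC; simpl; ring).
  rewrite cos_sign, sin_sign, cos_PI2, sin_PI2, exp_0 by exact H.
  unfold Cmult, RtoC; simpl. f_equal; ring.
Qed.

Lemma is_abel_int_of_ldecay (g : R -> C) (F : R -> R -> C) (l : C) A s0 :
  0 < s0 -> (forall s, 0 < s -> exists M d, ldecay (F s) M d) ->
  (forall s t, 0 < s -> F s t = (g (exp t) * exp (- (s * exp t)) * exp t)%C) ->
  (forall s, 0 < s < s0 -> Cmod (LInt (F s) - l) <= A * s) ->
  is_abel_int g l.
Proof.
  intros Hs0 HF E HL. exists (fun s => LInt (F s)). split.
  - intros s Hs. destruct (HF s Hs) as [M [d HM]].
    apply (is_RInt_gen_exp_subst (F s) _ M d HM). intros t. apply (E s t Hs).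
  - apply (filterlim_C_iff (at_right 0) (within_filter _ _ _ _)). intros eps He.
    pose proof (Rabs_pos A) as HA.
    assert (Hp : 0 < Rmin s0 (eps / (Rabs A + 1))).
    { apply Rmin_pos; [exact Hs0|]. apply Rdiv_lt_0_compat; lra. }
    exists (mkposreal _ Hp). intros s Hs Hs1.
    change (Rabs (s - 0) < Rmin s0 (eps / (Rabs A + 1))) in Hs.
    pose proof (Rmin_l s0 (eps / (Rabs A + 1))). pose proof (Rmin_r s0 (eps / (Rabs A + 1))).
    destruct (Rabs_def2 _ _ Hs).
    eapply Rle_lt_trans; [apply HL; lra|].
    apply Rle_lt_trans with ((Rabs A + 1) * s).
    + apply Rmult_le_compat_r; [lra|]. pose proof (Rle_abs A); lra.
    + apply Rlt_le_trans with ((Rabs A + 1) * (eps / (Rabs A + 1))).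
      * apply Rmult_lt_compat_l; lra.
      * right. field. lra.
Qed.

(* A rotation through a quarter turn in two steps: the kernel k1 is controlled on the
   first half of the quadrant, where exp (- s z) decays, and k2 decays on the second half. *)
Lemma abel_rotation (f : C -> C) (eta kappa p : R) (mu : C) (k1 k2 : C -> C) (M2 : R) :
  is_unit_sign eta -> analytic_right_half_plane f ->
  (forall eps, 0 < eps -> exists B, 0 < B /\ forall w, Cmod (f (polar w)) <= B * exp (eps * exp (Re w))) ->
  (forall z, 0 < Re z -> hol k1 z) ->
  (forall z, 0 < Re (- (0, eta) * z)%C -> hol k2 z) ->
  (forall t : R, k1 (Cexp (t + (0, eta) * (PI / 4)%R)) = k2 (Cexp (t + (0, eta) * (PI / 4)%R))) ->
  (forall eps, 0 < eps -> exists B, 0 < B /\ forall t th : R, 0 <= th <= PI / 4 ->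
     Cmod (k1 (Cexp (t + (0, eta) * th))) <= B * exp (- (kappa * t) + eps * exp t)) ->
  0 < p ->
  (forall t th : R, PI / 4 <= th <= PI / 2 ->
     Cmod (k2 (Cexp (t + (0, eta) * th))) <= M2 * exp (- (kappa * t) - p * exp t)) ->
  kappa < Re mu + 1 ->
  exists I : C,
    is_abel_int (fun x => f x * cpow x mu * k1 x)%C (Cexp ((mu + 1) * ((0, eta) * (PI / 2)%R)) * I)%C /\
    is_abel_int (fun x => f ((0, eta) * x) * cpow x mu * k2 ((0, eta) * x))%C I.
Proof.
  intros Heta Hf Hsub Hk1 Hk2 Hk12 Hb1 Hp Hb2 Hkap.
  set (j := (0, eta) : C) in *.
  pose proof PI_RGT_0 as HPI. pose proof PI_4 as HPI4.
  assert (Hne : eta <> 0) by (destruct Heta as [->| ->]; lra).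
  assert (Hj1 : Cmod j = 1).
  { unfold Cmod, j; simpl. replace (0 * (0 * 1) + eta * (eta * 1)) with (eta * eta) by ring.
    rewrite (sign_sqr _ Heta). apply sqrt_1. }
  (* The exponent left at the origin: z^mu and the Jacobian against the singularity |z|^(-kappa) of
     the kernel. *)
  set (a := Re mu + 1 - kappa). assert (Ha : 0 < a) by (unfold a; lra).
  (* The integrand in the logarithmic variable w; the exponent mu + 1 includes the Jacobian of z =
     exp w. The Abel parameter [sg] is allowed to be complex, because on the rotated ray the factor
     exp (- s z) becomes oscillating. *)
  set (G := fun (k : C -> C) (sg : C) (w : C) =>
    (f (polar w) * Cexp ((mu + 1) * w) * k (Cexp w) * Cexp (- (sg * Cexp w)))%C).
  assert (HGc : forall k sg w, hol k (Cexp w) -> ccont (G k sg) w).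
  { intros k sg w Hk. unfold G. apply ccont_mult; [apply ccont_mult; [apply ccont_mult|]|].
    - apply (ccont_f_polar f w Hf).
    - apply ccont_Cexp, ccont_mult; [apply ccont_const|apply ccont_id].
    - apply (ccont_comp (U := C_UniformSpace) (V := C_UniformSpace) Cexp k).
      + apply (ccont_Cexp (U := C_UniformSpace) (fun w => w)), ccont_id.
      + apply hol_ccont, Hk.
    - apply ccont_Cexp, ccont_opp, ccont_mult; [apply ccont_const|].
      apply (ccont_Cexp (U := C_UniformSpace) (fun w => w)), ccont_id. }
  assert (HGh : forall k sg w, hol k (Cexp w) -> Rabs (Im w) < PI / 2 -> hol (G k sg) w).
  { intros k sg w Hk Hw. unfold G.
    apply hol_mult; [apply hol_mult; [apply hol_mult|]|].
    - apply hol_f_polar; assumption.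
    - hh.
    - apply (hol_comp k Cexp); [exact Hk|apply hol_Cexp].
    - apply (hol_comp Cexp); [apply hol_Cexp|]. apply hol_opp, hol_mult; [apply hol_const|apply hol_Cexp]. }
  set (Emu := exp (Rabs (Im mu) * 2)).
  assert (Hmu : forall t th : R, 0 <= th <= PI / 2 ->
    Cmod (Cexp ((mu + 1) * (t + j * th))) <= Emu * exp ((Re mu + 1) * t)).
  { intros t th Hth. rewrite Cmod_Cexp. unfold Emu. rewrite <- exp_plus. apply exp_mono.
    rewrite Re_mult. unfold j. rewrite Re_ray, Im_ray. rewrite Re_plus, Im_plus, Re_RtoC, Im_RtoC.
    assert (T : - ((Im mu + 0) * (eta * th)) <= Rabs (Im mu) * 2).
    { rewrite Rplus_0_r. eapply Rle_trans; [apply Rle_abs|].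
      rewrite Rabs_Ropp, Rabs_mult. apply Rmult_le_compat_l; [apply Rabs_pos|].
      destruct Heta as [->| ->]; apply Rabs_le; lra. }
    lra. }
  (* The growth rates of f, of the kernel and of the Abel factor, in units of |z| = exp t, simply
     add up. *)
  assert (HGM : forall k sg (t th : R) B1 B2 e1 e2 e3, 0 <= th <= PI / 2 ->
    Cmod (f (polar (t + j * th))) <= B1 * exp (e1 * exp t) ->
    Cmod (k (Cexp (t + j * th))) <= B2 * exp (- (kappa * t) + e2 * exp t) ->
    - Re (sg * Cexp (t + j * th))%C <= e3 * exp t ->
    Cmod (G k sg (t + j * th)%C) <= B1 * Emu * B2 * exp (a * t + (e1 + e2 + e3) * exp t)).
  { intros k sg t th B1 B2 e1 e2 e3 Hth H1 H2 H3. unfold G. rewrite !Cmod_mult.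
    apply Rle_trans with (B1 * exp (e1 * exp t) * (Emu * exp ((Re mu + 1) * t)) *
      (B2 * exp (- (kappa * t) + e2 * exp t)) * exp (e3 * exp t)).
    - apply Rmult_le_compat; [| apply Cmod_ge_0 | | rewrite Cmod_Cexp; apply exp_mono, H3].
      + repeat apply Rmult_le_pos; apply Cmod_ge_0.
      + apply Rmult_le_compat; [| apply Cmod_ge_0 | | exact H2].
        * apply Rmult_le_pos; apply Cmod_ge_0.
        * apply Rmult_le_compat; try apply Cmod_ge_0; [exact H1|apply Hmu, Hth].
    - right. unfold a.
      replace ((Re mu + 1 - kappa) * t + (e1 + e2 + e3) * exp t) with
        (e1 * exp t + ((Re mu + 1) * t + ((- (kappa * t) + e2 * exp t) + e3 * exp t))) by ring.
      rewrite !(exp_plus (e1 * exp t)), (exp_plus ((Re mu + 1) * t)), (exp_plus (- (kappa * t) + e2 * exp t)).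
      ring. }
  assert (Hreg1 : forall t th : R, 0 <= th <= PI / 4 -> hol k1 (Cexp (t + j * th))).
  { intros t th Hth. apply Hk1. unfold j. rewrite Re_Cexp_ray by exact Heta.
    apply Rmult_lt_0_compat; [apply exp_pos|]. apply cos_gt_0; lra. }
  assert (Hreg2 : forall t th : R, PI / 4 <= th <= PI / 2 -> hol k2 (Cexp (t + j * th))).
  { intros t th Hth. apply Hk2. unfold j. rewrite Re_rot_Cexp_ray by exact Heta.
    apply Rmult_lt_0_compat; [apply exp_pos|]. apply sin_gt_0; lra. }
  assert (Himr : forall t th : R, 0 < th < PI / 2 -> Rabs (Im (t + j * th)%C) < PI / 2).
  { intros t th Hth. unfold j. rewrite Im_ray.
    destruct Heta as [->| ->]; apply Rabs_def1; lra. }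
  (* Here cos th >= 1/2, so the Abel factor has rate - s / 2; f and [k1] are allowed s / 8 each,
     which leaves - s / 4. *)
  assert (St1 : forall s, 0 < s -> exists M d, 0 < d /\ forall t th : R, 0 <= th <= PI / 4 ->
     Cmod (G k1 s (t + j * th)%C) <= M * exp (- (d * Rabs t))).
  { intros s Hs. destruct (Hsub (s / 8) ltac:(lra)) as [B1 [HB1 F1]].
    destruct (Hb1 (s / 8) ltac:(lra)) as [B2 [HB2 F2]].
    destruct (exp_ldecay a (s / 4) Ha ltac:(lra)) as [M [HM HMt]].
    exists (B1 * Emu * B2 * M), a. split; [exact Ha|]. intros t th Hth.
    eapply Rle_trans.
    - apply (HGM k1 s t th B1 B2 (s / 8) (s / 8) (- (s / 2))); [lra| |apply F2, Hth|].
      + specialize (F1 (t + j * th)%C). unfold j in F1 at 2. rewrite Re_ray in F1. exact F1.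
      + rewrite Re_mult, Re_RtoC, Im_RtoC. unfold j. rewrite Re_Cexp_ray by exact Heta.
        assert (C2 : 1 / 2 <= cos th).
        { rewrite <- cos_PI3. apply cos_decr_1; lra. }
        pose proof (exp_pos t). assert (0 <= s * exp t) by (apply Rmult_le_pos; lra). nra.
    - rewrite !Rmult_assoc. repeat apply Rmult_le_compat_l; try lra; [left; apply exp_pos|].
      replace (a * t + (s / 8 + (s / 8 + - (s / 2))) * exp t) with (a * t - s / 4 * exp t) by field.
      replace (a * t + (s / 8 + s / 8 + - (s / 2)) * exp t) with (a * t - s / 4 * exp t) by field.
      apply HMt. }
  assert (HM2 : 0 <= M2).
  { specialize (Hb2 0 (PI / 4) ltac:(lra)). pose proof (Cmod_ge_0 (k2 (Cexp (0 + j * (PI / 4)%R)))).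
    apply Rmult_le_reg_r with (exp (- (kappa * 0) - p * exp 0)); [apply exp_pos|]. lra. }
  destruct (Hsub (p / 4) ltac:(lra)) as [B1 [HB1 F1]].
  assert (F1' : forall t th : R, Cmod (f (polar (t + j * th))) <= B1 * exp (p / 4 * exp t)).
  { intros t th. specialize (F1 (t + j * th)%C). unfold j in F1 at 2. rewrite Re_ray in F1. exact F1. }
  destruct (exp_ldecay a (p / 4) Ha ltac:(lra)) as [M3 [HM3 HMt3]].
  (* The kernel has rate - p; f and the Abel factor may each grow at rate p / 4. The resulting bound
     does not depend on [sg]. *)
  assert (St2 : forall (sg : C) (t th : R), PI / 4 <= th <= PI / 2 ->
     - Re (sg * Cexp (t + j * th))%C <= p / 4 * exp t ->
     Cmod (G k2 sg (t + j * th)%C) <= (B1 * Emu * M2 * M3) * exp (- (a * Rabs t))).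
  { intros sg t th Hth Hsg.
    eapply Rle_trans.
    - apply (HGM k2 sg t th B1 M2 (p / 4) (- p) (p / 4)); [lra|apply F1'| |exact Hsg].
      replace (- (kappa * t) + - p * exp t) with (- (kappa * t) - p * exp t) by ring. apply Hb2, Hth.
    - rewrite !Rmult_assoc. repeat apply Rmult_le_compat_l; try lra; [left; apply exp_pos|].
      eapply Rle_trans; [|apply HMt3]. apply exp_mono. pose proof (exp_pos t). nra. }
  assert (Hrot : forall s, 0 < s ->
    LInt (fun t : R => G k1 s (t + j * 0%R)%C) = LInt (fun t : R => G k2 s (t + j * (PI / 2)%R)%C)).
  { intros s Hs. destruct (St1 s Hs) as [M [d [Hd HM]]].
    transitivity (LInt (fun t : R => G k1 s (t + j * (PI / 4)%R)%C)).
    - apply (rotation eta 0 (PI / 4) (G k1 s) M d); try assumption; try lra.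
      + intros t th Hth. apply HGh; [apply Hreg1; lra|apply Himr; lra].
      + intros t th Hth. apply HGc, Hreg1, Hth.
    - transitivity (LInt (fun t : R => G k2 s (t + j * (PI / 4)%R)%C)).
      + unfold LInt. apply HInt_eq.
        * intros t. unfold G. rewrite !Hk12. reflexivity.
        * do 2 eexists. apply ldecay_sum with (F := fun t : R => G k1 s (t + j * (PI / 4)%R)%C).
          split; [exact Hd|]. split; [|intros t; apply HM; lra].
          intros t. apply (ccont_path (G k1 s) (fun t : R => (t + j * (PI / 4)%R)%C)); [cc|].
          apply HGc, Hreg1. lra.
      + apply (rotation eta (PI / 4) (PI / 2) (G k2 s) (B1 * Emu * M2 * M3) a); try assumption; try lra.
        * intros t th Hth. apply HGh; [apply Hreg2; lra|apply Himr; lra].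
        * intros t th Hth. apply HGc, Hreg2, Hth.
        * intros t th Hth. apply St2; [exact Hth|].
          rewrite Re_mult, Re_RtoC, Im_RtoC. unfold j. rewrite Re_Cexp_ray by exact Heta.
          assert (0 <= cos th) by (apply cos_ge_0; lra).
          pose proof (exp_pos t).
          assert (0 <= s * (exp t * cos th)) by (repeat apply Rmult_le_pos; lra).
          assert (0 <= p / 4 * exp t) by (apply Rmult_le_pos; lra). lra. }
  set (c := Cexp ((mu + 1) * (j * (PI / 2)%R))).
  assert (Ej : forall t : R, Cexp (t + j * (PI / 2)%R) = (j * exp t)%C).
  { intros t. rewrite Cexp_plus, Cexp_RtoC. unfold j. rewrite Cexp_quarter by exact Heta. ring. }
  (* Dividing by [j] turns the Abel factor on the rotated ray z = j x into exp (- sg x). The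
     integral on the real axis produces sg = s j, the one on the imaginary axis sg = s; both
     converge to the value at 0. *)
  set (W := fun (sg : C) (t : R) => (/ c * G k2 (sg * / j) (t + j * (PI / 2)%R))%C).
  assert (Hj0 : j <> 0) by (intros E; rewrite E, Cmod_0 in Hj1; lra).
  assert (Hc0 : c <> 0) by apply Cexp_neq_0.
  assert (Esg : forall (sg : C) (t : R), (sg * / j * Cexp (t + j * (PI / 2)%R))%C = (sg * exp t)%C).
  { intros sg t. rewrite Ej. field. exact Hj0. }
  assert (HWE : forall sg t, W sg t =
    (f (j * exp t) * cpow (exp t) mu * k2 (j * exp t) * Cexp (- (sg * exp t)) * exp t)%C).
  { intros sg t. unfold W, G. rewrite Esg.
    unfold j at 1. rewrite (polar_eq eta t (PI / 2) Heta) by lra. fold j. rewrite !Ej.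
    replace ((mu + 1) * (t + j * (PI / 2)%R))%C with ((mu * ln (exp t) + t) + (mu + 1) * (j * (PI / 2)%R))%C
      by (rewrite ln_exp; ring).
    rewrite !Cexp_plus, Cexp_RtoC. fold c. unfold cpow. field. exact Hc0. }
  assert (HWc : forall sg t, ccont (W sg) t).
  { intros sg t. unfold W. apply ccont_mult; [apply ccont_const|].
    apply (ccont_path (G k2 (sg * / j)%C) (fun t : R => (t + j * (PI / 2)%R)%C)); [cc|].
    apply HGc, Hreg2. lra. }
  assert (HWd : forall sg, - (p / 4) <= Re sg -> ldecay (W sg) (Cmod (/ c) * (B1 * Emu * M2 * M3)) a).
  { intros sg Hsg. split; [exact Ha|]. split; [apply HWc|].
    intros t. unfold W. rewrite Cmod_mult, Rmult_assoc. apply Rmult_le_compat_l; [apply Cmod_ge_0|].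
    apply St2; [lra|]. rewrite Esg, Re_mult, Re_RtoC, Im_RtoC. pose proof (exp_pos t). nra. }
  set (I := LInt (W 0)). exists I.
  (* The exponent rises by 1 because |exp (- sg x) - 1| <= |sg| x exp (|sg| x) contributes a factor
     x = exp t. *)
  destruct (exp_ldecay (a + 1) (p / 4) ltac:(lra) ltac:(lra)) as [M4 [HM4 HMt4]].
  assert (HW0 : forall t, Cmod (W 0 t) <= Cmod (/ c) * (B1 * Emu * M2) * exp (a * t - 3 * p / 4 * exp t)).
  { intros t. unfold W. rewrite Cmod_mult, (Rmult_assoc (Cmod (/ c))). apply Rmult_le_compat_l; [apply Cmod_ge_0|].
    replace (a * t - 3 * p / 4 * exp t) with (a * t + (p / 4 + - p + 0) * exp t) by field.
    apply HGM; [lra|apply F1'| |].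
    - replace (- (kappa * t) + - p * exp t) with (- (kappa * t) - p * exp t) by ring. apply Hb2; lra.
    - rewrite Esg, Re_mult, Re_RtoC, Im_RtoC. lra. }
  set (A := Cmod (/ c) * (B1 * Emu * M2) * M4).
  (* The passage to the limit under the integral sign, in quantitative form and for complex [sg]. *)
  assert (HWlim : forall sg, Cmod sg < p / 4 -> Cmod (LInt (W sg) - I) <= (A + A) / (a + 1) * Cmod sg).
  { intros sg Hsg.
    assert (Hre : - (p / 4) <= Re sg).
    { pose proof (re_le_Cmod sg). pose proof (Rabs_maj2 (Re sg)). lra. }
    pose proof (HWd sg Hre) as D1.
    assert (D0 : ldecay (W 0) (Cmod (/ c) * (B1 * Emu * M2 * M3)) a) by (apply HWd; simpl; lra).
    replace (LInt (W sg) - I)%C with (LInt (fun t => W sg t + (- RtoC 1) * W 0 t)%C).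
    2:{ unfold I, LInt.
        transitivity (HInt (fun t => (W sg t + W sg (- t)%R) + (- RtoC 1) * (W 0 t + W 0 (- t)%R))%C).
        - symmetry. apply HInt_eq; [intros t; ring|].
          apply hdecay_plus; [|apply hdecay_scal]; do 2 eexists; eapply ldecay_sum; eassumption.
        - rewrite HInt_plus, HInt_scal; [ring| | |apply hdecay_scal]; do 2 eexists; eapply ldecay_sum; eassumption. }
    eapply Rle_trans; [apply (LInt_bound _ (A * Cmod sg) (a + 1))|right; field; lra].
    split; [lra|]. split; [intros t; apply ccont_plus; [apply HWc|apply ccont_mult; [apply ccont_const|apply HWc]]|].
    intros t.
    replace (W sg t + - RtoC 1 * W 0 t)%C with (W 0 t * (Cexp (- (sg * exp t)) - 1))%C.
    2:{ rewrite !HWE. replace (- (0 * exp t))%C with (RtoC 0) by ring. rewrite Cexp_0. ring. }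
    rewrite Cmod_mult.
    assert (Es : Cmod (- (sg * exp t)) = Cmod sg * exp t).
    { rewrite Cmod_opp, Cmod_mult, Cmod_R, Rabs_pos_eq; [reflexivity|left; apply exp_pos]. }
    pose proof (Cexp_minus_1_bound (- (sg * exp t))) as Bd. rewrite Es in Bd.
    pose proof (Cmod_ge_0 sg) as Hsg0. pose proof (exp_pos t) as Het.
    apply Rle_trans with (Cmod (/ c) * (B1 * Emu * M2) * exp (a * t - 3 * p / 4 * exp t) *
      (Cmod sg * exp t * exp (p / 4 * exp t))).
    - apply Rmult_le_compat; try apply Cmod_ge_0; [apply HW0|].
      eapply Rle_trans; [exact Bd|]. apply Rmult_le_compat_l; [apply Rmult_le_pos; lra|].
      apply exp_mono. apply Rmult_le_compat_r; lra.
    - replace (Cmod (/ c) * (B1 * Emu * M2) * exp (a * t - 3 * p / 4 * exp t) * (Cmod sg * exp t * exp (p / 4 * exp t)))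
        with (Cmod (/ c) * (B1 * Emu * M2) * Cmod sg * (exp (a * t - 3 * p / 4 * exp t) * (exp t * exp (p / 4 * exp t)))) by ring.
      rewrite <- !exp_plus.
      replace (A * Cmod sg * exp (- ((a + 1) * Rabs t))) with
        (Cmod (/ c) * (B1 * Emu * M2) * Cmod sg * (M4 * exp (- ((a + 1) * Rabs t)))) by (unfold A; ring).
      apply Rmult_le_compat_l.
      + repeat apply Rmult_le_pos; try apply Cmod_ge_0; try lra. left; apply exp_pos.
      + eapply Rle_trans; [|apply HMt4]. apply exp_mono. nra. }
  assert (HGs : forall s, 0 < s -> LInt (fun t : R => G k1 s (t + j * 0%R)%C) = (c * LInt (W (s * j)))%C).
  { intros s Hs. rewrite (Hrot s Hs).
    assert (Hre : - (p / 4) <= Re (s * j)%C).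
    { rewrite Re_mult. unfold j, Re, Im, RtoC; simpl. lra. }
    unfold LInt. rewrite <- HInt_scal by (do 2 eexists; apply ldecay_sum, HWd, Hre).
    symmetry. apply HInt_eq.
    - intros t. unfold W. replace (s * j * / j)%C with (RtoC s) by (field; exact Hj0). field. exact Hc0.
    - apply hdecay_scal. do 2 eexists. apply ldecay_sum, HWd, Hre. }
  split.
  - apply is_abel_int_of_ldecay with (F := fun s (t : R) => G k1 s (t + j * 0%R)%C)
      (A := Cmod c * ((A + A) / (a + 1))) (s0 := p / 4); [lra| | |].
    + intros s Hs. destruct (St1 s Hs) as [M [d [Hd HM]]]. exists M, d.
      split; [exact Hd|]. split; [|intros t; apply HM; lra].
      intros t. apply (ccont_path (G k1 s) (fun t : R => (t + j * 0%R)%C)); [cc|].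
      apply HGc, Hreg1. lra.
    + intros s t Hs. unfold G. unfold j at 1. rewrite (polar_eq eta t 0 Heta) by lra. fold j.
      replace (t + j * 0%R)%C with (RtoC t) by ring. rewrite !Cexp_RtoC.
      replace ((mu + 1) * t)%C with (mu * ln (exp t) + t)%C by (rewrite ln_exp; ring).
      rewrite Cexp_plus, Cexp_RtoC.
      replace (Cexp (- (s * exp t))) with (RtoC (exp (- (s * exp t)))).
      2:{ rewrite <- RtoC_mult, <- RtoC_opp, Cexp_RtoC. reflexivity. }
      unfold cpow. ring.
    + intros s Hs. rewrite (HGs s) by lra.
      replace (c * LInt (W (s * j)) - c * I)%C with (c * (LInt (W (s * j)) - I))%C by ring.
      assert (Es : Cmod (s * j) = s) by (rewrite Cmod_mult, Hj1, Cmod_R, Rabs_pos_eq; lra).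
      rewrite Cmod_mult, Rmult_assoc. apply Rmult_le_compat_l; [apply Cmod_ge_0|].
      pose proof (HWlim (s * j)%C) as K. rewrite Es in K. apply K. lra.
  - apply is_abel_int_of_ldecay with (F := fun s t => W s t) (A := (A + A) / (a + 1)) (s0 := p / 4); [lra| | |].
    + intros s Hs. do 2 eexists. apply HWd. rewrite Re_RtoC. lra.
    + intros s t Hs. rewrite HWE.
      rewrite <- RtoC_mult, <- RtoC_opp, Cexp_RtoC. reflexivity.
    + intros s Hs. pose proof (HWlim (RtoC s)) as K. rewrite Cmod_R, Rabs_pos_eq in K by lra. apply K. lra.
Qed.

(** * Hankel's integral for the reciprocal Gamma function *)

Lemma exp_edecay b p : 0 < p -> exists M, 0 < M /\ forall t, 0 <= t -> exp (b * t - p * exp t) <= M * exp (- (1 * t)).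
Proof.
  intros Hp. destruct (exp_le_exp_exp (Rabs b + 1) p ltac:(pose proof (Rabs_pos b); lra) Hp) as [M [HM H]].
  exists M. split; [exact HM|]. intros t Ht.
  replace (b * t - p * exp t) with ((b + 1) * t + (- (p * exp t) + - (1 * t))) by ring.
  rewrite !exp_plus. rewrite <- Rmult_assoc. apply Rmult_le_compat_r; [left; apply exp_pos|].
  rewrite exp_Ropp. apply Rmult_le_reg_r with (exp (p * exp t)); [apply exp_pos|].
  rewrite Rmult_assoc, Rinv_l by apply Rgt_not_eq, exp_pos. rewrite Rmult_1_r.
  eapply Rle_trans; [|apply H]. apply exp_mono. apply Rmult_le_compat_r; [exact Ht|].
  pose proof (Rle_abs b). lra.
Qed.

Lemma Cexp_Ci_PI : Cexp (Ci * PI) = (- RtoC 1)%C.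
Proof.
  unfold Cexp.
  replace (Im (Ci * PI)%C) with PI by (unfold Im, Ci, Cmult, RtoC; simpl; ring).
  replace (Re (Ci * PI)%C) with 0 by (unfold Re, Ci, Cmult, RtoC; simpl; ring).
  rewrite cos_PI, sin_PI, exp_0. unfold Cmult, Copp, RtoC; simpl. f_equal; ring.
Qed.

Lemma Cexp_m_Ci_PI : Cexp (- (Ci * PI)) = (- RtoC 1)%C.
Proof. rewrite Cexp_opp, Cexp_Ci_PI. field. Qed.

Lemma Ci_neq_0 : Ci <> 0.
Proof. intros E. apply (f_equal Im) in E. unfold Im, Ci, RtoC in E; simpl in E. lra. Qed.

Lemma Ci_sqr : (Ci * Ci)%C = (- RtoC 1)%C.
Proof. unfold Ci, Cmult, Copp, RtoC; simpl. f_equal; ring. Qed.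

Lemma RtoC_PI_neq_0 : RtoC PI <> 0.
Proof. apply RtoC_neq_0, Rgt_not_eq, PI_RGT_0. Qed.

Definition sinpi (a : C) : C := Csin (a * PI).

Lemma sinpi_eq a : (2 * Ci * sinpi a)%C = (Cexp (Ci * PI * a) - Cexp (- (Ci * PI * a)))%C.
Proof.
  unfold sinpi, Csin. replace (Ci * (a * PI))%C with (Ci * PI * a)%C by ring.
  field. apply Ci_neq_0.
Qed.

Lemma sinpi_S a : sinpi (a + 1) = (- sinpi a)%C.
Proof.
  unfold sinpi, Csin.
  replace (Ci * ((a + 1) * PI))%C with (Ci * (a * PI) + Ci * PI)%C by ring.
  replace (- (Ci * (a * PI) + Ci * PI))%C with (- (Ci * (a * PI)) + - (Ci * PI))%C by ring.
  rewrite !Cexp_plus, Cexp_Ci_PI, Cexp_m_Ci_PI.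
  field. apply Ci_neq_0.
Qed.

Lemma sinpi_0 : sinpi 0 = 0.
Proof.
  unfold sinpi, Csin. replace (Ci * (0 * PI))%C with (RtoC 0) by ring.
  replace (- RtoC 0)%C with (RtoC 0) by ring. rewrite Cexp_0.
  field. apply Ci_neq_0.
Qed.

Lemma RtoC_S n : RtoC (INR (S n)) = (RtoC (INR n) + 1)%C.
Proof. rewrite S_INR, RtoC_plus. reflexivity. Qed.

Lemma sinpi_plus_nat a n : sinpi (a + INR n) = ((-1) ^ n * sinpi a)%C.
Proof.
  induction n as [|n IH].
  - simpl. replace (a + 0)%C with a by ring. ring.
  - rewrite RtoC_S. replace (a + (INR n + 1))%C with (a + INR n + 1)%C by ring.
    rewrite sinpi_S, IH. rewrite Cpow_S. ring.
Qed.

Lemma sinpi_nat n : sinpi (INR n) = 0.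
Proof.
  replace (RtoC (INR n)) with (0 + INR n)%C by ring. rewrite sinpi_plus_nat, sinpi_0. ring.
Qed.

(* Hankel's loop in the variable log w: hk is integrated over the circle of radius exp L,
   and the integrals over the two sides of the cut combine into sin (pi a) times that of hm. *)
Definition hk (a w : C) : C := Cexp (Cexp w + (1 - a) * w).

Definition hm (a : C) (t : R) : C := Cexp (- Cexp t + (1 - a) * t).

(** The loop integral of exp (zeta) zeta^(-a) / (2 pi i), that is 1 / Gamma (a). The value is
    independent of [L], which is chosen three times below: tending to minus infinity in [hankel_1],
    ln n for the saddle point, ln y for the Bessel series. *)
Definition hankel (a : C) (L : R) : C :=
  (/ (2 * PI) * CInt (fun th : R => hk a (L + Ci * th)) (- PI) PI
   + sinpi a * / PI * HInt (fun t => hm a (L + t)%R))%C.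

Lemma ccont_hk_circle a L th : ccont (fun th : R => hk a (L + Ci * th)) th.
Proof. unfold hk. cc. Qed.

Lemma ccont_hm a t : ccont (hm a) t.
Proof. unfold hm. cc. Qed.

Lemma ccont_shift (F : R -> C) (L t : R) : (forall u, ccont F u) -> ccont (fun t : R => F (L + t)) t.
Proof.
  intros H. apply (ccont_comp (U := R_UniformSpace) (V := R_UniformSpace) (fun t => L + t) F); [|apply H].
  apply (continuous_plus (V := R_NormedModule)); [apply continuous_const|apply continuous_id].
Qed.

Lemma Re_hm_exponent (a : C) (t : R) : Re (- Cexp t + (1 - a) * t)%C = - exp t + (1 - Re a) * t.
Proof.
  rewrite Cexp_RtoC, Re_plus, Re_opp, Re_mult, !Re_RtoC, Im_RtoC. unfold Cminus. rewrite Re_plus, Re_opp, Re_RtoC. ring.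
Qed.

Lemma hdecay_hm a L : hdecay (fun t => hm a (L + t)).
Proof.
  destruct (exp_edecay (1 - Re a) (exp L) (exp_pos L)) as [M [HM H]].
  exists (exp ((1 - Re a) * L) * M), 1. split; [lra|]. split; [intros t; apply ccont_shift, ccont_hm|].
  intros t Ht. unfold hm. rewrite Cmod_Cexp, Re_hm_exponent, (exp_plus L t).
  replace (- (exp L * exp t) + (1 - Re a) * (L + t)) with ((1 - Re a) * L + ((1 - Re a) * t - exp L * exp t)) by ring.
  rewrite (exp_plus ((1 - Re a) * L)), Rmult_assoc. apply Rmult_le_compat_l; [left; apply exp_pos|apply H, Ht].
Qed.

Lemma HInt_shift (F : R -> C) (L L' : R) : (forall t, ccont F t) -> hdecay (fun t => F (L + t)) -> hdecay (fun t => F (L' + t)) ->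
  HInt (fun t => F (L + t)) = (CInt F L L' + HInt (fun t => F (L' + t)%R))%C.
Proof.
  intros Hc [M [d HF]] [M' [d' HF']].
  assert (S : forall A T, CInt (fun t => F (A + t)) 0 T = CInt F A (A + T)).
  { intros A T. pose proof (CInt_comp_lin F 1 A 0 T ltac:(apply cont_on_all, Hc)) as K.
    replace (1 * 0 + A) with A in K by ring. replace (1 * T + A) with (A + T) in K by ring.
    rewrite <- K. apply CInt_ext. intros t _. replace (1 * t + A) with (A + t) by ring. ring. }
  apply (HInt_unique _ _ _ _ HF). intros eps He.
  destruct (HInt_lim _ _ _ eps HF' He) as [T0 [_ H0]].
  exists (T0 + L' - L). intros T HT.
  specialize (H0 (T + L - L') ltac:(lra)). rewrite S in *.
  replace (L' + (T + L - L')) with (L + T) in H0 by ring.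
  rewrite <- (CInt_Chasles F L L' (L + T)) by (apply cont_on_all, Hc).
  match goal with |- Cmod ?x <= _ => match type of H0 with Cmod ?y < _ => replace x with y by ring end end. lra.
Qed.

Lemma hk_upper a (t : R) : hk a (t + Ci * PI) = (- Cexp (- (Ci * PI * a)) * hm a t)%C.
Proof.
  unfold hk, hm. rewrite (Cexp_plus t (Ci * PI)), Cexp_Ci_PI.
  replace (Cexp t * - (1) + (1 - a) * (t + Ci * PI))%C with
    ((- Cexp t + (1 - a) * t) + (Ci * PI + - (Ci * PI * a)))%C by ring.
  rewrite Cexp_plus, (Cexp_plus (Ci * PI)), Cexp_Ci_PI. ring.
Qed.

Lemma hk_lower a (t : R) : hk a (t + Ci * (- PI)%R) = (- Cexp (Ci * PI * a) * hm a t)%C.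
Proof.
  unfold hk, hm. replace (Ci * (- PI)%R)%C with (- (Ci * PI))%C by (rewrite RtoC_opp; ring).
  rewrite (Cexp_plus t (- (Ci * PI))), Cexp_m_Ci_PI.
  replace (Cexp t * - (1) + (1 - a) * (t + - (Ci * PI)))%C with
    ((- Cexp t + (1 - a) * t) + (- (Ci * PI) + (Ci * PI * a)))%C by ring.
  rewrite Cexp_plus, (Cexp_plus (- (Ci * PI))), Cexp_m_Ci_PI. ring.
Qed.

Lemma hol_hk a w : hol (hk a) w.
Proof.
  unfold hk. apply (hol_comp Cexp (fun w => Cexp w + (1 - a) * w)%C); [apply hol_Cexp|].
  apply hol_plus; [apply hol_Cexp|]. apply (hol_mult (fun _ => 1 - a)%C (fun w => w)); [apply hol_const|apply hol_id].
Qed.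

(** Cauchy's theorem on [L, L'] times [-pi, pi], whose horizontal sides are the two sides of the
    cut. Their phases exp (- i pi a) and exp (i pi a) differ by a multiple of sin (pi a), exactly
    the change in the integral along the cut. *)
Lemma hankel_indep a L L' : hankel a L = hankel a L'.
Proof.
  pose proof PI_4. pose proof PI_RGT_0.
  pose proof (cauchy_rectangle 1 (-5) 5 (hk a) L L' (- PI) PI ltac:(lra)
    ltac:(intros t th _; apply hol_hk) ltac:(lra) ltac:(lra) ltac:(lra)) as Rt.
  change ((0, 1) : C) with Ci in Rt.
  rewrite CInt_minus in Rt by (apply cont_on_all; intros; apply ccont_hk_circle).
  assert (E1 : CInt (fun t : R => hk a (t + Ci * PI)) L L' = (- Cexp (- (Ci * PI * a)) * CInt (hm a) L L')%C).
  { rewrite <- CInt_scal by (apply cont_on_all; intros; apply ccont_hm).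
    apply CInt_ext. intros t _. apply hk_upper. }
  assert (E2 : CInt (fun t : R => hk a (t + Ci * (- PI)%R)) L L' = (- Cexp (Ci * PI * a) * CInt (hm a) L L')%C).
  { rewrite <- CInt_scal by (apply cont_on_all; intros; apply ccont_hm).
    apply CInt_ext. intros t _. apply hk_lower. }
  rewrite E1, E2 in Rt.
  unfold hankel. rewrite (HInt_shift (hm a) L L') by (try apply hdecay_hm; intros; apply ccont_hm).
  set (A := CInt (fun th : R => hk a (L + Ci * th)) (- PI) PI) in *.
  set (A' := CInt (fun th : R => hk a (L' + Ci * th)) (- PI) PI) in *.
  set (B := CInt (hm a) L L') in *. set (D := HInt (fun t => hm a (L' + t))).
  pose proof (sinpi_eq a) as Sn.
  assert (E3 : (A' - A = 2 * sinpi a * B)%C).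
  { assert (X : (Ci * (A' - A) = Ci * (2 * sinpi a * B))%C).
    { rewrite <- Rt. replace (Ci * (2 * sinpi a * B))%C with (2 * Ci * sinpi a * B)%C by ring. rewrite Sn. ring. }
    replace (A' - A)%C with (/ Ci * (Ci * (A' - A)))%C by (field; apply Ci_neq_0).
    rewrite X. field. apply Ci_neq_0. }
  replace A' with (A + 2 * sinpi a * B)%C by (rewrite <- E3; ring).
  field. apply RtoC_PI_neq_0.
Qed.

(** Integration by parts: the derivative of exp (exp w - a w) is [hk a] - a [hk (a + 1)]. The
    boundary terms of the circle cancel those of the cut at t = L, since sin (pi (a + 1)) = - sin
    (pi a). *)
Lemma hankel_recurrence a L : hankel a L = (a * hankel (a + 1) L)%C.
Proof.
  set (P := fun w : C => Cexp (Cexp w - a * w)).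
  set (Pm := fun t : R => Cexp (- Cexp t - a * t)).
  assert (Hka : forall w, hk a w = (Cexp w * P w)%C).
  { intros w. unfold hk, P. rewrite <- Cexp_plus. f_equal. ring. }
  assert (Hka1 : forall w, hk (a + 1) w = P w).
  { intros w. unfold hk, P. f_equal. ring. }
  assert (Hma : forall t, hm a t = (Cexp t * Pm t)%C).
  { intros w. unfold hm, Pm. rewrite <- Cexp_plus. f_equal. ring. }
  assert (Hma1 : forall t, hm (a + 1) t = Pm t).
  { intros w. unfold hm, Pm. f_equal. ring. }
  assert (EA : (CInt (fun th : R => hk a (L + Ci * th)) (- PI) PI - a * CInt (fun th : R => hk (a + 1) (L + Ci * th)) (- PI) PI
     = / Ci * (P (L + Ci * PI) - P (L + Ci * (- PI)%R)))%C).
  { rewrite <- CInt_scal by (apply cont_on_all; intros; apply ccont_hk_circle).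
    rewrite <- CInt_minus.
    2: apply cont_on_all; intros; apply ccont_hk_circle.
    2: apply cont_on_scal, cont_on_all; intros; apply ccont_hk_circle.
    rewrite (CInt_FTC (fun th : R => / Ci * P (L + Ci * th))%C).
    - ring.
    - intros t _. eapply cderiv_eq.
      + apply cderiv_mult; [apply cderiv_const|]. unfold P. apply cderiv_Cexp.
        unfold Cminus. apply cderiv_plus; [apply cderiv_Cexp|].
        * apply cderiv_plus; [apply cderiv_const|]. apply cderiv_mult; [apply cderiv_const|].
          apply (cderiv_RtoC (fun u => u) t 1). apply (is_derive_id (K := R_AbsRing)).
        * apply cderiv_ext with (fun u : R => (- a) * (L + Ci * u))%C; [intros u; ring|].
          apply (cderiv_mult (fun _ => - a)%C); [apply cderiv_const|].
          apply cderiv_plus; [apply cderiv_const|]. apply cderiv_mult; [apply cderiv_const|].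
          apply (cderiv_RtoC (fun u => u) t 1). apply (is_derive_id (K := R_AbsRing)).
      + cbv beta. rewrite Hka, Hka1. unfold P, Cminus. field. apply Ci_neq_0.
    - apply cont_on_all. intros t. apply ccont_minus; [|apply ccont_mult; [apply ccont_const|]]; apply ccont_hk_circle. }
  assert (EB : (HInt (fun t => hm a (L + t)%R) + a * HInt (fun t => hm (a + 1) (L + t)%R) = Pm L)%C).
  { rewrite <- HInt_scal by apply hdecay_hm.
    rewrite <- HInt_plus; [|apply hdecay_hm|apply hdecay_scal, hdecay_hm].
    destruct (hdecay_plus _ _ (hdecay_hm a L) (hdecay_scal a _ (hdecay_hm (a + 1) L))) as [M [d HD]].
    apply (HInt_unique _ M d _ HD). intros eps He.
    destruct (hdecay_hm (a + 1) L) as [M' [d' [Hd' [_ Hb']]]].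
    destruct (decay_small M' d' eps Hd' He) as [T0 [HT0 HT]]. exists T0. intros T HT'.
    rewrite (CInt_FTC (fun t : R => - Pm (L + t)%R)%C).
    - rewrite Rplus_0_r.
      replace (Pm L - (- Pm (L + T)%R - - Pm L))%C with (Pm (L + T)%R) by ring.
      rewrite <- Hma1. eapply Rle_trans; [apply Hb'; lra|]. left. apply HT, HT'.
    - intros t _. apply cderiv_ext with (fun t : R => (- RtoC 1) * Cexp ((- RtoC 1) * Cexp (RtoC (L + t)) + (- a) * RtoC (L + t)))%C.
      { intros u. unfold Pm. replace (- Cexp (L + u)%R - a * (L + u)%R)%C with (- (1) * Cexp (L + u)%R + - a * (L + u)%R)%C by ring. ring. }
      assert (HL : cderiv (fun t => RtoC (L + t)) t 1).
      { apply (cderiv_RtoC (fun t => L + t) t 1). auto_derive; [exact I|ring]. }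
      eapply cderiv_eq.
      + apply cderiv_mult; [apply cderiv_const|]. apply cderiv_Cexp.
        apply cderiv_plus; (apply cderiv_mult; [apply cderiv_const|]); [apply cderiv_Cexp|]; exact HL.
      + cbv beta. rewrite Hma, Hma1. unfold Pm.
        replace (- (1) * Cexp (L + t)%R + - a * (L + t)%R)%C with (- Cexp (L + t)%R - a * (L + t)%R)%C by ring. ring.
    - apply cont_on_all, HD. }
  unfold hankel. rewrite sinpi_S.
  set (A := CInt (fun th : R => hk a (L + Ci * th)) (- PI) PI) in *.
  set (A' := CInt (fun th : R => hk (a + 1) (L + Ci * th)) (- PI) PI) in *.
  set (B := HInt (fun t => hm a (L + t))) in *. set (B' := HInt (fun t => hm (a + 1) (L + t))) in *.
  rewrite <- !Hka1, hk_upper, hk_lower, Hma1 in EA.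
  replace (- (Ci * PI * (a + 1)))%C with (- (Ci * PI * a) + - (Ci * PI))%C in EA by ring.
  replace (Ci * PI * (a + 1))%C with (Ci * PI * a + Ci * PI)%C in EA by ring.
  rewrite !Cexp_plus, Cexp_Ci_PI, Cexp_m_Ci_PI in EA.
  pose proof (sinpi_eq a) as Sn.
  assert (EA2 : (A = a * A' - 2 * sinpi a * Pm L)%C).
  { replace A with (a * A' + (A - a * A'))%C by ring. rewrite EA.
    replace (2 * sinpi a * Pm L)%C with (/ Ci * (2 * Ci * sinpi a) * Pm L)%C by (field; apply Ci_neq_0).
    rewrite Sn. ring. }
  rewrite EA2, <- EB. field. apply RtoC_PI_neq_0.
Qed.

(** The cut disappears because sin pi = 0, and on a circle of radius e the integrand exp (exp w) is
    within e exp 1 of 1; then e tends to 0. *)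
Lemma hankel_1 L : hankel 1 L = 1.
Proof.
  pose proof PI_RGT_0 as HPI.
  apply Cmod_small_eq. intros eps He.
  set (e := Rmin 1 (eps / exp 1)).
  assert (He1 : 0 < e) by (apply Rmin_pos; [lra|apply Rdiv_lt_0_compat; [lra|apply exp_pos]]).
  assert (He2 : e <= 1) by apply Rmin_l.
  assert (He3 : e * exp 1 <= eps).
  { apply Rle_trans with (eps / exp 1 * exp 1).
    - apply Rmult_le_compat_r; [left; apply exp_pos|apply Rmin_r].
    - right. field. apply Rgt_not_eq, exp_pos. }
  rewrite (hankel_indep 1 L (ln e)). unfold hankel.
  assert (Es : sinpi 1 = 0).
  { change (RtoC 1) with (RtoC (INR 1)). apply sinpi_nat. }
  rewrite Es.
  assert (Hb : Cmod (CInt (fun th : R => hk 1 (ln e + Ci * th) - 1)%C (- PI) PI) <= (PI - - PI) * (e * exp 1)).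
  { apply CInt_bound_const; [lra| |].
    - apply cont_on_all. intros t. apply ccont_minus; [apply ccont_hk_circle|apply ccont_const].
    - intros t _. unfold hk.
      replace (Cexp (ln e + Ci * t) + (1 - 1) * (ln e + Ci * t))%C with (Cexp (ln e + Ci * t)) by ring.
      assert (Em : Cmod (Cexp (ln e + Ci * t)) = e).
      { rewrite Cmod_Cexp. replace (Re (ln e + Ci * t)%C) with (ln e) by (unfold Re, Ci, Cplus, Cmult, RtoC; simpl; ring).
        apply exp_ln, He1. }
      eapply Rle_trans; [apply Cexp_minus_1_bound|]. rewrite Em.
      apply Rmult_le_compat_l; [lra|]. apply exp_mono, He2. }
  rewrite CInt_minus in Hb; [|apply cont_on_all; intros; apply ccont_hk_circle|apply cont_on_all; intros; apply ccont_const].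
  assert (Ec : CInt (fun _ => RtoC 1) (- PI) PI = RtoC (2 * PI)).
  { apply CInt_unique.
    - replace (Re (RtoC (2 * PI))) with (scal (PI - - PI) 1).
      + apply (is_RInt_const (V := R_NormedModule)).
      + unfold scal, Re, RtoC; simpl; unfold mult; simpl. ring.
    - replace (Im (RtoC (2 * PI))) with (scal (PI - - PI) 0).
      + apply (is_RInt_const (V := R_NormedModule)).
      + unfold scal, Im, RtoC; simpl; unfold mult; simpl. ring. }
  rewrite Ec in Hb.
  set (A := CInt (fun th : R => hk 1 (ln e + Ci * th)) (- PI) PI) in *.
  replace (/ (2 * PI) * A + 0 * / PI * HInt (fun t => hm 1 (ln e + t)) - 1)%C with
    (/ (2 * PI) * (A - (2 * PI)%R))%C.
  2:{ rewrite RtoC_mult. field. apply RtoC_PI_neq_0. }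
  rewrite Cmod_mult. rewrite <- RtoC_mult, <- RtoC_inv by lra. rewrite Cmod_R, Rabs_pos_eq.
  2:{ left. apply Rinv_0_lt_compat. lra. }
  apply Rle_trans with (/ (2 * PI) * ((PI - - PI) * (e * exp 1))).
  - apply Rmult_le_compat_l; [left; apply Rinv_0_lt_compat; lra|exact Hb].
  - replace (/ (2 * PI) * ((PI - - PI) * (e * exp 1))) with (e * exp 1) by (field; lra). exact He3.
Qed.

Lemma hankel_nat n L : (INR (fact n) * hankel (INR n + 1) L)%C = 1.
Proof.
  induction n as [|n IH].
  - simpl. replace (0 + 1)%C with (RtoC 1) by ring. rewrite hankel_1. ring.
  - rewrite fact_simpl, mult_INR, RtoC_mult, RtoC_S.
    rewrite (hankel_recurrence (INR n + 1)) in IH. etransitivity; [|exact IH]. ring.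
Qed.

Lemma hankel_rising z n L : hankel z L = (rising z n * hankel (z + INR n) L)%C.
Proof.
  induction n as [|n IH].
  - simpl. replace (z + 0)%C with z by ring. ring.
  - rewrite IH, (hankel_recurrence (z + INR n)). rewrite RtoC_S.
    replace (z + (INR n + 1))%C with (z + INR n + 1)%C by ring. simpl rising. ring.
Qed.

(** * Stirling's upper bound, the saddle point, and Euler's limit *)

(** The difference vanishes at 0 and has derivative x^2 / ((1 + x) (2 + x)^2). This rational bound
    is the one that gives (n + 1/2) ln (1 + 1/n) >= 1. *)
Lemma ln_1p_lower y : 0 <= y -> 2 * y / (2 + y) <= ln (1 + y).
Proof.
  intros Hy. destruct Hy as [Hy|<-].
  2:{ replace (1 + 0) with 1 by ring. rewrite ln_1. right. field. }
  set (phi := fun x => ln (1 + x) - 2 * x / (2 + x)).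
  assert (Hd : forall x, 0 <= x -> is_derive phi x (x ^ 2 / ((1 + x) * (2 + x) ^ 2))).
  { intros x Hx. unfold phi. auto_derive; [split; [lra|split; [lra|exact I]]|]. field. lra. }
  destruct (MVT_gen phi 0 y (fun x => x ^ 2 / ((1 + x) * (2 + x) ^ 2))) as [c [Hc E]].
  - intros x Hx. rewrite Rmin_left in Hx by lra. apply Hd. lra.
  - intros x Hx. rewrite Rmin_left in Hx by lra.
    apply continuity_pt_filterlim, (ex_derive_continuous (V := R_NormedModule)).
    eexists. apply Hd. lra.
  - rewrite Rmin_left in Hc by lra.
    assert (P0 : phi 0 = 0) by (unfold phi; replace (1 + 0) with 1 by ring; rewrite ln_1; field).
    assert (0 <= c ^ 2 / ((1 + c) * (2 + c) ^ 2)).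
    { apply Rdiv_le_0_compat; [apply pow2_ge_0|]. apply Rmult_lt_0_compat; [lra|apply pow_lt; lra]. }
    assert (0 <= phi y) by nra. unfold phi in *. lra.
Qed.

(** In the form n! <= e sqrt n (n / e)^n. The inductive step is (n + 1/2) ln (1 + 1/n) >= 1; the
    constant e instead of sqrt (2 pi) suffices, as only the order of magnitude is used. *)
Lemma stirling_upper n : (1 <= n)%nat ->
  INR (fact n) <= exp (1 + / 2 * ln (INR n) + INR n * ln (INR n) - INR n).
Proof.
  induction n as [|n IH]; [lia|]. intros _.
  destruct n as [|n].
  - simpl. rewrite ln_1. right. symmetry. rewrite <- exp_0. f_equal. ring.
  - specialize (IH ltac:(lia)). set (x := INR (S n)) in *.
    assert (Hx : 0 < x) by (apply lt_0_INR; lia).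
    rewrite fact_simpl, mult_INR, (S_INR (S n)). fold x.
    pose proof (ln_1p_lower (/ x) ltac:(left; apply Rinv_0_lt_compat, Hx)) as Hl.
    assert (E1 : ln (x + 1) = ln x + ln (1 + / x)).
    { rewrite <- ln_mult; [f_equal; field; lra|exact Hx|].
      assert (0 < / x) by (apply Rinv_0_lt_compat, Hx). lra. }
    assert (E2 : 2 * / x / (2 + / x) = 2 / (2 * x + 1)) by (field; lra).
    rewrite E2 in Hl.
    assert (E3 : 1 <= (x + / 2) * ln (1 + / x)).
    { apply Rle_trans with ((x + / 2) * (2 / (2 * x + 1))); [right; field; lra|].
      apply Rmult_le_compat_l; [lra|exact Hl]. }
    rewrite <- (exp_ln (x + 1)) at 1 by lra.
    apply Rle_trans with (exp (ln (x + 1)) * exp (1 + / 2 * ln x + x * ln x - x)).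
    + apply Rmult_le_compat_l; [left; apply exp_pos|exact IH].
    + rewrite <- exp_plus. apply exp_mono. rewrite E1. lra.
Qed.

(** On this range x - x^3 / 6 >= x / 3, and the next two Taylor terms together are nonnegative. *)
Lemma sin_lower x : 0 <= x <= 2 -> x / 3 <= sin x.
Proof.
  intros Hx. pose proof PI2_3_2 as HP.
  pose proof (SIN x ltac:(lra) ltac:(unfold PI2 in HP; lra)) as [Hs _].
  eapply Rle_trans; [|exact Hs].
  unfold sin_lb, sin_approx, sum_f_R0, sin_term.
  assert (F : forall m k, Z.of_nat (fact m) = k -> INR (fact m) = IZR k) by (intros m k <-; apply INR_IZR_INZ).
  cbn [Nat.mul Nat.add].
  rewrite (F 1%nat 1%Z eq_refl), (F 3%nat 6%Z eq_refl), (F 5%nat 120%Z eq_refl), (F 7%nat 5040%Z eq_refl).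
  assert (H2 : 0 <= 4 - x * x) by nra.
  assert (H5 : 0 <= x * (4 - x * x)) by (apply Rmult_le_pos; lra).
  assert (H6 : 0 <= x * x * x * x * x * (42 - x * x)) by (repeat apply Rmult_le_pos; lra).
  match goal with |- _ <= ?e => replace e with (x - x ^ 3 / 6 + x ^ 5 * (42 - x ^ 2) / 5040) by field end.
  simpl. lra.
Qed.

(** From cos x = 1 - 2 sin^2 (x / 2) and [sin_lower], since 2 (x / 6)^2 = x^2 / 18. A quadratic
    bound on the whole circle makes the saddle estimate global. *)
Lemma cos_upper x : - PI <= x <= PI -> cos x <= 1 - x ^ 2 / 18.
Proof.
  intros Hx. pose proof PI_4.
  assert (K : forall y, 0 <= y <= PI -> cos y <= 1 - y ^ 2 / 18).
  { intros y Hy. pose proof (sin_lower (y / 2) ltac:(lra)) as Hs.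
    replace y with (2 * (y / 2)) at 1 by field. rewrite cos_2a_sin.
    nra. }
  destruct (Rle_dec 0 x) as [H0|H0].
  - apply K. lra.
  - rewrite <- cos_neg. replace (x ^ 2) with ((- x) ^ 2) by ring. apply K. lra.
Qed.

(** The weight |x| gives an elementary primitive and the order 1/n, where the Gaussian alone would
    give 1 / sqrt n. This gain is what makes the error tend to 0. *)
Lemma is_RInt_abs_gauss n : 0 < n ->
  is_RInt (fun x => Rabs x * exp (- (n * x ^ 2 / 18))) (- PI) PI (18 / n * (1 - exp (- (n * PI ^ 2 / 18)))).
Proof.
  intros Hn. pose proof PI_RGT_0 as HPI.
  replace (18 / n * (1 - exp (- (n * PI ^ 2 / 18)))) with
    (plus (minus (9 / n * exp (- (n * 0 ^ 2 / 18))) (9 / n * exp (- (n * (- PI) ^ 2 / 18))))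
          (minus (- (9 / n) * exp (- (n * PI ^ 2 / 18))) (- (9 / n) * exp (- (n * 0 ^ 2 / 18))))).
  - apply (is_RInt_Chasles (V := R_NormedModule)) with 0.
    + apply is_RInt_ext with (fun x => - x * exp (- (n * x ^ 2 / 18))).
      { intros x Hx. rewrite Rmin_left, Rmax_right in Hx by lra. rewrite Rabs_left by lra. reflexivity. }
      apply (is_RInt_derive (V := R_CompleteNormedModule) (fun x => 9 / n * exp (- (n * x ^ 2 / 18)))).
      * intros x _. auto_derive; [exact I|]. unfold Rdiv; simpl pow. field. lra.
      * intros x _. apply (ex_derive_continuous (V := R_NormedModule)). auto_derive. exact I.
    + apply is_RInt_ext with (fun x => x * exp (- (n * x ^ 2 / 18))).
      { intros x Hx. rewrite Rmin_left, Rmax_right in Hx by lra. rewrite Rabs_pos_eq by lra. reflexivity. }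
      apply (is_RInt_derive (V := R_CompleteNormedModule) (fun x => - (9 / n) * exp (- (n * x ^ 2 / 18)))).
      * intros x _. auto_derive; [exact I|]. unfold Rdiv; simpl pow. field. lra.
      * intros x _. apply (ex_derive_continuous (V := R_NormedModule)). auto_derive. exact I.
  - match goal with |- plus (minus ?a ?b) (minus ?c ?d) = _ => change ((a - b) + (c - d) = 18 / n * (1 - exp (- (n * PI ^ 2 / 18)))) end.
    replace (- (n * 0 ^ 2 / 18)) with 0 by field. rewrite exp_0.
    replace ((- PI) ^ 2) with (PI ^ 2) by ring. field. lra.
Qed.

Lemma Cmod_sinpi_plus_nat a n : Cmod (sinpi (a + INR n)) = Cmod (sinpi a).
Proof.
  rewrite sinpi_plus_nat, Cmod_mult, Cmod_pow.
  replace (Cmod (-1)) with 1; [rewrite pow1; ring|].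
  rewrite Cmod_R, Rabs_left; lra.
Qed.

(* With the radius n of the contour, the integrand for n + 1 + z differs from the one for
   n + 1, whose integral is 1 / n!, by O(|theta|) on the saddle of width n^(-1/2). *)
Lemma hankel_asymptotics z : exists A, forall n, (1 <= n)%nat -> Rabs (Re z) <= INR n ->
  Cmod (INR (fact n) * cpow (INR n) z * hankel (INR n + 1 + z) 0 - 1) <= A / sqrt (INR n).
Proof.
  pose proof PI_RGT_0 as HPI. pose proof PI_4 as HPI4.
  set (A0 := Cmod z * exp (Cmod z * 4)).
  assert (HA0 : 0 <= A0) by (apply Rmult_le_pos; [apply Cmod_ge_0|left; apply exp_pos]).
  exists (exp 1 * (/ (2 * PI) * (A0 * 18) + Cmod (sinpi z) * / PI)).
  intros n Hn Hzn. set (x := INR n) in *. set (L := ln x).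
  assert (Hx : 1 <= x) by (apply (le_INR 1), Hn).
  assert (HL : exp L = x) by (apply exp_ln; lra).
  pose proof (stirling_upper n Hn) as HS. fold x in HS.
  set (N := INR (fact n)) in *. assert (HN : 0 < N) by apply INR_fact_pos.
  (* The number 1 is written as n! times the loop integral at n + 1, so that only a difference of
     integrals over the same circle is estimated and the saddle-point constant is never computed. *)
  pose proof (hankel_nat n L) as HN1. fold x in HN1. fold N in HN1.
  replace (N * cpow x z * hankel (x + 1 + z) 0 - 1)%C with
    (N * cpow x z * hankel (x + 1 + z) 0 - N * hankel (x + 1) L)%C by (rewrite HN1; reflexivity).
  rewrite (hankel_indep (x + 1 + z) 0 L). unfold hankel.
  assert (Es : sinpi (x + 1) = 0) by (unfold x; rewrite <- RtoC_S; apply sinpi_nat).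
  rewrite Es.
  set (g := fun th : R => hk (x + 1) (L + Ci * th)).
  (* On the circle of radius n, the factor n^z w^(-z) is exp (- i z theta). *)
  assert (Eg : forall th : R, (cpow x z * hk (x + 1 + z) (L + Ci * th) - g th =
     g th * (Cexp (- (Ci * z * th)) - 1))%C).
  { intros th. unfold g, hk, cpow. fold L.
    replace (Cexp (L + Ci * th) + (1 - (x + 1 + z)) * (L + Ci * th))%C with
      ((Cexp (L + Ci * th) + (1 - (x + 1)) * (L + Ci * th)) + (- (z * L) + - (Ci * z * th)))%C by ring.
    rewrite !(Cexp_plus (Cexp (L + Ci * th) + (1 - (x + 1)) * (L + Ci * th))), (Cexp_plus (- (z * L))), (Cexp_opp (z * L)).
    field. apply Cexp_neq_0. }
  assert (Hgc : forall th, ccont g th) by (intros; apply ccont_hk_circle).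
  assert (Hg : forall th : R, - PI <= th <= PI -> Cmod (g th) <= exp (x - x * L) * exp (- (x * th ^ 2 / 18))).
  { intros th Hth. unfold g, hk. rewrite Cmod_Cexp, <- exp_plus. apply exp_mono.
    rewrite Re_plus, Re_Cexp, Re_mult.
    replace (Re (L + Ci * th)%C) with L by (unfold Re, Ci, Cplus, Cmult, RtoC; simpl; ring).
    replace (Im (L + Ci * th)%C) with th by (unfold Im, Ci, Cplus, Cmult, RtoC; simpl; ring).
    replace (Re (1 - (x + 1))%C) with (- x) by (unfold Re, Cminus, Copp, Cplus, RtoC; simpl; ring).
    replace (Im (1 - (x + 1))%C) with 0 by (unfold Im, Cminus, Copp, Cplus, RtoC; simpl; ring).
    rewrite HL. pose proof (cos_upper th Hth) as Hc.
    apply Rmult_le_compat_l with (r := x) in Hc; [|lra]. lra. }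
  assert (Hc1 : cont_on (fun th : R => hk (x + 1 + z) (L + Ci * th))%C (- PI) PI)
    by (apply cont_on_all; intros; apply ccont_hk_circle).
  set (I1 := CInt (fun th : R => hk (x + 1 + z) (L + Ci * th)) (- PI) PI).
  set (I0 := CInt g (- PI) PI).
  assert (B1 : Cmod (cpow x z * I1 - I0) <= exp (x - x * L) * A0 * (18 / x)).
  { unfold I1, I0. rewrite <- CInt_scal by exact Hc1.
    rewrite <- CInt_minus; [|apply cont_on_scal, Hc1|apply cont_on_all, Hgc].
    rewrite (CInt_ext _ (fun th : R => g th * (Cexp (- (Ci * z * th)) - 1))%C) by (intros; apply Eg).
    apply Rle_trans with (exp (x - x * L) * A0 * (18 / x * (1 - exp (- (x * PI ^ 2 / 18))))).
    2:{ apply Rmult_le_compat_l; [apply Rmult_le_pos; [left; apply exp_pos|exact HA0]|].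
        assert (0 < 18 / x) by (apply Rdiv_lt_0_compat; lra).
        pose proof (exp_pos (- (x * PI ^ 2 / 18))). nra. }
    apply (CInt_bound _ (fun th => exp (x - x * L) * A0 * (Rabs th * exp (- (x * th ^ 2 / 18))))); [lra| | |].
    - apply cont_on_all. intros t. apply ccont_mult; [apply Hgc|cc].
    - intros th Hth. rewrite Cmod_mult.
      apply Rle_trans with (exp (x - x * L) * exp (- (x * th ^ 2 / 18)) * (Rabs th * A0)); [|right; ring].
      apply Rmult_le_compat; try apply Cmod_ge_0; [apply Hg, Hth|].
      eapply Rle_trans; [apply Cexp_minus_1_bound|].
      rewrite Cmod_opp, !Cmod_mult, Cmod_Ci, Cmod_R. unfold A0.
      rewrite Rmult_1_l. rewrite (Rmult_comm (Cmod z) (Rabs th)), Rmult_assoc.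
      apply Rmult_le_compat_l; [apply Rabs_pos|]. apply Rmult_le_compat_l; [apply Cmod_ge_0|].
      apply exp_mono. rewrite (Rmult_comm (Rabs th)). apply Rmult_le_compat_l; [apply Cmod_ge_0|]. apply Rabs_le; lra.
    - apply (is_RInt_scal (V := R_NormedModule)), is_RInt_abs_gauss. lra. }
  set (T := HInt (fun t => hm (x + 1 + z) (L + t))).
  (* The cut contributes a further factor exp (- 2 n), of which only 1/n is kept to match the
     circle. *)
  assert (B2 : Cmod (cpow x z * T) <= exp (x - x * L) * / x).
  { assert (HT : Cmod T <= exp (- x - (x + Re z) * L) / 1).
    { apply HInt_bound. split; [lra|]. split; [intros t; apply ccont_shift, ccont_hm|].
      intros t Ht. unfold hm. rewrite Cmod_Cexp, Re_hm_exponent, <- exp_plus. apply exp_mono.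
      rewrite exp_plus, HL.
      replace (Re (x + 1 + z)%C) with (x + 1 + Re z) by (unfold Re, Cplus, RtoC; simpl; ring).
      pose proof (exp_ineq1_le t) as Het.
      apply Rmult_le_compat_l with (r := x) in Het; [|lra].
      pose proof (Rabs_maj2 (Re z)).
      assert (0 <= (x + Re z) * t) by (apply Rmult_le_pos; lra).
      assert (t <= x * t) by nra. lra. }
    rewrite Cmod_mult. unfold cpow. rewrite Cmod_Cexp.
    fold L. replace (Re (z * L)%C) with (Re z * L) by (rewrite Re_mult, Re_RtoC, Im_RtoC; ring).
    apply Rle_trans with (exp (Re z * L) * (exp (- x - (x + Re z) * L) / 1)).
    - apply Rmult_le_compat_l; [left; apply exp_pos|exact HT].
    - unfold Rdiv. rewrite Rinv_1, Rmult_1_r, <- exp_plus.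
      replace (Re z * L + (- x - (x + Re z) * L)) with ((x - x * L) + - (2 * x)) by ring.
      rewrite exp_plus, (exp_Ropp (2 * x)). apply Rmult_le_compat_l; [left; apply exp_pos|].
      apply Rinv_le_contravar; [lra|]. pose proof (exp_ineq1_le (2 * x)). lra. }
  replace (N * cpow x z * (/ (2 * PI) * I1 + sinpi (x + 1 + z) * / PI * T) -
     N * (/ (2 * PI) * I0 + 0 * / PI * HInt (fun t => hm (x + 1) (L + t))))%C with
    (N * (/ (2 * PI) * (cpow x z * I1 - I0) + sinpi (x + 1 + z) * / PI * (cpow x z * T)))%C by ring.
  assert (Esn : Cmod (sinpi (x + 1 + z)) = Cmod (sinpi z)).
  { unfold x. rewrite <- RtoC_S, Cplus_comm. apply Cmod_sinpi_plus_nat. }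
  assert (E2 : Cmod (/ (2 * PI)) = / (2 * PI)).
  { rewrite <- RtoC_mult, <- RtoC_inv by lra. rewrite Cmod_R, Rabs_pos_eq; [reflexivity|].
    left; apply Rinv_0_lt_compat; lra. }
  assert (E3 : Cmod (/ PI) = / PI).
  { rewrite <- RtoC_inv by lra. rewrite Cmod_R, Rabs_pos_eq; [reflexivity|]. left; apply Rinv_0_lt_compat; lra. }
  assert (P2 : 0 < / (2 * PI)) by (apply Rinv_0_lt_compat; lra).
  assert (P1 : 0 < / PI) by (apply Rinv_0_lt_compat; lra).
  pose proof (Cmod_ge_0 (sinpi z)) as Ps.
  rewrite Cmod_mult, Cmod_R, (Rabs_pos_eq N) by lra.
  assert (B3 : Cmod (/ (2 * PI) * (cpow x z * I1 - I0) + sinpi (x + 1 + z) * / PI * (cpow x z * T)) <=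
    exp (x - x * L) * / x * (/ (2 * PI) * (A0 * 18) + Cmod (sinpi z) * / PI)).
  { eapply Rle_trans; [apply Cmod_triangle|].
    rewrite (Cmod_mult (/ (2 * PI))), (Cmod_mult (sinpi (x + 1 + z) * / PI)), (Cmod_mult (sinpi (x + 1 + z))), E2, E3, Esn.
    apply Rle_trans with (/ (2 * PI) * (exp (x - x * L) * A0 * (18 / x)) + Cmod (sinpi z) * / PI * (exp (x - x * L) * / x)).
    - apply Rplus_le_compat; apply Rmult_le_compat_l; try assumption; [lra|apply Rmult_le_pos; lra].
    - right. field. lra. }
  apply Rle_trans with (exp (1 + / 2 * L + x * L - x) *
    (exp (x - x * L) * / x * (/ (2 * PI) * (A0 * 18) + Cmod (sinpi z) * / PI))).
  { apply Rmult_le_compat; [lra|apply Cmod_ge_0|exact HS|exact B3]. }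
  (* The powers (n / e)^n of Stirling's bound and of the integrand cancel; sqrt n times 1/n
     remains. *)
  replace (exp (1 + / 2 * L + x * L - x)) with (exp 1 * exp (/ 2 * L) * exp (x * L - x)).
  2:{ rewrite <- !exp_plus. f_equal. ring. }
  assert (E4 : exp (x * L - x) * exp (x - x * L) = 1).
  { rewrite <- exp_plus, <- exp_0. f_equal. ring. }
  assert (E5 : exp (/ 2 * L) = sqrt x) by (apply (Rpower_sqrt x); lra).
  rewrite E5. assert (Hsq : 0 < sqrt x) by (apply sqrt_lt_R0; lra).
  assert (E6 : sqrt x * / x = / sqrt x).
  { rewrite <- (sqrt_sqrt x) at 2 by lra. field. lra. }
  set (D := / (2 * PI) * (A0 * 18) + Cmod (sinpi z) * / PI).
  right. transitivity (exp 1 * D * (sqrt x * / x) * (exp (x * L - x) * exp (x - x * L))); [ring|].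
  rewrite E4, E6. unfold Rdiv. ring.
Qed.

(** By [hankel_rising], [hankel z 0] is Euler's quotient u times a factor Q that tends to 1 by
    [hankel_asymptotics]. As the error is |u| |Q - 1|, u must first be bounded, by 2 |hankel z 0|
    once |Q - 1| <= 1/2. *)
Lemma rGamma_hankel z : rGamma z = hankel z 0.
Proof.
  unfold rGamma. apply C_lim_seq_unique.
  apply (filterlim_C_iff eventually (filter_filter (F := eventually))). intros eps He.
  destruct (hankel_asymptotics z) as [A HA].
  set (h := Cmod (hankel z 0)). assert (Hh : 0 <= h) by apply Cmod_ge_0.
  set (del := Rmin (1 / 2) (eps / (2 * h + 1) / 2)).
  assert (Hdel : 0 < del).
  { apply Rmin_pos; [lra|]. apply Rdiv_lt_0_compat; [|lra]. apply Rdiv_lt_0_compat; lra. }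
  (* The three summands ensure |Re z| <= n, n >= 1 and |A| / sqrt n <= del. *)
  destruct (INR_eventually_ge (Rabs (Re z) + 1 + (Rabs A / del) ^ 2)) as [N HN].
  exists N. intros n Hn. specialize (HN n Hn).
  pose proof (Rabs_pos (Re z)). pose proof (pow2_ge_0 (Rabs A / del)).
  assert (Hn1 : (1 <= n)%nat) by (apply INR_le; simpl; lra).
  specialize (HA n Hn1 ltac:(lra)).
  set (x := INR n) in *.
  assert (Hsq : 0 < sqrt x) by (apply sqrt_lt_R0; lra).
  assert (HAd : A / sqrt x <= del).
  { apply Rle_trans with (Rabs A / sqrt x).
    - apply Rmult_le_compat_r; [left; apply Rinv_0_lt_compat, Hsq|apply Rle_abs].
    - assert (Rabs A / del <= sqrt x).
      { rewrite <- (sqrt_pow2 (Rabs A / del)) by (apply Rdiv_le_0_compat; [apply Rabs_pos|exact Hdel]).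
        apply sqrt_le_1; lra. }
      apply Rmult_le_reg_r with (sqrt x); [exact Hsq|].
      replace (Rabs A / sqrt x * sqrt x) with (Rabs A / del * del) by (field; lra).
      rewrite (Rmult_comm del). apply Rmult_le_compat_r; lra. }
  set (Q := (INR (fact n) * cpow x z * hankel (x + 1 + z) 0)%C) in *.
  set (u := (rising z (S n) / (INR (fact n) * cpow x z))%C).
  assert (Hf : RtoC (INR (fact n)) <> 0) by apply RtoC_neq_0, INR_fact_neq_0.
  assert (Hc : cpow x z <> 0) by apply Cexp_neq_0.
  assert (EQ : hankel z 0 = (u * Q)%C).
  { rewrite (hankel_rising z (S n) 0), RtoC_S. fold x. unfold u, Q.
    replace (z + (x + 1))%C with (x + 1 + z)%C by ring. field. split; assumption. }
  assert (Hd2 : del <= 1 / 2) by apply Rmin_l.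
  assert (Hd3 : del <= eps / (2 * h + 1) / 2) by apply Rmin_r.
  assert (Eu : (u - hankel z 0 = - (u * (Q - 1)))%C) by (rewrite EQ; ring).
  assert (Bu : Cmod u <= 2 * h).
  { pose proof (Cmod_triangle (hankel z 0) (- (u * (Q - 1)))) as T.
    rewrite <- Eu in T. replace (hankel z 0 + (u - hankel z 0))%C with u in T by ring.
    rewrite Eu, Cmod_opp, Cmod_mult in T. fold h in T. nra. }
  change (Cmod (u - hankel z 0) < eps). rewrite Eu, Cmod_opp, Cmod_mult.
  apply Rle_lt_trans with (2 * h * (eps / (2 * h + 1) / 2)).
  - apply Rmult_le_compat; try apply Cmod_ge_0; lra.
  - apply Rle_lt_trans with ((2 * h + 1) * (eps / (2 * h + 1) / 2)).
    + apply Rmult_le_compat_r; lra.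
    + replace ((2 * h + 1) * (eps / (2 * h + 1) / 2)) with (eps / 2) by (field; lra). lra.
Qed.

(** * Integral representations of the Bessel functions *)

(* Schlaefli's integral; u = - y gives J_nu (2 y) and u = y gives I_nu (2 y). *)
Definition schlaefli (nu : C) (y u : R) : C :=
  (/ (2 * PI) * CInt (fun th : R => Cexp (y * Cexp (Ci * th) - Ci * nu * th) * Cexp (u * Cexp (- (Ci * th)))) (- PI) PI
   - sinpi nu * / PI * HInt (fun t : R => Cexp (- (y * Cexp t) - nu * t) * Cexp (- u * Cexp (- t))))%C.

Lemma exp_edecay_schlaefli (nu : C) y : 0 < y ->
  exists M, forall t : R, 0 <= t -> Cmod (Cexp (- (y * Cexp t) - nu * t)) <= M * exp (- (1 * t)).
Proof.
  intros Hy. destruct (exp_edecay (- Re nu) y Hy) as [M [_ H]]. exists M. intros t Ht.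
  eapply Rle_trans; [|apply (H t Ht)]. rewrite Cmod_Cexp. apply exp_mono. right.
  rewrite Cexp_RtoC. unfold Cminus. rewrite Re_plus, !Re_opp, !Re_mult, !Re_RtoC, !Im_RtoC. ring.
Qed.

Lemma etaylor_bound_le N (w : C) r : Cmod w <= r ->
  Cmod (Cexp w - etaylor N w) <= r ^ S N / INR (fact (S N)) * exp r.
Proof.
  intros H. eapply Rle_trans; [apply etaylor_remainder|].
  apply Rmult_le_compat; [|left; apply exp_pos| |apply exp_mono, H].
  - apply Rdiv_le_0_compat; [apply pow_le, Cmod_ge_0|apply INR_fact_pos].
  - apply Rmult_le_compat_r; [left; apply Rinv_0_lt_compat, INR_fact_pos|].
    apply pow_incr. split; [apply Cmod_ge_0|exact H].
Qed.

Lemma Cpow_Cexp (w : C) n : (Cexp w ^ n)%C = Cexp (INR n * w).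
Proof.
  induction n as [|n IH].
  - simpl. replace (0 * w)%C with (RtoC 0) by ring. rewrite Cexp_0. reflexivity.
  - rewrite Cpow_S, IH, <- Cexp_plus, RtoC_S. f_equal. ring.
Qed.

Lemma cpow_opp y a : cpow y (- a) = (/ cpow y a)%C.
Proof. unfold cpow. rewrite <- Cexp_opp. f_equal. ring. Qed.

(** Expanding the exponential in u under both integrals gives, term by term, Hankel's integral for 1
    / Gamma (nu + k + 1). A partial sum is the same integral with a Taylor polynomial in place of
    that exponential, so the error is controlled by the Taylor remainder. *)
Lemma schlaefli_series (nu : C) (y u : R) : 0 < y ->
  is_series (V := C_NormedModule)
    (fun k => (u * y) ^ k / INR (fact k) * rGamma (nu + INR k + 1))%C
    (cpow y (- nu) * schlaefli nu y u)%C.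
Proof.
  intros Hy. set (L := ln y). pose proof PI_RGT_0 as HPI. pose proof PI_4 as HPI4.
  assert (HyL : Cexp L = RtoC y) by (rewrite Cexp_RtoC; f_equal; apply exp_ln, Hy).
  set (phi := fun th : R => Cexp (y * Cexp (Ci * th) - Ci * nu * th)).
  set (psi := fun t : R => Cexp (- (y * Cexp t) - nu * t)).
  set (e1 := fun th : R => (u * Cexp (- (Ci * th)))%C).
  set (e2 := fun t : R => (- u * Cexp (- t))%C).
  assert (Cphi : forall th, ccont phi th) by (intros; unfold phi; cc).
  assert (Cpsi : forall t, ccont psi t) by (intros; unfold psi; cc).
  assert (Ce1 : forall th, ccont e1 th) by (intros; unfold e1; cc).
  assert (Ce2 : forall t, ccont e2 t) by (intros; unfold e2; cc).
  assert (Be1 : forall th, Cmod (e1 th) <= Rabs u).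
  { intros th. unfold e1. rewrite Cmod_mult, Cmod_R, Cmod_Cexp.
    replace (Re (- (Ci * th))%C) with 0 by (unfold Re, Copp, Ci, Cmult, RtoC; simpl; ring).
    rewrite exp_0. lra. }
  assert (Be2 : forall t, 0 <= t -> Cmod (e2 t) <= Rabs u).
  { intros t Ht. unfold e2. rewrite Cmod_mult, Cmod_opp, Cmod_R, Cmod_Cexp, Re_opp, Re_RtoC.
    rewrite <- (Rmult_1_r (Rabs u)) at 2. apply Rmult_le_compat_l; [apply Rabs_pos|].
    rewrite <- exp_0. apply exp_mono. lra. }
  destruct (exp_edecay_schlaefli nu y Hy) as [Mpsi Bpsi]. fold (psi) in Bpsi.
  set (Mphi := exp (y + Cmod nu * 4)).
  assert (Bphi : forall th, - PI <= th <= PI -> Cmod (phi th) <= Mphi).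
  { intros th Hth. eapply Rle_trans; [apply Cmod_Cexp_le|]. apply exp_mono.
    unfold Cminus. eapply Rle_trans; [apply Cmod_triangle|]. rewrite Cmod_opp, !Cmod_mult, Cmod_Ci, !Cmod_R.
    rewrite (Rabs_pos_eq y) by lra. rewrite Cmod_Cexp.
    replace (Re (Ci * th)%C) with 0 by (unfold Re, Ci, Cmult, RtoC; simpl; ring). rewrite exp_0.
    assert (Cmod nu * Rabs th <= Cmod nu * 4).
    { apply Rmult_le_compat_l; [apply Cmod_ge_0|]. apply Rabs_le; lra. }
    lra. }
  set (pN := fun N th => (phi th * etaylor N (e1 th))%C).
  set (qN := fun N t => (psi t * etaylor N (e2 t))%C).
  assert (CpN : forall N th, ccont (pN N) th) by (intros; apply ccont_mult; [apply Cphi|apply ccont_etaylor, Ce1]).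
  assert (CqN : forall N th, ccont (qN N) th) by (intros; apply ccont_mult; [apply Cpsi|apply ccont_etaylor, Ce2]).
  assert (HMpsi : 0 <= Mpsi).
  { specialize (Bpsi 0 (Rle_refl 0)). rewrite Rmult_0_r, Ropp_0, exp_0 in Bpsi.
    pose proof (Cmod_ge_0 (Cexp (- (y * Cexp 0) - nu * 0))). lra. }
  assert (Dq : forall F : R -> C, (forall t, ccont F t) -> forall B, (forall t, 0 <= t -> Cmod (F t) <= B) ->
     edecay (fun t => psi t * F t)%C (Mpsi * B) 1).
  { intros F HF B HB. split; [lra|]. split; [intros t; apply ccont_mult; [apply Cpsi|apply HF]|].
    intros t Ht. rewrite Cmod_mult.
    replace (Mpsi * B * exp (- (1 * t))) with (Mpsi * exp (- (1 * t)) * B) by ring.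
    apply Rmult_le_compat; try apply Cmod_ge_0; [apply Bpsi, Ht|apply HB, Ht]. }
  assert (Det : forall N, exists B, forall t, 0 <= t -> Cmod (etaylor N (e2 t)) <= B).
  { induction N as [|N [B IH]].
    - exists 1. intros t _. simpl. rewrite Cmod_1. lra.
    - exists (B + Cmod (/ INR (fact (S N))) * Rabs u ^ S N). intros t Ht.
      change (etaylor (S N) (e2 t)) with (etaylor N (e2 t) + / INR (fact (S N)) * e2 t ^ S N)%C.
      eapply Rle_trans; [apply Cmod_triangle|]. apply Rplus_le_compat; [apply IH, Ht|].
      rewrite Cmod_mult, Cmod_pow. apply Rmult_le_compat_l; [apply Cmod_ge_0|].
      apply pow_incr. split; [apply Cmod_ge_0|apply Be2, Ht]. }
  assert (DqN : forall N, hdecay (qN N)).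
  { intros N. destruct (Det N) as [B HB]. do 2 eexists. apply Dq; [intros; apply ccont_etaylor, Ce2|exact HB]. }
  assert (Dpow : forall k, hdecay (fun t => psi t * e2 t ^ k)%C).
  { intros k. do 2 eexists. apply (Dq (fun t => e2 t ^ k)%C) with (B := Rabs u ^ k).
    - intros t. apply ccont_Cpow, Ce2.
    - intros t Ht. rewrite Cmod_pow. apply pow_incr. split; [apply Cmod_ge_0|apply Be2, Ht]. }
  (* The loop has radius y, that is L = ln y. The sign (-1)^k of sin (pi (nu + k + 1)) is absorbed
     by the powers of - u in [e2]. *)
  assert (Hterm : forall k, ((u * y) ^ k / INR (fact k) * rGamma (nu + INR k + 1))%C =
     (cpow y (- nu) * (/ INR (fact k) *
       (/ (2 * PI) * CInt (fun th => phi th * e1 th ^ k) (- PI) PI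
        - sinpi nu * / PI * HInt (fun t => psi t * e2 t ^ k))))%C).
  { intros k. rewrite rGamma_hankel, (hankel_indep _ 0 L). unfold hankel.
    set (b := (nu + INR k + 1)%C).
    assert (Hyk2 : (y ^ k)%C = Cexp (INR k * L)) by (rewrite <- HyL, Cpow_Cexp; reflexivity).
    assert (E1 : ((u * y) ^ k * CInt (fun th : R => hk b (L + Ci * th)) (- PI) PI =
       cpow y (- nu) * CInt (fun th => phi th * e1 th ^ k) (- PI) PI)%C).
    { rewrite <- !CInt_scal.
      - apply CInt_ext. intros th _. unfold hk, b, phi, e1, cpow. fold L.
        rewrite !Cpow_mult_l, Hyk2, Cpow_Cexp.
        rewrite (Cexp_plus L), HyL.
        replace (y * Cexp (Ci * th) + (1 - (nu + INR k + 1)) * (L + Ci * th))%C with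
          ((y * Cexp (Ci * th) - Ci * nu * th) + (INR k * - (Ci * th) + (- nu * L + - (INR k * L))))%C by ring.
        rewrite (Cexp_plus (y * Cexp (Ci * th) - Ci * nu * th)), (Cexp_plus (INR k * - (Ci * th))), (Cexp_plus (- nu * L)), (Cexp_opp (INR k * L)).
        field. apply Cexp_neq_0.
      - apply cont_on_all. intros t. apply ccont_mult; [apply Cphi|apply ccont_Cpow, Ce1].
      - apply cont_on_all. intros; apply ccont_hk_circle. }
    assert (E2 : ((u * y) ^ k * (- (1)) ^ k * HInt (fun t => hm b (L + t)%R) =
       cpow y (- nu) * HInt (fun t => psi t * e2 t ^ k))%C).
    { rewrite <- (HInt_scal _ _ (hdecay_hm b L)), <- (HInt_scal _ _ (Dpow k)).
      apply HInt_eq; [|apply hdecay_scal, hdecay_hm].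
      intros t. unfold hm, b, psi, e2, cpow. fold L.
      rewrite RtoC_plus, (Cexp_plus L), HyL.
      replace (- u * Cexp (- t))%C with (u * (- (1)) * Cexp (- t))%C by ring.
      rewrite !Cpow_mult_l, Hyk2, Cpow_Cexp.
      replace (- (y * Cexp t) + (1 - (nu + INR k + 1)) * (L + t))%C with
          ((- (y * Cexp t) - nu * t) + (INR k * - t + (- nu * L + - (INR k * L))))%C by ring.
      rewrite (Cexp_plus (- (y * Cexp t) - nu * t)), (Cexp_plus (INR k * - t)), (Cexp_plus (- nu * L)), (Cexp_opp (INR k * L)).
      field. apply Cexp_neq_0. }
    assert (Es : sinpi b = (- (sinpi nu * (- (1)) ^ k))%C).
    { unfold b. rewrite sinpi_S, sinpi_plus_nat.
      replace (RtoC (-1)) with (- (1))%C by (rewrite <- RtoC_opp; reflexivity). ring. }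
    rewrite Es.
    set (X := CInt (fun th : R => hk b (L + Ci * th)) (- PI) PI) in *.
    set (Y := HInt (fun t => hm b (L + t))) in *.
    assert (Hf : RtoC (INR (fact k)) <> 0) by apply RtoC_neq_0, INR_fact_neq_0.
    transitivity (/ INR (fact k) * (/ (2 * PI) * ((u * y) ^ k * X) - sinpi nu * / PI * ((u * y) ^ k * (- (1)) ^ k * Y)))%C.
    - field. split; [apply RtoC_PI_neq_0|exact Hf].
    - rewrite E1, E2. ring. }
  assert (Hsum : forall N, sum_n (G := C_AbelianMonoid) (fun k => (u * y) ^ k / INR (fact k) * rGamma (nu + INR k + 1))%C N =
     (cpow y (- nu) * (/ (2 * PI) * CInt (pN N) (- PI) PI - sinpi nu * / PI * HInt (qN N)))%C).
  { induction N as [|N IH].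
    - rewrite sum_O, Hterm. simpl fact. simpl INR.
      rewrite (CInt_ext _ (pN 0%nat)) by (intros; reflexivity).
      change (HInt (fun t => psi t * e2 t ^ 0)%C) with (HInt (qN 0%nat)).
      match goal with |- ?a = ?b => change (@eq C a b) end. field. apply RtoC_PI_neq_0.
    - rewrite sum_Sn, IH, Hterm.
      match goal with |- plus ?a ?b = ?c => change (@eq C (Cplus a b) c) end.
      replace (CInt (pN (S N)) (- PI) PI) with
        (CInt (pN N) (- PI) PI + / INR (fact (S N)) * CInt (fun th => phi th * e1 th ^ S N) (- PI) PI)%C.
      2:{ rewrite <- CInt_scal, <- CInt_plus.
          - apply CInt_ext. intros th _. unfold pN.
            change (etaylor (S N) (e1 th)) with (etaylor N (e1 th) + / INR (fact (S N)) * e1 th ^ S N)%C. ring.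
          - apply cont_on_all, CpN.
          - apply cont_on_scal, cont_on_all. intros th. apply ccont_mult; [apply Cphi|apply ccont_Cpow, Ce1].
          - apply cont_on_all. intros th. apply ccont_mult; [apply Cphi|apply ccont_Cpow, Ce1]. }
      replace (HInt (qN (S N))) with
        (HInt (qN N) + / INR (fact (S N)) * HInt (fun t => psi t * e2 t ^ S N))%C.
      2:{ rewrite <- HInt_scal, <- HInt_plus.
          - apply HInt_eq.
            + intros t. unfold qN.
              change (etaylor (S N) (e2 t)) with (etaylor N (e2 t) + / INR (fact (S N)) * e2 t ^ S N)%C. ring.
            + apply hdecay_plus; [apply DqN|apply hdecay_scal, Dpow].
          - apply DqN.
          - apply hdecay_scal, Dpow.
          - apply Dpow. }
      ring. }
  apply is_series_C. intros eps He.
  (* The factor multiplying |u|^(N+1) / (N+1)! in the error; it does not depend on N. *)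
  set (Z := Cmod (cpow y (- nu)) * (Cmod (/ (2 * PI)) * ((PI - - PI) * Mphi) + Cmod (sinpi nu * / PI) * Mpsi) * exp (Rabs u)).
  assert (HZ : 0 <= Z).
  { unfold Z. repeat apply Rmult_le_pos; try apply Cmod_ge_0; [|left; apply exp_pos].
    apply Rplus_le_le_0_compat; repeat apply Rmult_le_pos; try apply Cmod_ge_0; try lra. left; apply exp_pos. }
  destruct (cv_speed_pow_fact (Rabs u) (eps / (Z + 1)) ltac:(apply Rdiv_lt_0_compat; lra)) as [N0 HN0].
  exists N0. intros N HN. rewrite Hsum.
  specialize (HN0 (S N) ltac:(lia)). unfold Rdist in HN0. rewrite Rminus_0_r in HN0.
  set (r := Rabs u ^ S N / INR (fact (S N))) in *.
  assert (Hr : 0 <= r) by (apply Rdiv_le_0_compat; [apply pow_le, Rabs_pos|apply INR_fact_pos]).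
  rewrite Rabs_pos_eq in HN0 by exact Hr.
  set (P := CInt (fun th : R => phi th * Cexp (u * Cexp (- (Ci * th))))%C (- PI) PI).
  set (Q := HInt (fun t : R => psi t * Cexp (- u * Cexp (- t)))%C).
  assert (Bnd1 : Cmod (CInt (pN N) (- PI) PI - P) <= (PI - - PI) * (Mphi * (r * exp (Rabs u)))).
  { unfold P. rewrite <- CInt_minus.
    - apply CInt_bound_const; [lra| |].
      + apply cont_on_all. intros t. apply ccont_minus; [apply CpN|apply ccont_mult; [apply Cphi|]]. cc.
      + intros th Hth. unfold pN. fold (e1 th).
        replace (phi th * etaylor N (e1 th) - phi th * Cexp (e1 th))%C with
          (- (phi th * (Cexp (e1 th) - etaylor N (e1 th))))%C by ring.
        rewrite Cmod_opp, Cmod_mult. apply Rmult_le_compat; try apply Cmod_ge_0; [apply Bphi, Hth|].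
        apply etaylor_bound_le, Be1.
    - apply cont_on_all, CpN.
    - apply cont_on_all. intros t. apply ccont_mult; [apply Cphi|cc]. }
  assert (DQ : edecay (fun t : R => psi t * Cexp (- u * Cexp (- t)))%C (Mpsi * exp (Rabs u)) 1).
  { apply Dq; [intros t; cc|]. intros t Ht. fold (e2 t). eapply Rle_trans; [apply Cmod_Cexp_le|].
    apply exp_mono, Be2, Ht. }
  assert (Bnd2 : Cmod (HInt (qN N) - Q) <= Mpsi * (r * exp (Rabs u)) / 1).
  { unfold Q. rewrite <- HInt_minus; [|apply DqN|do 2 eexists; exact DQ].
    apply HInt_bound.
    pose proof (Dq (fun t => etaylor N (e2 t) - Cexp (- u * Cexp (- t)))%C
      ltac:(intros t; apply ccont_minus; [apply ccont_etaylor, Ce2|cc]) (r * exp (Rabs u))) as K.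
    destruct K as [K1 [K2 K3]].
    - intros t Ht. fold (e2 t). rewrite Cmod_minus_sym. apply etaylor_bound_le, Be2, Ht.
    - split; [exact K1|]. split.
      + intros t. apply ccont_minus; [apply CqN|]. apply ccont_mult; [apply Cpsi|cc].
      + intros t Ht. specialize (K3 t Ht). unfold qN.
        replace (psi t * etaylor N (e2 t) - psi t * Cexp (- u * Cexp (- t)))%C with
          (psi t * (etaylor N (e2 t) - Cexp (- u * Cexp (- t))))%C by ring. exact K3. }
  change (schlaefli nu y u) with (/ (2 * PI) * P - sinpi nu * / PI * Q)%C.
  replace (cpow y (- nu) * (/ (2 * PI) * CInt (pN N) (- PI) PI - sinpi nu * / PI * HInt (qN N)) -
     cpow y (- nu) * (/ (2 * PI) * P - sinpi nu * / PI * Q))%C with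
    (cpow y (- nu) * (/ (2 * PI) * (CInt (pN N) (- PI) PI - P) + - (sinpi nu * / PI * (HInt (qN N) - Q))))%C by ring.
  rewrite Cmod_mult.
  apply Rle_lt_trans with (Z * r).
  - unfold Z. rewrite !Rmult_assoc. apply Rmult_le_compat_l; [apply Cmod_ge_0|].
    eapply Rle_trans; [apply Cmod_triangle|]. rewrite Cmod_opp, (Cmod_mult (/ (2 * PI))), (Cmod_mult (sinpi nu * / PI)).
    apply Rle_trans with (Cmod (/ (2 * PI)) * ((PI - - PI) * (Mphi * (r * exp (Rabs u)))) +
      Cmod (sinpi nu * / PI) * (Mpsi * (r * exp (Rabs u)) / 1)).
    + apply Rplus_le_compat; apply Rmult_le_compat_l; try apply Cmod_ge_0; assumption.
    + right. field.
  - apply Rle_lt_trans with ((Z + 1) * r); [lra|].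
    apply Rlt_le_trans with ((Z + 1) * (eps / (Z + 1))).
    + apply Rmult_lt_compat_l; lra.
    + right. field. lra.
Qed.

Lemma C_Series_unique a l : is_series (V := C_NormedModule) a l -> C_Series a = l.
Proof.
  intros H. unfold C_Series.
  apply (iota_filterlim_locally (V := C_CompleteNormedModule) (sum_n a) l H).
Qed.

Lemma bessel_schlaefli (nu : C) x : 0 < x ->
  besselJ nu x = schlaefli nu (x / 2) (- (x / 2)) /\ besselI nu x = schlaefli nu (x / 2) (x / 2).
Proof.
  intros Hx.
  assert (K : forall u (c : nat -> R), (forall k, c k = (u * (x / 2)) ^ k / INR (fact k)) ->
    (cpow (x / 2) nu * C_Series (fun k => c k * rGamma (nu + INR k + 1)))%C = schlaefli nu (x / 2) u).
  { intros u c Hc.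
    rewrite (C_Series_unique _ (cpow (x / 2) (- nu) * schlaefli nu (x / 2) u)%C).
    - rewrite cpow_opp. field. apply Cexp_neq_0.
    - eapply is_series_ext; [|apply (schlaefli_series nu (x / 2) u); lra].
      intros k. cbv beta. rewrite Hc. rewrite (RtoC_div ((u * (x / 2)) ^ k)) by apply INR_fact_neq_0.
      rewrite RtoC_pow, (RtoC_mult u). reflexivity. }
  split; apply K; intros k; rewrite Rpow_mult_distr, pow_mult; unfold Rdiv; f_equal.
  - replace ((- (x * / 2)) ^ k) with ((-1) ^ k * (x * / 2) ^ k) by (rewrite <- Rpow_mult_distr; f_equal; ring).
    rewrite Rmult_assoc, <- (Rpow_mult_distr (x * / 2)). f_equal. f_equal. ring.
  - rewrite <- Rpow_mult_distr. f_equal. ring.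
Qed.

(** * Hankel functions and the Macdonald function of a complex argument *)

Definition csinh (w : C) : C := ((Cexp w - Cexp (- w)) / 2)%C.

Definition ccosh (w : C) : C := ((Cexp w + Cexp (- w)) / 2)%C.

(* With j = i or j = - i, hankelA is pi j times the Hankel function of order nu. *)
Definition hankelA (eta : R) (nu z : C) : C :=
  (HInt (fun t : R => Cexp (z * - csinh t) * (Cexp (nu * t) + Cexp (- ((0, eta) * PI * nu) - nu * t)))
   + (0, eta) * CInt (fun th : R => Cexp (z * csinh ((0, eta) * th)) * Cexp (- (nu * ((0, eta) * th)))) 0 PI)%C.

(* Twice the Macdonald function K of order nu. *)
Definition macdonald (nu z : C) : C :=
  HInt (fun t : R => Cexp (z * - ccosh t) * (Cexp (nu * t) + Cexp (- (nu * t))))%C.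

Lemma csinh_RtoC t : csinh (RtoC t) = RtoC (sinh t).
Proof.
  unfold csinh, sinh. rewrite <- RtoC_opp, !Cexp_RtoC, RtoC_div, RtoC_minus by lra. reflexivity.
Qed.

Lemma ccosh_RtoC t : ccosh (RtoC t) = RtoC (cosh t).
Proof.
  unfold ccosh, cosh. rewrite <- RtoC_opp, !Cexp_RtoC, RtoC_div, RtoC_plus by lra. reflexivity.
Qed.

Lemma Cexp_imag (eta th : R) : is_unit_sign eta ->
  Cexp ((0, eta) * th) = (RtoC (cos th) + (0, eta) * RtoC (sin th))%C.
Proof.
  intros H. unfold Cexp.
  replace (Re ((0, eta) * th)%C) with 0 by (unfold Re, Cmult, RtoC; simpl; ring).
  replace (Im ((0, eta) * th)%C) with (eta * th) by (unfold Im, Cmult, RtoC; simpl; ring).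
  rewrite exp_0, cos_sign, sin_sign by exact H.
  unfold Cplus, Cmult, RtoC; simpl. f_equal; ring.
Qed.

Lemma csinh_ray (eta t th : R) : is_unit_sign eta ->
  csinh (t + (0, eta) * th) = (RtoC (sinh t * cos th) + (0, eta) * RtoC (cosh t * sin th))%C.
Proof.
  intros H. unfold csinh, sinh, cosh.
  replace (- (t + (0, eta) * th))%C with (RtoC (- t) + (0, eta) * RtoC (- th))%C by (rewrite !RtoC_opp; ring).
  rewrite !Cexp_plus, !Cexp_RtoC, !(Cexp_imag eta) by exact H.
  rewrite cos_neg, sin_neg.
  unfold Cdiv, Cminus, Cplus, Copp, Cmult, Cinv, RtoC; simpl. f_equal; field.
Qed.

Lemma csinh_imag (eta th : R) : is_unit_sign eta -> csinh ((0, eta) * th) = ((0, eta) * RtoC (sin th))%C.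
Proof.
  intros H. replace ((0, eta) * th)%C with (RtoC 0 + (0, eta) * th)%C by ring.
  rewrite csinh_ray by exact H. rewrite sinh_0, cosh_0, Rmult_0_l, Rmult_1_l. ring.
Qed.

Lemma ccont_csinh {U : UniformSpace} (F : U -> C) x : ccont F x -> ccont (fun y => csinh (F y)) x.
Proof.
  intros H. unfold csinh, Cdiv. apply ccont_mult; [|apply ccont_const].
  apply ccont_minus; apply ccont_Cexp; [exact H|apply ccont_opp, H].
Qed.

Lemma ccont_ccosh {U : UniformSpace} (F : U -> C) x : ccont F x -> ccont (fun y => ccosh (F y)) x.
Proof.
  intros H. unfold ccosh, Cdiv. apply ccont_mult; [|apply ccont_const].
  apply ccont_plus; apply ccont_Cexp; [exact H|apply ccont_opp, H].
Qed.

Lemma sinh_lower t : 0 <= t -> exp t / 2 - 1 / 2 <= sinh t.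
Proof.
  intros Ht. unfold sinh. assert (exp (- t) <= 1) by (rewrite <- exp_0; apply exp_mono; lra). lra.
Qed.

Lemma sinh_ge_0 t : 0 <= t -> 0 <= sinh t.
Proof. intros Ht. unfold sinh. assert (exp (- t) <= exp t) by (apply exp_mono; lra). lra. Qed.

Lemma sinh_le_cosh t : sinh t <= cosh t.
Proof. unfold sinh, cosh. pose proof (exp_pos (- t)). lra. Qed.

(** The mean of the bounds 1 and exp t / 2. In [macdonald_bound] the first half gives the decay exp
    (- x / 2), the second the convergence in t and the power of x at the origin. *)
Lemma cosh_lower t : 1 / 2 + exp t / 4 <= cosh t.
Proof.
  unfold cosh.
  assert (E : exp t * exp (- t) = 1) by (rewrite <- exp_plus, Rplus_opp_r; apply exp_0).
  assert (0 <= (exp t - exp (- t)) ^ 2) by apply pow2_ge_0.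
  pose proof (exp_pos (- t)).
  assert (2 <= exp t + exp (- t)) by nra. lra.
Qed.

Lemma Re_mult_RtoC (z : C) (r : R) : Re (z * RtoC r)%C = Re z * r.
Proof. rewrite Re_mult, Re_RtoC, Im_RtoC. ring. Qed.

Lemma Cmod_Cexp_RtoC (nu : C) t : Cmod (Cexp (nu * RtoC t)) = exp (Re nu * t).
Proof. rewrite Cmod_Cexp, Re_mult_RtoC. reflexivity. Qed.

Definition hankelA_weight (eta : R) (nu : C) (t : R) : C :=
  (Cexp (nu * t) + Cexp (- ((0, eta) * PI * nu) - nu * t))%C.

Lemma Rmult_abs_le b x t : Rabs x <= b -> 0 <= t -> x * t <= b * t /\ - x * t <= b * t.
Proof.
  intros H Ht. pose proof (Rle_abs x). pose proof (Rabs_maj2 x). split; apply Rmult_le_compat_r; lra.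
Qed.

Lemma hankelA_weight_bound eta nu : exists M, 0 < M /\ forall t, 0 <= t ->
  Cmod (hankelA_weight eta nu t) <= M * exp (Rabs (Re nu) * t).
Proof.
  exists (1 + exp (Re (- ((0, eta) * PI * nu))%C)).
  split; [pose proof (exp_pos (Re (- ((0, eta) * PI * nu))%C)); lra|]. intros t Ht.
  destruct (Rmult_abs_le _ (Re nu) t (Rle_refl _) Ht) as [H1 H2].
  unfold hankelA_weight. eapply Rle_trans; [apply Cmod_triangle|].
  rewrite Cmod_Cexp_RtoC, Rmult_plus_distr_r, Rmult_1_l. apply Rplus_le_compat; [apply exp_mono, H1|].
  unfold Cminus. rewrite Cexp_plus, Cmod_mult, !Cmod_Cexp. apply Rmult_le_compat_l; [left; apply exp_pos|].
  apply exp_mono. rewrite (Re_opp (nu * t)), Re_mult_RtoC. lra.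
Qed.

Lemma ccont_hankelA_weight eta nu t : ccont (hankelA_weight eta nu) t.
Proof. unfold hankelA_weight. cc. Qed.

Lemma macdonald_weight_bound (nu : C) t : 0 <= t ->
  Cmod (Cexp (nu * t) + Cexp (- (nu * t))) <= 2 * exp (Rabs (Re nu) * t).
Proof.
  intros Ht. destruct (Rmult_abs_le _ (Re nu) t (Rle_refl _) Ht) as [H1 H2].
  eapply Rle_trans; [apply Cmod_triangle|].
  rewrite !Cmod_Cexp, Re_opp, Re_mult_RtoC.
  apply exp_mono in H1. replace (- (Re nu * t)) with (- Re nu * t) by ring. apply exp_mono in H2. lra.
Qed.

Lemma exp_sinh_decay b x M0 : 0 < x -> 0 <= M0 -> exists M, forall t, 0 <= t ->
  M0 * exp (b * t) * exp (- (x * sinh t)) <= M * exp (- (1 * t)).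
Proof.
  intros Hx HM0. destruct (exp_edecay b (x / 2) ltac:(lra)) as [M [HM H]].
  exists (M0 * exp (x / 2) * M). intros t Ht. rewrite !Rmult_assoc. apply Rmult_le_compat_l; [exact HM0|].
  apply Rle_trans with (exp (x / 2) * exp (b * t - x / 2 * exp t)).
  - rewrite <- !exp_plus. apply exp_mono. pose proof (sinh_lower t Ht). nra.
  - apply Rmult_le_compat_l; [left; apply exp_pos|apply H, Ht].
Qed.

Lemma exp_cosh_decay b x M0 : 0 < x -> 0 <= M0 -> exists M, forall t, 0 <= t ->
  M0 * exp (b * t) * exp (- (x * cosh t)) <= M * exp (- (1 * t)).
Proof.
  intros Hx HM0. destruct (exp_sinh_decay b x M0 Hx HM0) as [M H]. exists M. intros t Ht.
  eapply Rle_trans; [|apply H, Ht]. apply Rmult_le_compat_l.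
  - apply Rmult_le_pos; [exact HM0|left; apply exp_pos].
  - apply exp_mono. pose proof (sinh_le_cosh t). nra.
Qed.

Lemma hdecay_hankelA eta nu z : 0 < Re z ->
  hdecay (fun t : R => Cexp (z * - csinh t) * hankelA_weight eta nu t)%C.
Proof.
  intros Hz. destruct (hankelA_weight_bound eta nu) as [M0 [HM0 HB]].
  destruct (exp_sinh_decay (Rabs (Re nu)) (Re z) M0 Hz ltac:(lra)) as [M HM].
  exists M, 1. split; [lra|]. split.
  - intros t. apply ccont_mult; [|apply ccont_hankelA_weight].
    apply ccont_Cexp, ccont_mult; [apply ccont_const|]. apply ccont_opp, ccont_csinh, ccont_RtoC_id.
  - intros t Ht. eapply Rle_trans; [|apply HM, Ht].
    rewrite Cmod_mult, Rmult_comm. apply Rmult_le_compat; try apply Cmod_ge_0; [apply HB, Ht|].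
    right. rewrite Cmod_Cexp, csinh_RtoC, <- RtoC_opp, Re_mult_RtoC. f_equal. ring.
Qed.

Lemma hdecay_macdonald nu z : 0 < Re z ->
  hdecay (fun t : R => Cexp (z * - ccosh t) * (Cexp (nu * t) + Cexp (- (nu * t))))%C.
Proof.
  intros Hz. destruct (exp_cosh_decay (Rabs (Re nu)) (Re z) 2 Hz ltac:(lra)) as [M HM].
  exists M, 1. split; [lra|]. split.
  - intros t. apply ccont_mult; [|cc].
    apply ccont_Cexp, ccont_mult; [apply ccont_const|]. apply ccont_opp, ccont_ccosh, ccont_RtoC_id.
  - intros t Ht. eapply Rle_trans; [|apply HM, Ht].
    rewrite Cmod_mult, Rmult_comm. apply Rmult_le_compat; try apply Cmod_ge_0; [apply macdonald_weight_bound, Ht|].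
    right. rewrite Cmod_Cexp, ccosh_RtoC, <- RtoC_opp, Re_mult_RtoC. f_equal. ring.
Qed.

Lemma hol_macdonald nu z : 0 < Re z -> hol (macdonald nu) z.
Proof.
  intros Hz. destruct (exp_cosh_decay (Rabs (Re nu)) (Re z / 2) 2 ltac:(lra) ltac:(lra)) as [M HM].
  (* With the margin Re z / 2, half of the decay exp (- Re z cosh t) remains. *)
  apply (hol_HInt_Cexp (fun t => - ccosh t)%C (fun t => Cexp (nu * t) + Cexp (- (nu * t)))%C z (Re z / 2) M 1);
    try lra.
  - intros t. apply ccont_opp, ccont_ccosh, ccont_RtoC_id.
  - intros t. cc.
  - intros t Ht. eapply Rle_trans; [|apply HM, Ht].
    apply Rmult_le_compat; [apply Cmod_ge_0|left; apply exp_pos|apply macdonald_weight_bound, Ht|].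
    apply exp_mono. rewrite ccosh_RtoC, Cmod_opp, <- RtoC_opp, Re_mult_RtoC, Cmod_R.
    pose proof (cosh_lower t). pose proof (exp_pos t). rewrite Rabs_pos_eq by lra. lra.
Qed.

Lemma Cmod_sign (eta : R) : is_unit_sign eta -> Cmod (0, eta) = 1.
Proof.
  intros H. unfold Cmod; simpl. replace (0 * (0 * 1) + eta * (eta * 1)) with (eta * eta) by ring.
  rewrite (sign_sqr _ H). apply sqrt_1.
Qed.

Lemma arc_weight_bound (eta : R) (nu : C) th : is_unit_sign eta -> 0 <= th <= PI ->
  Cmod (Cexp (- (nu * ((0, eta) * th)))) <= exp (Cmod nu * 4).
Proof.
  intros H Hth. pose proof PI_4. eapply Rle_trans; [apply Cmod_Cexp_le|]. apply exp_mono.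
  rewrite Cmod_opp, !Cmod_mult, (Cmod_sign eta H), Cmod_R, Rabs_pos_eq by lra.
  apply Rmult_le_compat_l; [apply Cmod_ge_0|lra].
Qed.

Lemma ccont_csinh_imag (eta t : R) : ccont (fun th : R => csinh ((0, eta) * th)) t.
Proof. apply ccont_csinh. cc. Qed.

Lemma ccont_arc_weight (eta : R) nu t : ccont (fun th : R => Cexp (- (nu * ((0, eta) * th)))) t.
Proof. cc. Qed.

Lemma hol_hankelA eta nu z : is_unit_sign eta -> 0 < Re z -> hol (hankelA eta nu) z.
Proof.
  intros Heta Hz. unfold hankelA. apply hol_plus; [|apply hol_mult; [apply hol_const|]].
  - destruct (hankelA_weight_bound eta nu) as [M0 [HM0 HB]].
    destruct (exp_sinh_decay (Rabs (Re nu)) (Re z / 2) M0 ltac:(lra) ltac:(lra)) as [M HM].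
    apply (hol_HInt_Cexp (fun t => - csinh t)%C (hankelA_weight eta nu) z (Re z / 2) M 1); try lra.
    + intros t. apply ccont_opp, ccont_csinh, ccont_RtoC_id.
    + intros t. apply ccont_hankelA_weight.
    + intros t Ht. eapply Rle_trans; [|apply HM, Ht].
      apply Rmult_le_compat; [apply Cmod_ge_0|left; apply exp_pos|apply HB, Ht|].
      apply exp_mono. rewrite csinh_RtoC, Cmod_opp, <- RtoC_opp, Re_mult_RtoC, Cmod_R.
      pose proof (sinh_ge_0 t Ht). rewrite Rabs_pos_eq by lra. lra.
  - pose proof PI_RGT_0.
    apply (hol_CInt_Cexp (fun th => csinh ((0, eta) * th)) (fun th => Cexp (- (nu * ((0, eta) * th)))) z 0 PI
      (exp (Cmod nu * 4) * exp (Cmod z + 1))); [lra| | |].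
    + intros t. apply ccont_csinh_imag.
    + intros t. apply ccont_arc_weight.
    + intros th Hth. apply Rmult_le_compat; [apply Cmod_ge_0|left; apply exp_pos|apply arc_weight_bound; assumption|].
      apply exp_mono. rewrite csinh_imag by exact Heta.
      assert (B : Cmod ((0, eta) * sin th) <= 1).
      { rewrite Cmod_mult, (Cmod_sign eta Heta), Cmod_R, Rmult_1_l. apply Rabs_le. apply SIN_bound. }
      assert (B2 : Re (z * ((0, eta) * sin th))%C <= Cmod z).
      { eapply Rle_trans; [apply Rle_abs|]. eapply Rle_trans; [apply re_le_Cmod|].
        rewrite Cmod_mult. rewrite <- (Rmult_1_r (Cmod z)) at 2. apply Rmult_le_compat_l; [apply Cmod_ge_0|exact B]. }
      lra.
Qed.

(** This is exp (- p y) <= M y^(-kappa) at y = x exp t: one bound supplies both decay in t and the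
    power of x. *)
Lemma exp_exp_le_power kappa p : 0 <= kappa -> 0 < p -> exists M, 0 < M /\ forall t x, 0 < x ->
  exp (- (p * (exp t * x))) <= M * exp (- (kappa * (t + ln x))).
Proof.
  intros Hk Hp. destruct (exp_le_exp_exp kappa p Hk Hp) as [M [HM H]]. exists M. split; [exact HM|].
  intros t x Hx. specialize (H (t + ln x)). rewrite exp_plus, exp_ln in H by exact Hx.
  rewrite !exp_Ropp. apply Rmult_le_reg_r with (exp (p * (exp t * x))); [apply exp_pos|].
  rewrite Rinv_l by apply Rgt_not_eq, exp_pos.
  apply Rmult_le_reg_r with (exp (kappa * (t + ln x))); [apply exp_pos|].
  replace (M * / exp (kappa * (t + ln x)) * exp (p * (exp t * x)) * exp (kappa * (t + ln x))) with
    (M * exp (p * (exp t * x))) by (field; apply Rgt_not_eq, exp_pos).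
  rewrite Rmult_1_l. exact H.
Qed.

(** For kappa > |Re nu| the integrand is at most a multiple of x^(-kappa) exp (- (kappa - |Re nu|)
    t), uniformly in x = Re z, with the factor exp (- x / 2) to spare. *)
Lemma macdonald_bound nu kappa : Rabs (Re nu) < kappa -> exists M, 0 <= M /\ forall z, 0 < Re z ->
  Cmod (macdonald nu z) <= M * exp (- (kappa * ln (Re z)) - Re z / 2).
Proof.
  intros Hk. pose proof (Rabs_pos (Re nu)) as Hb0. set (b := Rabs (Re nu)) in *.
  destruct (exp_exp_le_power kappa (1 / 4) ltac:(lra) ltac:(lra)) as [M0 [HM0 H0]].
  exists (2 * M0 / (kappa - b)). split; [apply Rdiv_le_0_compat; lra|]. intros z Hz.
  set (x := Re z) in *. set (Lx := ln x).
  replace (2 * M0 / (kappa - b) * exp (- (kappa * Lx) - x / 2)) with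
    (2 * M0 * exp (- (kappa * Lx) - x / 2) / (kappa - b)) by (field; lra).
  apply HInt_bound. split; [lra|]. split.
  - intros t. apply ccont_mult; [|cc].
    apply ccont_Cexp, ccont_mult; [apply ccont_const|]. apply ccont_opp, ccont_ccosh, ccont_RtoC_id.
  - intros t Ht. rewrite Cmod_mult, Rmult_comm.
    apply Rle_trans with (2 * exp (b * t) * exp (- (x * cosh t))).
    + apply Rmult_le_compat; try apply Cmod_ge_0; [apply macdonald_weight_bound, Ht|].
      right. rewrite Cmod_Cexp, ccosh_RtoC, <- RtoC_opp, Re_mult_RtoC. fold x. f_equal. ring.
    + pose proof (H0 t x Hz) as K. fold Lx in K.
      apply Rle_trans with (2 * exp (b * t) * (exp (- (x / 2)) * exp (- (1 / 4 * (exp t * x))))).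
      * apply Rmult_le_compat_l; [pose proof (exp_pos (b * t)); lra|].
        rewrite <- exp_plus. apply exp_mono. pose proof (cosh_lower t). nra.
      * apply Rle_trans with (2 * exp (b * t) * (exp (- (x / 2)) * (M0 * exp (- (kappa * (t + Lx)))))).
        -- apply Rmult_le_compat_l; [pose proof (exp_pos (b * t)); lra|].
           apply Rmult_le_compat_l; [left; apply exp_pos|exact K].
        -- right. replace (2 * exp (b * t) * (exp (- (x / 2)) * (M0 * exp (- (kappa * (t + Lx)))))) with
             (2 * M0 * (exp (b * t) * (exp (- (x / 2)) * exp (- (kappa * (t + Lx)))))) by ring.
           rewrite (Rmult_assoc (2 * M0)). f_equal. rewrite <- !exp_plus. f_equal. field.
Qed.

(** The half-line part is estimated as for K. On the arc, z sinh (j theta) = j z sin theta has real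
    part at most 0, because Im z has the sign of eta; hence the bounded term. *)
Lemma hankelA_bound eta nu kappa : is_unit_sign eta -> Rabs (Re nu) < kappa ->
  exists M, 0 <= M /\ forall z, 0 < Re z -> 0 <= eta * Im z ->
  Cmod (hankelA eta nu z) <= M * (exp (- (kappa * ln (Re z))) + 1).
Proof.
  intros Heta Hk. pose proof (Rabs_pos (Re nu)) as Hb0. set (b := Rabs (Re nu)) in *.
  destruct (hankelA_weight_bound eta nu) as [C0 [HC0 HB]]. fold b in HB.
  destruct (exp_exp_le_power kappa (1 / 2) ltac:(lra) ltac:(lra)) as [M0 [HM0 H0]].
  set (M1 := C0 * exp (1 / 2) * M0 / (kappa - b)).
  assert (HM1 : 0 <= M1).
  { apply Rdiv_le_0_compat; [|lra]. repeat apply Rmult_le_pos; try lra. left; apply exp_pos. }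
  set (M2 := PI * exp (Cmod nu * 4)). pose proof PI_RGT_0 as HPI.
  assert (HM2 : 0 <= M2) by (apply Rmult_le_pos; [lra|left; apply exp_pos]).
  exists (M1 + M2). split; [lra|]. intros z Hz Him. set (x := Re z) in *.
  (* The bound sinh t >= exp t / 2 - 1/2 costs a factor exp (x' / 2), harmless for x' <= 1. The
     values used are x' = x and, when x > 1, x' = 1. *)
  assert (Hpart : forall x', 0 < x' -> x' <= 1 -> x' <= x ->
    Cmod (HInt (fun t : R => Cexp (z * - csinh t) * hankelA_weight eta nu t)%C) <= M1 * exp (- (kappa * ln x'))).
  { intros x' Hx' Hx1 Hxx. set (Lx := ln x').
    replace (M1 * exp (- (kappa * Lx))) with (C0 * exp (1 / 2) * M0 * exp (- (kappa * Lx)) / (kappa - b))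
      by (unfold M1; field; lra).
    apply HInt_bound. split; [lra|]. split.
    - intros t. apply ccont_mult; [|apply ccont_hankelA_weight].
      apply ccont_Cexp, ccont_mult; [apply ccont_const|]. apply ccont_opp, ccont_csinh, ccont_RtoC_id.
    - intros t Ht. rewrite Cmod_mult, Rmult_comm.
      apply Rle_trans with (C0 * exp (b * t) * exp (- (x * sinh t))).
      + apply Rmult_le_compat; try apply Cmod_ge_0; [apply HB, Ht|].
        right. rewrite Cmod_Cexp, csinh_RtoC, <- RtoC_opp, Re_mult_RtoC. fold x. f_equal. ring.
      + pose proof (H0 t x' Hx') as K. fold Lx in K.
        apply Rle_trans with (C0 * exp (b * t) * (exp (1 / 2) * (M0 * exp (- (kappa * (t + Lx)))))).
        * apply Rmult_le_compat_l; [apply Rmult_le_pos; [lra|left; apply exp_pos]|].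
          apply Rle_trans with (exp (1 / 2) * exp (- (1 / 2 * (exp t * x')))).
          -- rewrite <- exp_plus. apply exp_mono. pose proof (sinh_lower t Ht). pose proof (sinh_ge_0 t Ht).
             assert (x' * sinh t <= x * sinh t) by (apply Rmult_le_compat_r; assumption).
             assert (x' * (exp t / 2 - 1 / 2) <= x' * sinh t) by (apply Rmult_le_compat_l; lra). lra.
          -- apply Rmult_le_compat_l; [left; apply exp_pos|exact K].
        * right. replace (C0 * exp (b * t) * (exp (1 / 2) * (M0 * exp (- (kappa * (t + Lx)))))) with
             (C0 * exp (1 / 2) * M0 * (exp (b * t) * exp (- (kappa * (t + Lx))))) by ring.
          rewrite (Rmult_assoc (C0 * exp (1 / 2) * M0)). f_equal. rewrite <- !exp_plus. f_equal. ring. }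
  assert (P1 : Cmod (HInt (fun t : R => Cexp (z * - csinh t) * hankelA_weight eta nu t)%C) <=
     M1 * (exp (- (kappa * ln x)) + 1)).
  { pose proof (exp_pos (- (kappa * ln x))).
    destruct (Rle_dec x 1) as [Hx1|Hx1].
    - eapply Rle_trans; [apply (Hpart x); lra|]. apply Rmult_le_compat_l; lra.
    - eapply Rle_trans; [apply (Hpart 1); lra|]. rewrite ln_1, Rmult_0_r, Ropp_0, exp_0.
      apply Rmult_le_compat_l; lra. }
  assert (P2 : Cmod ((0, eta) * CInt (fun th : R => Cexp (z * csinh ((0, eta) * th)) * Cexp (- (nu * ((0, eta) * th))))%C 0 PI) <= M2).
  { rewrite Cmod_mult, (Cmod_sign eta Heta), Rmult_1_l.
    replace M2 with ((PI - 0) * exp (Cmod nu * 4)) by (unfold M2; ring).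
    apply CInt_bound_const; [lra| |].
    - apply cont_on_all. intros t. apply ccont_mult; [|apply ccont_arc_weight].
      apply ccont_Cexp, ccont_mult; [apply ccont_const|apply ccont_csinh_imag].
    - intros th Hth. rewrite Cmod_mult. rewrite <- (Rmult_1_l (exp (Cmod nu * 4))).
      apply Rmult_le_compat; try apply Cmod_ge_0; [|apply arc_weight_bound; assumption].
      rewrite Cmod_Cexp, <- exp_0. apply exp_mono. rewrite csinh_imag by exact Heta.
      replace (Re (z * ((0, eta) * sin th))%C) with (- (eta * Im z * sin th)).
      2:{ unfold Re, Im, Cmult, RtoC; simpl. ring. }
      assert (0 <= sin th) by (apply sin_ge_0; lra).
      assert (0 <= eta * Im z * sin th) by (apply Rmult_le_pos; assumption). lra. }
  unfold hankelA. eapply Rle_trans; [apply Cmod_triangle|].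
  pose proof (exp_pos (- (kappa * ln x))).
  apply Rle_trans with (M1 * (exp (- (kappa * ln x)) + 1) + M2).
  - apply Rplus_le_compat; [exact P1|exact P2].
  - assert (0 <= M2 * exp (- (kappa * ln x))) by (apply Rmult_le_pos; lra). lra.
Qed.

Lemma sinh_opp t : sinh (- t) = - sinh t.
Proof. unfold sinh. rewrite Ropp_involutive. field. Qed.

Lemma cosh_opp t : cosh (- t) = cosh t.
Proof. unfold cosh. rewrite Ropp_involutive. field. Qed.

(* Both sides are integrals of exp (z sinh w - nu w): over the path 0 -> -oo reversed,
   0 -> j pi -> j pi + oo, and over the line Im w = pi / 2; Cauchy's theorem moves one to the other. *)
Lemma hankelA_macdonald eta nu z : is_unit_sign eta -> 0 < Re z -> 0 < eta * Im z ->
  hankelA eta nu z = (Cexp (- (nu * ((0, eta) * (PI / 2)%R))) * macdonald nu (- (0, eta) * z))%C.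
Proof.
  intros Heta Hx Hy. set (j := (0, eta) : C). set (x := Re z) in *. set (y := eta * Im z) in *.
  pose proof PI_RGT_0 as HPI. pose proof PI_4 as HPI4.
  assert (Hne : eta <> 0) by (destruct Heta as [->| ->]; lra).
  set (E := fun w : C => Cexp (z * csinh w + - (nu * w))).
  assert (EM : forall w, E w = (Cexp (z * csinh w) * Cexp (- (nu * w)))%C) by (intros; apply Cexp_plus).
  assert (HolE : forall w, hol E w).
  { intros w. apply (hol_comp Cexp (fun w => z * csinh w + - (nu * w))%C); [apply hol_Cexp|].
    apply hol_plus.
    - apply hol_mult; [apply hol_const|]. unfold csinh, Cdiv. apply hol_mult; [|apply hol_const].
      apply hol_minus; [apply hol_Cexp|]. apply (hol_comp Cexp); [apply hol_Cexp|apply hol_opp, hol_id].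
    - apply hol_opp, (hol_mult (fun _ => nu) (fun w => w)); [apply hol_const|apply hol_id]. }
  assert (CE : forall (F : R -> C) t, ccont F t -> ccont (fun t => E (F t)) t).
  { intros F t HF. apply (ccont_path E F); [exact HF|apply hol_ccont, HolE]. }
  assert (Chor : forall (th : R) t, ccont (fun t : R => E (t + j * th)%C) t) by (intros; apply CE; cc).
  assert (Cver : forall (T : R) th, ccont (fun th : R => E (T + j * th)%C) th) by (intros; apply CE; cc).
  assert (Cver0 : forall th, ccont (fun th : R => E (j * th)%C) th) by (intros; apply CE; cc).
  assert (Cneg : forall (th : R) t, ccont (U := R_UniformSpace) (fun t : R => E (RtoC (- t)%R + j * th)%C) t).
  { intros th t. apply (ccont_neg (fun t : R => E (t + j * th)%C)), Chor. }
  assert (Hj2 : (j * j)%C = (- RtoC 1)%C).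
  { unfold j, Cmult, Copp, RtoC; simpl. f_equal; [|ring].
    pose proof (sign_sqr eta Heta). lra. }

  set (FA := fun t : R => (Cexp (z * - csinh t) * hankelA_weight eta nu t)%C).
  set (FK := fun t : R => (E (RtoC (- t)%R + j * (PI / 2)%R) + E (t + j * (PI / 2)%R))%C).
  set (q := Cexp (- (nu * (j * (PI / 2)%R)))).
  (* The two terms of the weight are the two horizontal rays of the path, folded together at t =
     0. *)
  assert (HA : forall t : R, FA t = (E (RtoC (- t)%R + j * 0%R) + E (t + j * PI))%C).
  { intros t. rewrite !EM. unfold j. rewrite !csinh_ray by exact Heta. rewrite sin_0, cos_0, sin_PI, cos_PI, sinh_opp.
    unfold FA, hankelA_weight. fold j. rewrite csinh_RtoC.
    replace (z * (RtoC (- sinh t * 1) + j * RtoC (cosh (- t) * 0)))%C with (z * - sinh t)%C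
      by (rewrite !RtoC_mult, RtoC_opp; ring).
    replace (z * (RtoC (sinh t * -1) + j * RtoC (cosh t * 0)))%C with (z * - sinh t)%C
      by (rewrite !RtoC_mult; ring).
    replace (- (nu * (RtoC (- t)%R + j * 0%R)))%C with (nu * t)%C by (rewrite RtoC_opp; ring).
    replace (- (nu * (t + j * PI)))%C with (- (j * PI * nu) - nu * t)%C by ring. ring. }
  assert (HK : forall t : R, (q * (Cexp (- j * z * - ccosh t) * (Cexp (nu * t) + Cexp (- (nu * t)))))%C = FK t).
  { intros t. unfold FK. rewrite !EM. unfold j. rewrite !csinh_ray by exact Heta.
    rewrite sin_PI2, cos_PI2, cosh_opp. fold j. rewrite ccosh_RtoC.
    replace (z * (RtoC (sinh (- t) * 0) + j * RtoC (cosh t * 1)))%C with (- j * z * - cosh t)%C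
      by (rewrite !RtoC_mult; ring).
    replace (z * (RtoC (sinh t * 0) + j * RtoC (cosh t * 1)))%C with (- j * z * - cosh t)%C
      by (rewrite !RtoC_mult; ring).
    replace (- (nu * (RtoC (- t)%R + j * (PI / 2)%R)))%C with (- (nu * (j * (PI / 2)%R)) + nu * t)%C by (rewrite RtoC_opp; ring).
    replace (- (nu * (t + j * (PI / 2)%R)))%C with (- (nu * (j * (PI / 2)%R)) + - (nu * t))%C by ring.
    rewrite (Cexp_plus (- (nu * (j * (PI / 2)%R))) (nu * t)), (Cexp_plus (- (nu * (j * (PI / 2)%R))) (- (nu * t))).
    fold q. ring. }
  assert (Hrot : 0 < Re (- j * z)%C).
  { replace (Re (- j * z)%C) with y; [exact Hy|]. unfold y, j, Re, Im, Copp, Cmult; simpl. ring. }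
  pose proof (hdecay_macdonald nu _ Hrot) as DK.
  unfold macdonald. rewrite <- (HInt_scal q _ DK).
  rewrite (HInt_eq _ FK HK) by (apply hdecay_scal, DK).
  pose proof (hdecay_eq _ _ HK (hdecay_scal q _ DK)) as DFK.
  pose proof (hdecay_hankelA eta nu z Hx) as DFA. fold FA in DFA.
  unfold hankelA. fold j.
  change (HInt (fun t : R => Cexp (z * - csinh t) * (Cexp (nu * t) + Cexp (- (j * PI * nu) - nu * t)))%C) with (HInt FA).
  rewrite (CInt_ext _ (fun th : R => E (j * th)%C)) by (intros th _; rewrite EM; reflexivity).
  set (A0 := CInt (fun th : R => E (j * th)%C) 0 PI).
  symmetry.
  destruct DFK as [MK [dK DFK]]. destruct DFA as [MA [dA DFA]].
  apply (HInt_unique FK MK dK _ DFK).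
  (* On the vertical sides the decay comes from x where |cos| is large and from y where sin is
     large; as |cos| + sin >= 1 there, the minimum serves throughout. *)
  set (m := Rmin x y). assert (Hm : 0 < m) by (apply Rmin_pos; assumption).
  assert (Hmx : m <= x) by apply Rmin_l. assert (Hmy : m <= y) by apply Rmin_r.
  destruct (exp_sinh_decay (Cmod nu) m (exp (Cmod nu * 4)) Hm ltac:(left; apply exp_pos)) as [MV HV].
  assert (HVb : forall (T T' th : R), 0 <= T -> Rabs T' = T -> 0 <= th <= PI ->
     x * (sinh T' * cos th) - y * (cosh T * sin th) <= - (m * sinh T) ->
     Cmod (E (T' + j * th)%C) <= MV * exp (- (1 * T))).
  { intros T T' th HT HT' Hth Hre. eapply Rle_trans; [|apply HV, HT].
    assert (Hc : cosh T' = cosh T).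
    { rewrite <- HT'. destruct (Rle_dec 0 T'); [rewrite Rabs_pos_eq by lra; reflexivity|].
      rewrite Rabs_left, cosh_opp by lra. reflexivity. }
    rewrite EM, Cmod_mult, (Rmult_comm (Cmod _)). apply Rmult_le_compat; try apply Cmod_ge_0.
    - rewrite <- exp_plus. eapply Rle_trans; [apply Cmod_Cexp_le|]. apply exp_mono.
      rewrite Cmod_opp, Cmod_mult.
      assert (B : Cmod (T' + j * th) <= T + 4).
      { eapply Rle_trans; [apply Cmod_triangle|]. unfold j. rewrite Cmod_mult, (Cmod_sign eta Heta), !Cmod_R, HT'.
        rewrite (Rabs_pos_eq th) by lra. lra. }
      apply Rmult_le_compat_l with (r := Cmod nu) in B; [|apply Cmod_ge_0]. lra.
    - rewrite Cmod_Cexp. apply exp_mono. unfold j. rewrite csinh_ray by exact Heta.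
      eapply Rle_trans; [|exact Hre]. right. unfold x, y. rewrite <- Hc.
      unfold Re, Im, Cplus, Cmult, RtoC; simpl. ring. }
  intros eps He. assert (He3 : 0 < eps / 3) by lra.
  destruct (HInt_lim FA MA dA _ DFA He3) as [T1 [HT1 L1]].
  destruct (decay_small (PI * MV) 1 _ Rlt_0_1 He3) as [T2 [HT2 L2]].
  exists (T1 + T2). intros T HT. specialize (L1 T ltac:(lra)). specialize (L2 T ltac:(lra)).
  assert (HolS : strip_hol (0, eta) (-5) 5 E) by (intros t th _; apply HolE).
  pose proof (cauchy_rectangle eta (-5) 5 E 0 T (PI / 2) PI Hne HolS ltac:(lra) ltac:(lra) ltac:(lra)) as R1.
  pose proof (cauchy_rectangle eta (-5) 5 E (- T) 0 0 (PI / 2) Hne HolS ltac:(lra) ltac:(lra) ltac:(lra)) as R2.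
  fold j in R1, R2.
  rewrite (CInt_minus (fun th : R => E (T + j * th)%C)) in R1 by (apply cont_on_all, Cver).
  rewrite (CInt_minus (fun th : R => E (0 + j * th)%C)) in R2 by (apply cont_on_all, Cver).
  rewrite (CInt_ext (fun th : R => E (0 + j * th)%C) (fun th : R => E (j * th)%C)) in R1
    by (intros; f_equal; ring).
  rewrite (CInt_ext (fun th : R => E (0 + j * th)%C) (fun th : R => E (j * th)%C)) in R2
    by (intros; f_equal; ring).
  pose proof (CInt_reflect (fun t : R => E (t + j * (PI / 2)%R)%C) 0 T (Chor (PI / 2))) as S1.
  pose proof (CInt_reflect (fun t : R => E (t + j * 0%R)%C) 0 T (Chor 0)) as S2.
  rewrite Ropp_0 in S1, S2.
  assert (EA : CInt FA 0 T = (CInt (fun t : R => E (t + j * 0%R)%C) (- T) 0 + CInt (fun t : R => E (t + j * PI)%C) 0 T)%C).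
  { rewrite <- S2. rewrite <- (CInt_plus (fun t : R => E (RtoC (- t)%R + j * 0%R)%C)).
    - apply CInt_ext. intros t _. apply HA.
    - apply cont_on_all, Cneg.
    - apply cont_on_all, Chor. }
  assert (EK : CInt FK 0 T = (CInt (fun t : R => E (t + j * (PI / 2)%R)%C) (- T) 0 + CInt (fun t : R => E (t + j * (PI / 2)%R)%C) 0 T)%C).
  { rewrite <- S1. rewrite <- (CInt_plus (fun t : R => E (RtoC (- t)%R + j * (PI / 2)%R)%C)).
    - reflexivity.
    - apply cont_on_all, Cneg.
    - apply cont_on_all, Chor. }
  assert (E0 : A0 = (CInt (fun th : R => E (j * th)%C) 0 (PI / 2) + CInt (fun th : R => E (j * th)%C) (PI / 2) PI)%C).
  { symmetry. apply CInt_Chasles; apply cont_on_all, Cver0. }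
  set (V1 := CInt (fun th : R => E (T + j * th)%C) (PI / 2) PI) in *.
  set (V2 := CInt (fun th : R => E ((- T)%R + j * th)%C) 0 (PI / 2)) in *.
  (* Sum of two rectangles, [0, T] times [pi/2, pi] and [-T, 0] times [0, pi/2]. Their sides over t
     = 0 make up the arc, and only the two far sides remain. *)
  assert (Key : (CInt FA 0 T + j * A0 - CInt FK 0 T = j * (V1 + V2))%C).
  { rewrite EA, EK, E0.
    match type of R1 with (?a - ?b = ?c)%C => replace a with (c + b)%C by (rewrite <- R1; ring) end.
    match type of R2 with (?a - ?b = ?c)%C => replace a with (c + b)%C by (rewrite <- R2; ring) end.
    ring. }
  assert (HTp : 0 <= T) by lra.
  pose proof (sinh_ge_0 T HTp) as HsT. pose proof (sinh_le_cosh T) as HcT.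
  assert (Hsc : forall th, 0 <= th <= PI -> 0 <= sin th) by (intros; apply sin_ge_0; lra).
  assert (Hmono : forall A B : R, 0 <= A -> 0 <= B -> 1 <= A + B ->
    - (x * (sinh T * A)) - y * (cosh T * B) <= - (m * sinh T)).
  { intros A B HA' HB' HAB.
    assert (m * (sinh T * A) <= x * (sinh T * A)) by (apply Rmult_le_compat_r; [apply Rmult_le_pos; assumption|exact Hmx]).
    assert (y * (sinh T * B) <= y * (cosh T * B)).
    { apply Rmult_le_compat_l; [lra|]. apply Rmult_le_compat_r; assumption. }
    assert (m * (sinh T * B) <= y * (sinh T * B)) by (apply Rmult_le_compat_r; [apply Rmult_le_pos; assumption|exact Hmy]).
    assert (m * sinh T * 1 <= m * sinh T * (A + B)).
    { apply Rmult_le_compat_l; [apply Rmult_le_pos; lra|exact HAB]. }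
    lra. }
  assert (Hsum1 : forall c s : R, 0 <= c -> 0 <= s -> c * c + s * s = 1 -> 1 <= c + s).
  { intros c s Hc Hs H1. destruct (Rle_lt_dec 1 (c + s)) as [K|K]; [exact K|].
    assert (0 <= c * s) by (apply Rmult_le_pos; assumption).
    assert ((c + s) * (c + s) < 1 * 1) by (apply Rmult_le_0_lt_compat; lra). lra. }
  assert (Hs2 : forall th, cos th * cos th + sin th * sin th = 1).
  { intros th. pose proof (sin2_cos2 th) as S. unfold Rsqr in S. lra. }
  assert (BV1 : Cmod V1 <= (PI - PI / 2) * (MV * exp (- (1 * T)))).
  { apply CInt_bound_const; [lra|apply cont_on_all, Cver|]. intros th Hth.
    apply HVb; [lra|apply Rabs_pos_eq, HTp|lra|].
    assert (Hc : cos th <= 0) by (apply cos_le_0; lra).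
    pose proof (Hmono (- cos th) (sin th) ltac:(lra) (Hsc th ltac:(lra))
      (Hsum1 (- cos th) (sin th) ltac:(lra) (Hsc th ltac:(lra)) ltac:(pose proof (Hs2 th); lra))) as K. lra. }
  assert (BV2 : Cmod V2 <= (PI / 2 - 0) * (MV * exp (- (1 * T)))).
  { apply CInt_bound_const; [lra|apply cont_on_all, Cver|]. intros th Hth.
    apply HVb; [lra|rewrite Rabs_Ropp; apply Rabs_pos_eq, HTp|lra|].
    assert (Hc : 0 <= cos th) by (apply cos_ge_0; lra).
    pose proof (Hmono (cos th) (sin th) Hc (Hsc th ltac:(lra))
      (Hsum1 _ _ Hc (Hsc th ltac:(lra)) (Hs2 th))) as K. rewrite sinh_opp. lra. }
  replace (HInt FA + j * A0 - CInt FK 0 T)%C with ((HInt FA - CInt FA 0 T) + (CInt FA 0 T + j * A0 - CInt FK 0 T))%C by ring.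
  rewrite Key. eapply Rle_trans; [apply Cmod_triangle|]. rewrite Cmod_mult. unfold j. rewrite (Cmod_sign eta Heta), Rmult_1_l.
  pose proof (Cmod_triangle V1 V2). lra.
Qed.

Lemma Csin_sinpi nu : Csin (nu * PI) = sinpi nu.
Proof. reflexivity. Qed.

(** J is half the sum of the two Hankel functions. The arcs for eta = 1 and eta = -1 join into the
    circle of Schlaefli's integral, and the half-line parts leave exp (- i pi nu) - exp (i pi nu), a
    multiple of sin (pi nu). *)
Lemma besselJ_hankelA nu x : 0 < x ->
  besselJ nu x = (/ (2 * Ci * PI) * (hankelA 1 nu x - hankelA (-1) nu x))%C.
Proof.
  intros Hx. destruct (bessel_schlaefli nu x Hx) as [-> _]. unfold schlaefli, hankelA.
  change ((0, 1) : C) with Ci.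
  assert (Em : ((0, -1) : C) = (- Ci)%C) by (unfold Ci, Copp; simpl; f_equal; ring).
  rewrite Em.
  set (g := fun th : R => (Cexp (x * csinh (Ci * th)) * Cexp (- (nu * (Ci * th))))%C).
  assert (Cg : forall t, ccont g t).
  { intros t. unfold g. apply ccont_mult; [|cc]. apply ccont_Cexp, ccont_mult; [apply ccont_const|]. apply ccont_csinh. cc. }
  assert (X2 : forall t : R, ((x / 2)%R * Cexp t)%C = (RtoC x * (Cexp t / 2))%C).
  { intros t. rewrite RtoC_div by lra. field. }
  rewrite (CInt_ext _ g).
  2:{ intros th _. unfold g. rewrite <- !Cexp_plus. f_equal. unfold csinh.
      rewrite RtoC_opp, RtoC_div by lra. field. }
  rewrite (CInt_ext (fun th : R => (Cexp (x * csinh (- Ci * th)) * Cexp (- (nu * (- Ci * th))))%C) (fun th => g (- th))).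
  2:{ intros th _. unfold g. rewrite RtoC_opp. f_equal; f_equal; [f_equal; f_equal|]; ring. }
  rewrite CInt_reflect by exact Cg. rewrite Ropp_0.
  assert (Ech : CInt g (- PI) PI = (CInt g (- PI) 0 + CInt g 0 PI)%C).
  { symmetry. apply CInt_Chasles; apply cont_on_all, Cg. }
  rewrite Ech.
  set (h := fun t : R => (Cexp (x * - csinh t) * Cexp (- (nu * t)))%C).
  assert (Dh : hdecay h).
  { apply hdecay_eq with (fun t => / 1 * h t)%C; [intros t; field|].
    destruct (exp_sinh_decay (Rabs (Re nu)) x 1 Hx ltac:(lra)) as [M HM].
    apply hdecay_scal. exists M, 1. split; [lra|]. split.
    - intros t. unfold h. apply ccont_mult; [|cc].
      apply ccont_Cexp, ccont_mult; [apply ccont_const|]. apply ccont_opp, ccont_csinh, ccont_RtoC_id.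
    - intros t Ht. eapply Rle_trans; [|apply HM, Ht].
      destruct (Rmult_abs_le _ (Re nu) t (Rle_refl _) Ht) as [K1 K2].
      unfold h. rewrite Cmod_mult, Rmult_1_l, Rmult_comm. apply Rmult_le_compat; try apply Cmod_ge_0.
      + rewrite Cmod_Cexp, Re_opp, Re_mult_RtoC. apply exp_mono. lra.
      + right. rewrite Cmod_Cexp, csinh_RtoC, <- RtoC_opp, Re_mult_RtoC, Re_RtoC. f_equal. ring. }
  assert (E1 : HInt (fun t : R => Cexp (- ((x / 2)%R * Cexp t) - nu * t) * Cexp (- (- (x / 2))%R * Cexp (- t)))%C = HInt h).
  { symmetry. apply HInt_eq; [|exact Dh]. intros t. unfold h. rewrite <- !Cexp_plus. f_equal. unfold csinh.
    rewrite RtoC_opp, RtoC_div by lra. field. }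
  rewrite E1.
  pose proof (hdecay_hankelA 1 nu x Hx) as D1. pose proof (hdecay_hankelA (-1) nu x Hx) as D2.
  assert (E2 : (HInt (fun t : R => Cexp (x * - csinh t) * hankelA_weight 1 nu t) -
     HInt (fun t : R => Cexp (x * - csinh t) * hankelA_weight (-1) nu t) = - (2 * Ci * sinpi nu) * HInt h)%C).
  { rewrite <- HInt_minus, <- HInt_scal by assumption.
    apply HInt_eq.
    - intros t. unfold hankelA_weight, h. change ((0, 1) : C) with Ci. rewrite Em, sinpi_eq.
      replace (- (Ci * PI * nu) - nu * t)%C with (- (Ci * PI * nu) + - (nu * t))%C by ring.
      replace (- (- Ci * PI * nu) - nu * t)%C with (Ci * PI * nu + - (nu * t))%C by ring.
      rewrite !Cexp_plus. ring.
    - apply hdecay_eq with (fun t : R => Cexp (x * - csinh t) * hankelA_weight 1 nu t +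
        (- RtoC 1) * (Cexp (x * - csinh t) * hankelA_weight (-1) nu t))%C; [intros t; ring|].
      apply hdecay_plus; [exact D1|apply hdecay_scal, D2]. }
  unfold hankelA_weight in E2. rewrite Em in E2. change ((0, 1) : C) with Ci in E2.
  match type of E2 with (?a - ?b = ?c)%C => set (P := a) in *; set (Q := b) in * end.
  replace (P + Ci * CInt g 0 PI - (Q + - Ci * CInt g (- PI) 0))%C with
    ((P - Q) + Ci * (CInt g (- PI) 0 + CInt g 0 PI))%C by ring.
  rewrite E2. field. split; [apply RtoC_PI_neq_0|apply Ci_neq_0].
Qed.

(** In I_{-nu} - I_nu the circle integrals cancel by theta -> - theta, and the half-line parts add
    up with the factor sin (pi nu), which cancels the denominator. *)
Lemma besselK_quot_macdonald nu x : 0 < x -> sinpi nu <> 0 ->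
  besselK_quot nu x = (macdonald nu x / 2)%C.
Proof.
  intros Hx Hs. unfold besselK_quot.
  destruct (bessel_schlaefli nu x Hx) as [_ ->]. destruct (bessel_schlaefli (- nu) x Hx) as [_ ->].
  rewrite Csin_sinpi. unfold schlaefli.
  set (g := fun (n : C) (th : R) => (Cexp ((x / 2)%R * Cexp (Ci * th) - Ci * n * th) * Cexp ((x / 2)%R * Cexp (- (Ci * th))))%C).
  assert (Cg : forall n t, ccont (g n) t) by (intros; unfold g; cc).
  assert (E0 : CInt (g (- nu)%C) (- PI) PI = CInt (g nu) (- PI) PI).
  { pose proof (CInt_reflect (g nu) (- PI) PI (Cg nu)) as K. rewrite Ropp_involutive in K. rewrite <- K.
    apply CInt_ext. intros th _. unfold g. rewrite RtoC_opp, <- !Cexp_plus.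
    replace (Ci * - th)%C with (- (Ci * th))%C by ring.
    replace (- - (Ci * th))%C with (Ci * th)%C by ring. f_equal. ring. }
  fold (g nu). fold (g (- nu)%C). rewrite E0.
  assert (Esn : sinpi (- nu) = (- sinpi nu)%C).
  { unfold sinpi, Csin. replace (Ci * (- nu * PI))%C with (- (Ci * (nu * PI)))%C by ring.
    replace (- - (Ci * (nu * PI)))%C with (Ci * (nu * PI))%C by ring. field. apply Ci_neq_0. }
  rewrite Esn.
  set (h := fun (n : C) (t : R) => (Cexp (x * - ccosh t) * Cexp (- (n * t)))%C).
  assert (Dh : forall n, hdecay (h n)).
  { intros n. destruct (exp_cosh_decay (Rabs (Re n)) x 1 Hx ltac:(lra)) as [M HM].
    exists M, 1. split; [lra|]. split.
    - intros t. unfold h. apply ccont_mult; [|cc].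
      apply ccont_Cexp, ccont_mult; [apply ccont_const|]. apply ccont_opp, ccont_ccosh, ccont_RtoC_id.
    - intros t Ht. eapply Rle_trans; [|apply HM, Ht].
      destruct (Rmult_abs_le _ (Re n) t (Rle_refl _) Ht) as [K1 K2].
      unfold h. rewrite Cmod_mult, Rmult_1_l, Rmult_comm. apply Rmult_le_compat; try apply Cmod_ge_0.
      + rewrite Cmod_Cexp, Re_opp, Re_mult_RtoC. apply exp_mono. lra.
      + right. rewrite Cmod_Cexp, ccosh_RtoC, <- RtoC_opp, Re_mult_RtoC, Re_RtoC. f_equal. ring. }
  assert (E1 : forall n, HInt (fun t : R => Cexp (- ((x / 2)%R * Cexp t) - n * t) * Cexp (- (x / 2)%R * Cexp (- t)))%C = HInt (h n)).
  { intros n. symmetry. apply HInt_eq; [|apply Dh]. intros t. unfold h. rewrite <- !Cexp_plus. f_equal. unfold ccosh.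
    rewrite RtoC_div by lra. field. }
  rewrite !E1.
  assert (E2 : macdonald nu x = (HInt (h (- nu)%C) + HInt (h nu))%C).
  { rewrite <- HInt_plus by apply Dh. unfold macdonald. symmetry. apply HInt_eq; [|apply hdecay_plus; apply Dh].
    intros t. unfold h. replace (- (- nu * t))%C with (nu * t)%C by ring. ring. }
  rewrite E2. field. split; [apply RtoC_PI_neq_0|exact Hs].
Qed.

(** At a zero the two phases agree, so the value at nu + h is exp (i pi nu) sin (pi h). The
    increment is real because [C_lim] approaches its point along the horizontal line. *)
Lemma sinpi_zero_isolated nu h : sinpi nu = 0 -> 0 < Rabs h < 1 -> sinpi (nu + RtoC h) <> 0.
Proof.
  intros H0 Hh E. pose proof (sinpi_eq nu) as S0. pose proof (sinpi_eq (nu + RtoC h)) as S1.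
  rewrite H0 in S0. rewrite E in S1.
  replace (Ci * PI * (nu + h))%C with (Ci * PI * nu + Ci * PI * h)%C in S1 by ring.
  replace (- (Ci * PI * nu + Ci * PI * h))%C with (- (Ci * PI * nu) + - (Ci * PI * h))%C in S1 by ring.
  rewrite !Cexp_plus in S1.
  assert (E0 : Cexp (- (Ci * PI * nu)) = Cexp (Ci * PI * nu)).
  { replace (Cexp (- (Ci * PI * nu))) with (Cexp (Ci * PI * nu) - (Cexp (Ci * PI * nu) - Cexp (- (Ci * PI * nu))))%C by ring.
    rewrite <- S0. ring. }
  rewrite E0 in S1. pose proof (Cexp_neq_0 (Ci * PI * nu)) as Hn.
  assert (E1 : (Cexp (Ci * PI * h) - Cexp (- (Ci * PI * h)))%C = 0).
  { replace (Cexp (Ci * PI * h) - Cexp (- (Ci * PI * h)))%C with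
      (/ Cexp (Ci * PI * nu) * (Cexp (Ci * PI * nu) * Cexp (Ci * PI * h) - Cexp (Ci * PI * nu) * Cexp (- (Ci * PI * h))))%C
      by (field; exact Hn).
    rewrite <- S1. ring. }
  replace (Ci * PI * h)%C with ((0, 1) * (PI * h)%R)%C in E1
    by (unfold Ci, Cmult, RtoC; simpl; f_equal; ring).
  replace (- ((0, 1) * (PI * h)%R))%C with ((0, 1) * (- (PI * h))%R)%C in E1 by (rewrite RtoC_opp; ring).
  rewrite !Cexp_imag in E1 by (left; reflexivity). rewrite cos_neg, sin_neg in E1.
  apply (f_equal Im) in E1. unfold Im, Cminus, Cplus, Copp, Cmult, RtoC in E1; simpl in E1.
  pose proof PI_RGT_0 as HPI.
  destruct (Rle_lt_dec 0 h) as [Hp|Hp].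
  - rewrite Rabs_pos_eq in Hh by exact Hp.
    assert (0 < sin (PI * h)) by (apply sin_gt_0; nra). lra.
  - rewrite Rabs_left in Hh by exact Hp.
    assert (0 < sin (PI * - h)) by (apply sin_gt_0; nra).
    replace (PI * - h) with (- (PI * h)) in H by ring. rewrite sin_neg in H. lra.
Qed.

(** Changing the order by h multiplies the weights by exp (h t) or exp (- h t), which differ from 1
    by at most |h| exp (2 t); the decay exp (- x cosh t) absorbs this factor. *)
Lemma macdonald_order_lipschitz nu x : 0 < x -> exists M, 0 <= M /\ forall h, Rabs h <= 1 ->
  Cmod (macdonald (nu + RtoC h) x - macdonald nu x) <= M * Rabs h.
Proof.
  intros Hx. destruct (exp_cosh_decay (Rabs (Re nu) + 2) x 2 Hx ltac:(lra)) as [M HM].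
  assert (HM0 : 0 <= M).
  { specialize (HM 0 (Rle_refl 0)). rewrite !Rmult_0_r, Ropp_0, exp_0 in HM.
    pose proof (exp_pos (- (x * cosh 0))). lra. }
  exists M. split; [exact HM0|]. intros h Hh.
  pose proof (hdecay_macdonald (nu + RtoC h) x Hx) as D1. pose proof (hdecay_macdonald nu x Hx) as D2.
  unfold macdonald. rewrite <- HInt_minus by assumption.
  replace (M * Rabs h) with (M * Rabs h / 1) by field.
  apply HInt_bound. split; [lra|]. split.
  - intros t. apply ccont_minus; (apply ccont_mult; [|cc]);
      apply ccont_Cexp, ccont_mult; try apply ccont_const; apply ccont_opp, ccont_ccosh, ccont_RtoC_id.
  - intros t Ht. specialize (HM t Ht).
    replace (Cexp (x * - ccosh t) * (Cexp ((nu + h) * t) + Cexp (- ((nu + h) * t))) -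
       Cexp (x * - ccosh t) * (Cexp (nu * t) + Cexp (- (nu * t))))%C with
      (Cexp (x * - ccosh t) * (Cexp (nu * t) * (Cexp (h * t) - 1) + Cexp (- (nu * t)) * (Cexp (- (h * t)) - 1)))%C.
    2:{ replace ((nu + h) * t)%C with (nu * t + h * t)%C by ring.
        replace (- (nu * t + h * t))%C with (- (nu * t) + - (h * t))%C by ring. rewrite !Cexp_plus. ring. }
    assert (Eht : Cmod (h * t) = Rabs h * t) by (rewrite Cmod_mult, !Cmod_R, (Rabs_pos_eq t Ht); reflexivity).
    assert (Et : t * exp (Rabs h * t) <= exp (2 * t)).
    { replace (2 * t) with (t + t) by ring. rewrite exp_plus. apply Rmult_le_compat; [exact Ht|left; apply exp_pos| |].
      - pose proof (exp_ineq1_le t). lra.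
      - apply exp_mono. nra. }
    assert (B1 : forall w : C, Cmod w = Rabs h * t -> Cmod (Cexp w - 1) <= Rabs h * exp (2 * t)).
    { intros w Hw. eapply Rle_trans; [apply Cexp_minus_1_bound|]. rewrite Hw, Rmult_assoc.
      apply Rmult_le_compat_l; [apply Rabs_pos|exact Et]. }
    pose proof (B1 (h * t)%C Eht) as K1. pose proof (B1 (- (h * t))%C ltac:(rewrite Cmod_opp; exact Eht)) as K2.
    destruct (Rmult_abs_le _ (Re nu) t (Rle_refl _) Ht) as [N1 N2].
    assert (K3 : Cmod (Cexp (nu * t) * (Cexp (h * t) - 1) + Cexp (- (nu * t)) * (Cexp (- (h * t)) - 1)) <=
       Rabs h * (2 * exp ((Rabs (Re nu) + 2) * t))).
    { eapply Rle_trans; [apply Cmod_triangle|]. rewrite !Cmod_mult, !Cmod_Cexp, Re_opp, Re_mult_RtoC.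
      replace ((Rabs (Re nu) + 2) * t) with (Rabs (Re nu) * t + 2 * t) by ring. rewrite exp_plus.
      assert (exp (Re nu * t) * Cmod (Cexp (h * t) - 1) <= exp (Rabs (Re nu) * t) * (Rabs h * exp (2 * t))).
      { apply Rmult_le_compat; [left; apply exp_pos|apply Cmod_ge_0|apply exp_mono, N1|exact K1]. }
      assert (exp (- (Re nu * t)) * Cmod (Cexp (- (h * t)) - 1) <= exp (Rabs (Re nu) * t) * (Rabs h * exp (2 * t))).
      { apply Rmult_le_compat; [left; apply exp_pos|apply Cmod_ge_0|apply exp_mono; lra|exact K2]. }
      lra. }
    rewrite Cmod_mult.
    assert (E2 : Cmod (Cexp (x * - ccosh t)) = exp (- (x * cosh t))).
    { rewrite Cmod_Cexp, ccosh_RtoC, <- RtoC_opp, Re_mult_RtoC, Re_RtoC. f_equal. ring. }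
    rewrite E2.
    apply Rle_trans with (exp (- (x * cosh t)) * (Rabs h * (2 * exp ((Rabs (Re nu) + 2) * t)))).
    + apply Rmult_le_compat_l; [left; apply exp_pos|exact K3].
    + apply Rmult_le_compat_l with (r := Rabs h) in HM; [|apply Rabs_pos]. lra.
Qed.

(** At integer orders the quotient agrees with [macdonald] / 2 at nearby orders, and the latter is
    continuous in the order, so it is the limit. *)
Lemma besselK_macdonald nu x : 0 < x -> besselK nu x = (macdonald nu x / 2)%C.
Proof.
  intros Hx. unfold besselK. rewrite Csin_sinpi.
  destruct (Ceq_dec (sinpi nu) 0) as [E|E]; [|apply besselK_quot_macdonald; assumption].
  destruct (macdonald_order_lipschitz nu x Hx) as [M [HM HL]].
  (* The components of [C_lim] are real limits in the first coordinate; [pr] covers both. *)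
  assert (K : forall pr : C -> R, (forall c, Rabs (pr c) <= Cmod c) -> (forall a b : C, pr (a - b)%C = pr a - pr b) ->
    Lim (fun t : R => pr (besselK_quot (t, snd nu) x)) (fst nu) = Finite (pr (macdonald nu x / 2)%C)).
  { intros pr Hle Hm. apply is_lim_unique, is_lim_spec. intros eps.
    set (d := Rmin (1 / 2) (eps / (M + 1))).
    assert (Hd : 0 < d) by (apply Rmin_pos; [lra|apply Rdiv_lt_0_compat; [apply cond_pos|lra]]).
    assert (Hd1 : d <= 1 / 2) by apply Rmin_l. assert (Hd2 : d <= eps / (M + 1)) by apply Rmin_r.
    assert (Step : forall t : R, Rabs (t - fst nu) < d -> t <> fst nu ->
      Rabs (pr (besselK_quot (t, snd nu) x) - pr (macdonald nu x / 2)%C) < eps).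
    2:{ exists (mkposreal _ Hd). intros t Ht Hne. apply Step; assumption. }
    intros t Ht Hne.
    set (h := t - fst nu) in *.
    assert (Et : (t, snd nu) = (nu + RtoC h)%C).
    { destruct nu as [a b]. unfold h, Cplus, RtoC; simpl. f_equal; ring. }
    assert (Hh : 0 < Rabs h) by (apply Rabs_pos_lt; unfold h; lra).
    rewrite Et, (besselK_quot_macdonald _ x Hx (sinpi_zero_isolated nu h E ltac:(lra))).
    rewrite <- Hm. eapply Rle_lt_trans; [apply Hle|].
    replace (macdonald (nu + h) x / 2 - macdonald nu x / 2)%C with
      ((/ 2)%R * (macdonald (nu + h) x - macdonald nu x))%C by (rewrite RtoC_inv by lra; field).
    rewrite Cmod_mult, Cmod_R, Rabs_pos_eq by lra. specialize (HL h ltac:(lra)).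
    pose proof (cond_pos eps) as He.
    apply Rle_lt_trans with ((M + 1) * d / 2).
    - assert (M * Rabs h <= (M + 1) * d) by (apply Rmult_le_compat; lra). lra.
    - assert ((M + 1) * d <= eps).
      { apply Rle_trans with ((M + 1) * (eps / (M + 1))); [apply Rmult_le_compat_l; lra|right; field; lra]. }
      lra. }
  unfold C_lim.
  rewrite (K fst re_le_Cmod (fun _ _ => eq_refl)), (K snd im_le_Cmod (fun _ _ => eq_refl)).
  symmetry. apply surjective_pairing.
Qed.

(** * Linearity of Abel integrals, the two kernels, and the theorem *)

(** [C_R_NormedModule] is a module over the reals, so a complex factor is handled through real and
    imaginary parts. *)
Lemma is_RInt_gen_Cscal (c : C) (g : R -> C) (l : C) Fa Fb : Filter Fa -> Filter Fb ->
  is_RInt_gen (V := C_R_NormedModule) g Fa Fb l ->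
  is_RInt_gen (V := C_R_NormedModule) (fun x => c * g x)%C Fa Fb (c * l)%C.
Proof.
  intros HFa HFb H P HP.
  apply (proj1 (locally_Cmod _ P)) in HP. destruct HP as [eps [He HP]].
  pose proof (Cmod_ge_0 c) as Hc.
  assert (Hd : 0 < eps / (Cmod c + 1)) by (apply Rdiv_lt_0_compat; lra).
  assert (HQ : locally (T := C_UniformSpace) l (fun w => Cmod (w - l) < eps / (Cmod c + 1))).
  { apply locally_Cmod. exists (eps / (Cmod c + 1)). split; [exact Hd|]. auto. }
  specialize (H _ HQ). unfold filtermapi in *. revert H. apply filter_imp.
  intros [a b] [I [HI Hl]]. simpl in *. exists (c * I)%C. split.
  - pose proof (is_RInt_fct_extend_fst (U := R_NormedModule) (V := R_NormedModule) g a b I HI) as H1.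
    pose proof (is_RInt_fct_extend_snd (U := R_NormedModule) (V := R_NormedModule) g a b I HI) as H2.
    apply (is_RInt_fct_extend_pair (U := R_NormedModule) (V := R_NormedModule) (fun x => c * g x)%C a b).
    + apply (is_RInt_minus (V := R_NormedModule)); apply (is_RInt_scal (V := R_NormedModule)); assumption.
    + apply (is_RInt_plus (V := R_NormedModule)); apply (is_RInt_scal (V := R_NormedModule)); assumption.
  - apply HP. replace (c * I - c * l)%C with (c * (I - l))%C by ring. rewrite Cmod_mult.
    apply Rle_lt_trans with ((Cmod c + 1) * Cmod (I - l)).
    + apply Rmult_le_compat_r; [apply Cmod_ge_0|lra].
    + apply Rlt_le_trans with ((Cmod c + 1) * (eps / (Cmod c + 1))).
      * apply Rmult_lt_compat_l; [lra|exact Hl].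
      * right. field. lra.
Qed.

Lemma is_abel_int_lincomb (g1 g2 h : R -> C) (c1 c2 l1 l2 l : C) :
  is_abel_int g1 l1 -> is_abel_int g2 l2 ->
  (forall x, 0 < x -> h x = (c1 * g1 x + c2 * g2 x)%C) -> l = (c1 * l1 + c2 * l2)%C ->
  is_abel_int h l.
Proof.
  intros [G1 [H1 L1]] [G2 [H2 L2]] Hh ->.
  exists (fun s => c1 * G1 s + c2 * G2 s)%C. split.
  - intros s Hs.
    eapply (is_RInt_gen_ext (V := C_R_NormedModule)); cycle 1.
    + apply (is_RInt_gen_plus (V := C_R_NormedModule)); apply is_RInt_gen_Cscal;
        try (apply (filter_filter (F := at_right 0))); try (apply (filter_filter (F := Rbar_locally p_infty)));
        [apply (H1 s Hs)|apply (H2 s Hs)].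
    + apply Filter_prod with (fun a => 0 < a) (fun b => 0 < b).
      * exists (mkposreal 1 Rlt_0_1). intros y _ Hy. exact Hy.
      * exists 0. intros y Hy. exact Hy.
      * intros a b Ha Hb x Hx. simpl in Hx.
        assert (0 < x) by (pose proof (Rmin_pos a b Ha Hb); lra).
        rewrite Hh by assumption. match goal with |- plus ?a ?b = ?c => change (@eq C (Cplus a b) c) end. ring.
  - apply (filterlim_C_iff (at_right 0) (within_filter _ _ _ _)). intros eps He.
    pose proof (Cmod_ge_0 c1) as P1. pose proof (Cmod_ge_0 c2) as P2.
    assert (Hd1 : 0 < eps / 2 / (Cmod c1 + 1)) by (apply Rdiv_lt_0_compat; lra).
    assert (Hd2 : 0 < eps / 2 / (Cmod c2 + 1)) by (apply Rdiv_lt_0_compat; lra).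
    pose proof (proj1 (filterlim_C_iff (at_right 0) (within_filter _ _ _ _) _ _) L1 _ Hd1) as K1.
    pose proof (proj1 (filterlim_C_iff (at_right 0) (within_filter _ _ _ _) _ _) L2 _ Hd2) as K2.
    generalize (filter_and _ _ K1 K2). apply filter_imp. intros s [A1 A2].
    replace (c1 * G1 s + c2 * G2 s - (c1 * l1 + c2 * l2))%C with (c1 * (G1 s - l1) + c2 * (G2 s - l2))%C by ring.
    eapply Rle_lt_trans; [apply Cmod_triangle|]. rewrite !Cmod_mult.
    assert (B : forall c a e : R, 0 <= c -> 0 <= a -> 0 < e -> a < e / (c + 1) -> c * a < e).
    { intros c a e Hc Ha Hee Hae. apply Rle_lt_trans with ((c + 1) * a); [lra|].
      apply Rlt_le_trans with ((c + 1) * (e / (c + 1))); [apply Rmult_lt_compat_l; lra|right; field; lra]. }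
    pose proof (B _ _ (eps / 2) P1 (Cmod_ge_0 (G1 s - l1)) ltac:(lra) A1).
    pose proof (B _ _ (eps / 2) P2 (Cmod_ge_0 (G2 s - l2)) ltac:(lra) A2). lra.
Qed.

Lemma sin_ge_half th : PI / 4 <= th <= PI / 2 -> 1 / 2 <= sin th.
Proof.
  intros H. rewrite <- sin_PI6. apply sin_incr_1; lra.
Qed.

Lemma cos_ge_half th : 0 <= th <= PI / 4 -> 1 / 2 <= cos th.
Proof.
  intros H. rewrite <- cos_PI3. apply cos_decr_1; lra.
Qed.

(** The kernel exp (i omega z) is entire and bounded on the quadrant, so it serves as both [k1] and
    [k2], with kappa = 0. The rate omega / 2 comes from sin >= 1/2 on the second half. *)
Lemma abel_rotation_exp (f : C -> C) (omega : R) (mu : C) : 0 < omega ->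
  analytic_right_half_plane f ->
  (forall eps, 0 < eps -> exists B, 0 < B /\ forall w, Cmod (f (polar w)) <= B * exp (eps * exp (Re w))) ->
  -1 < Re mu ->
  exists I : C,
    is_abel_int (fun x => f x * cpow x mu * Cexp (Ci * omega * x))%C (Cexp ((mu + 1) * (Ci * (PI / 2)%R)) * I)%C /\
    is_abel_int (fun x => f (Ci * x) * cpow x mu * exp (- (omega * x)))%C I.
Proof.
  intros Hom Hf Hsub Hmu.
  assert (H1 : is_unit_sign 1) by (left; reflexivity).
  assert (Hk : forall t th : R, Cmod (Cexp (Ci * omega * Cexp (t + (0, 1) * th))) = exp (- (omega * (exp t * sin th)))).
  { intros t th. rewrite Cmod_Cexp. f_equal. pose proof (Re_rot_Cexp_ray 1 t th H1) as E.
    change ((0, 1) : C) with Ci in *.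
    replace (Ci * omega * Cexp (t + Ci * th))%C with (- (omega * (- Ci * Cexp (t + Ci * th))))%C by ring.
    rewrite Re_opp, Re_mult, Re_RtoC, Im_RtoC, E. ring. }
  assert (Hhol : forall z, hol (fun z => Cexp (Ci * omega * z)) z).
  { intros z. apply (hol_comp Cexp (fun z => Ci * omega * z)%C); [apply hol_Cexp|].
    apply (hol_mult (fun _ => Ci * omega)%C (fun z => z)); [apply hol_const|apply hol_id]. }
  destruct (abel_rotation f 1 0 (omega / 2) mu (fun z => Cexp (Ci * omega * z)) (fun z => Cexp (Ci * omega * z)) 1 H1 Hf Hsub)
    as [I [A1 A2]]; try lra.
  - intros z _. apply Hhol.
  - intros z _. apply Hhol.
  - intros t. reflexivity.
  - intros eps He. exists 1. split; [lra|]. intros t th Hth. rewrite Hk, Rmult_1_l. apply exp_mono.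
    pose proof (exp_pos t). assert (0 <= sin th) by (apply sin_ge_0; lra).
    assert (0 <= omega * (exp t * sin th)) by (repeat apply Rmult_le_pos; lra).
    assert (0 <= eps * exp t) by (apply Rmult_le_pos; lra). lra.
  - intros t th Hth. rewrite Hk, Rmult_1_l. apply exp_mono.
    pose proof (exp_pos t). pose proof (sin_ge_half th Hth).
    assert (omega * (exp t * (1 / 2)) <= omega * (exp t * sin th)).
    { apply Rmult_le_compat_l; [lra|]. apply Rmult_le_compat_l; lra. }
    lra.
  - exists I. split; [exact A1|].
    (* The combination 1 and 0 of the same integral only serves to rewrite the integrand at x >
       0. *)
    refine (is_abel_int_lincomb _ _ _ 1 0 I I _ A2 A2 _ _); [|ring].
    intros x Hx. change ((0, 1) : C) with Ci.
    replace (Ci * omega * (Ci * x))%C with (RtoC (- (omega * x))).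
    2:{ rewrite RtoC_opp, RtoC_mult. replace (Ci * omega * (Ci * x))%C with (Ci * Ci * (omega * x))%C by ring.
        rewrite Ci_sqr. ring. }
    rewrite Cexp_RtoC. ring.
Qed.

Lemma abel_rotation_bessel (f : C -> C) (eta omega : R) (mu nu : C) : 0 < omega -> is_unit_sign eta ->
  analytic_right_half_plane f ->
  (forall eps, 0 < eps -> exists B, 0 < B /\ forall w, Cmod (f (polar w)) <= B * exp (eps * exp (Re w))) ->
  Rabs (Re nu) < Re mu + 1 ->
  exists I : C,
    is_abel_int (fun x => f x * cpow x mu * hankelA eta nu (omega * x))%C (Cexp ((mu + 1) * ((0, eta) * (PI / 2)%R)) * I)%C /\
    is_abel_int (fun x => f ((0, eta) * x) * cpow x mu *
      (Cexp (- (nu * ((0, eta) * (PI / 2)%R))) * macdonald nu (- (0, eta) * (omega * ((0, eta) * x)))))%C I.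
Proof.
  intros Hom Heta Hf Hsub Hnu. set (j := (0, eta) : C).
  pose proof PI_RGT_0 as HPI. pose proof (Rabs_pos (Re nu)) as Hb0.
  (* The midpoint leaves room on both sides: above |Re nu| for the kernel bounds, below Re mu + 1
     for integrability at 0. *)
  set (kappa := (Rabs (Re nu) + (Re mu + 1)) / 2).
  assert (Hk1 : Rabs (Re nu) < kappa) by (unfold kappa; lra).
  assert (Hk2 : kappa < Re mu + 1) by (unfold kappa; lra).
  set (q := Cexp (- (nu * (j * (PI / 2)%R)))).
  destruct (hankelA_bound eta nu kappa Heta Hk1) as [M1 [HM1 B1]].
  destruct (macdonald_bound nu kappa Hk1) as [M2 [HM2 B2]].
  assert (Hlow : forall t s, 1 / 2 <= s -> s <= 1 -> 0 < omega * (exp t * s) /\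
     exp (- (kappa * ln (omega * (exp t * s)))) <= exp (- (kappa * ln (omega / 2))) * exp (- (kappa * t)) /\
     omega / 2 * exp t <= omega * (exp t * s)).
  { intros t s Hs Hs1. pose proof (exp_pos t) as Et.
    assert (Hle : omega / 2 * exp t <= omega * (exp t * s)).
    { replace (omega / 2 * exp t) with (omega * (exp t * (1 / 2))) by field.
      apply Rmult_le_compat_l; [lra|]. apply Rmult_le_compat_l; lra. }
    assert (Hp : 0 < omega / 2 * exp t) by (apply Rmult_lt_0_compat; lra).
    split; [lra|]. split; [|exact Hle].
    rewrite <- exp_plus. apply exp_mono.
    assert (Hln : ln (omega / 2) + t <= ln (omega * (exp t * s))).
    { rewrite <- (ln_exp t) at 1. rewrite <- ln_mult by lra. apply ln_le; assumption. }
    apply Rmult_le_compat_l with (r := kappa) in Hln; lra. }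
  assert (Hrew : forall t th : R, Re (omega * Cexp (t + j * th))%C = omega * (exp t * cos th)).
  { intros t th. rewrite Re_mult, Re_RtoC, Im_RtoC. unfold j. rewrite Re_Cexp_ray by exact Heta. ring. }
  assert (Hrew2 : forall z : C, Re (- j * (omega * z))%C = omega * Re (- j * z)%C).
  { intros z. replace (- j * (omega * z))%C with (omega * (- j * z))%C by ring.
    rewrite Re_mult, Re_RtoC, Im_RtoC. ring. }
  assert (Him : forall z : C, Re (- j * z)%C = eta * Im z).
  { intros z. unfold j, Re, Im, Copp, Cmult; simpl. ring. }
  assert (Homz : forall z : C, Re (omega * z)%C = omega * Re z).
  { intros z. rewrite Re_mult, Re_RtoC, Im_RtoC. ring. }
  assert (Hoz : forall z, hol (fun z => omega * z)%C z).
  { intros z. apply (hol_mult (fun _ => RtoC omega) (fun z => z)); [apply hol_const|apply hol_id]. }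
  set (Cw := exp (- (kappa * ln (omega / 2)))).
  assert (HCw : 0 < Cw) by apply exp_pos.
  (* The rate omega / 4 is the product of the 1/2 in [macdonald_bound] and of sin >= 1/2. *)
  apply (abel_rotation f eta kappa (omega / 4) mu (fun z => hankelA eta nu (omega * z))
    (fun z => q * macdonald nu (- j * (omega * z)))%C (Cmod q * (M2 * Cw)) Heta Hf Hsub); try lra.
  - intros z Hz. apply (hol_comp (hankelA eta nu) (fun z => omega * z)%C); [|apply Hoz].
    apply hol_hankelA; [exact Heta|]. rewrite Homz. apply Rmult_lt_0_compat; assumption.
  - intros z Hz. apply hol_mult; [apply hol_const|].
    apply (hol_comp (macdonald nu) (fun z => - j * (omega * z))%C).
    + apply hol_macdonald. rewrite Hrew2. apply Rmult_lt_0_compat; [exact Hom|exact Hz].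
    + apply hol_mult; [apply hol_const|apply Hoz].
  - intros t. apply hankelA_macdonald; [exact Heta| |].
    + fold j. rewrite Hrew. repeat apply Rmult_lt_0_compat; [exact Hom|apply exp_pos|].
      apply cos_gt_0; lra.
    + fold j. rewrite <- Him, Hrew2. unfold j. rewrite Re_rot_Cexp_ray by exact Heta.
      repeat apply Rmult_lt_0_compat; [exact Hom|apply exp_pos|]. apply sin_gt_0; lra.
  - intros eps He. fold j.
    destruct (exp_le_exp_exp kappa eps ltac:(lra) He) as [M3 [HM3 H3]].
    exists (M1 * (Cw + M3) + 1). split.
    { assert (0 <= M1 * (Cw + M3)) by (apply Rmult_le_pos; lra). lra. }
    intros t th Hth. pose proof (exp_pos t) as Et.
    destruct (Hlow t (cos th) (cos_ge_half th Hth) ltac:(apply COS_bound)) as [L1 [L2 _]].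
    assert (Hs : 0 <= sin th) by (apply sin_ge_0; lra).
    eapply Rle_trans.
    + apply B1.
      * rewrite Hrew. exact L1.
      * rewrite <- Him, Hrew2. unfold j. rewrite Re_rot_Cexp_ray by exact Heta.
        repeat apply Rmult_le_pos; lra.
    + rewrite Hrew.
      assert (X1 : exp (- (kappa * t)) <= exp (- (kappa * t) + eps * exp t)).
      { apply exp_mono. assert (0 <= eps * exp t) by (apply Rmult_le_pos; lra). lra. }
      assert (X2 : 1 <= M3 * exp (- (kappa * t) + eps * exp t)).
      { rewrite exp_plus, exp_Ropp. apply Rmult_le_reg_l with (exp (kappa * t)); [apply exp_pos|].
        replace (exp (kappa * t) * (M3 * (/ exp (kappa * t) * exp (eps * exp t)))) with (M3 * exp (eps * exp t))
          by (field; apply Rgt_not_eq, exp_pos).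
        (* The bounded term of [hankelA_bound] fits the required form because exp (kappa t) is
           dominated by exp (eps exp t). *)
        rewrite Rmult_1_r. apply H3. }
      set (X := exp (- (kappa * t) + eps * exp t)) in *.
      assert (HX : 0 < X) by apply exp_pos.
      apply Rle_trans with (M1 * (Cw * X + M3 * X)).
      * apply Rmult_le_compat_l; [exact HM1|]. apply Rplus_le_compat; [|exact X2].
        eapply Rle_trans; [exact L2|]. apply Rmult_le_compat_l; [left; exact HCw|exact X1].
      * lra.
  - intros t th Hth. fold j.
    destruct (Hlow t (sin th) (sin_ge_half th Hth) ltac:(apply SIN_bound)) as [L1 [L2 L3]].
    assert (E : Re (- j * (omega * Cexp (t + j * th)))%C = omega * (exp t * sin th)).
    { rewrite Hrew2. unfold j. rewrite Re_rot_Cexp_ray by exact Heta. reflexivity. }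
    rewrite Cmod_mult, Rmult_assoc. apply Rmult_le_compat_l; [apply Cmod_ge_0|].
    eapply Rle_trans; [apply B2; rewrite E; exact L1|]. rewrite E.
    rewrite Rmult_assoc. apply Rmult_le_compat_l; [exact HM2|].
    unfold Rminus. rewrite !exp_plus. rewrite <- (Rmult_assoc Cw).
    apply Rmult_le_compat; [left; apply exp_pos|left; apply exp_pos|exact L2|].
    apply exp_mono. lra.
Qed.

Theorem theorem2p1 :
  forall (omega : R) (f : C -> C) (sigma K M : R),
    0 < omega ->
    analytic_right_half_plane f ->
    0 < K ->
    (exists R0 : R, 0 < R0 /\
       forall z : C, 0 < Re z -> R0 < Cmod z ->
         Cmod (f z) <= K * Rpower (Cmod z) sigma) ->
    0 < M ->
    (exists r0 : R, 0 < r0 /\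
       forall z : C, 0 < Re z -> Cmod z < r0 -> Cmod (f z) <= M) ->
    (forall mu : C, -1 < Re mu ->
       exists I1 I2 : C,
         is_abel_int
           (fun x : R => (f x * cpow x mu * Cexp (Ci * omega * x))%C) I1 /\
         is_abel_int
           (fun x : R => (f (Ci * x) * cpow x mu * exp (- (omega * x)))%C) I2 /\
         I1 = (Cexp ((mu + 1) * PI * Ci / 2) * I2)%C) /\
    (forall mu nu : C, -1 < Re (mu + nu) -> -1 < Re (mu - nu) ->
       exists I : C,
         is_abel_int
           (fun x : R => (f x * cpow x mu * besselJ nu (omega * x))%C) I /\
         is_abel_int
           (fun x : R =>
              (fhat f mu nu (Ci * x) * cpow x mu * besselK nu (omega * x))%C) I).
Proof.
  intros omega f sigma K M Hom Hf HK Hinf _ Hzero.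
  pose proof (right_half_plane_subexp f sigma K M Hf HK Hinf Hzero) as Hsub.
  assert (HPI2 : RtoC (PI / 2) = (PI / 2)%C) by (apply RtoC_div; lra).
  split.
  - intros mu Hmu. destruct (abel_rotation_exp f omega mu Hom Hf Hsub Hmu) as [I [A1 A2]].
    eexists; exists I. split; [exact A1|]. split; [exact A2|].
    f_equal. f_equal. rewrite HPI2. field.
  - intros mu nu H1 H2.
    (* The two conditions on mu + nu and mu - nu combine into this one. *)
    assert (Hnu : Rabs (Re nu) < Re mu + 1).
    { rewrite Re_plus in H1. unfold Cminus in H2. rewrite Re_plus, Re_opp in H2. apply Rabs_def1; lra. }
    destruct (abel_rotation_bessel f 1 omega mu nu Hom ltac:(left; reflexivity) Hf Hsub Hnu) as [I1 [A1 B1]].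
    destruct (abel_rotation_bessel f (-1) omega mu nu Hom ltac:(right; reflexivity) Hf Hsub Hnu) as [I2 [A2 B2]].
    change ((0, 1) : C) with Ci in A1, B1.
    assert (Em : ((0, -1) : C) = (- Ci)%C) by (unfold Ci, Copp; simpl; f_equal; ring).
    rewrite Em in A2, B2.
    pose proof Ci_neq_0 as HCi. pose proof RtoC_PI_neq_0 as HP.
    set (e := Cexp (mu * (Ci * (PI / 2)%R))).
    assert (He : e <> 0) by apply Cexp_neq_0.
    assert (Ee' : Cexp (- (mu * (Ci * (PI / 2)%R))) = (/ e)%C) by apply Cexp_opp.
    assert (EI : Cexp (Ci * (PI / 2)%R) = Ci) by (apply (Cexp_quarter 1); left; reflexivity).
    assert (EI' : Cexp (- (Ci * (PI / 2)%R)) = (- Ci)%C).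
    { rewrite Cexp_opp, EI. replace (/ Ci)%C with (/ Ci * (- (Ci * Ci)))%C by (rewrite Ci_sqr; field; exact HCi).
      field. exact HCi. }
    (* The coefficients 1 / (2 pi i) and - 1 / (2 pi i) of the Hankel functions in J meet the phases
       exp (i pi (mu + 1) / 2) and exp (- i pi (mu + 1) / 2) of the rotations; the factors i and - i
       cancel. *)
    exists (/ (2 * PI) * e * I1 + / (2 * PI) * / e * I2)%C. split.
    + refine (is_abel_int_lincomb _ _ _ (/ (2 * Ci * PI))%C (- / (2 * Ci * PI))%C _ _ _ A1 A2 _ _).
      * intros x Hx. rewrite besselJ_hankelA by (apply Rmult_lt_0_compat; assumption).
        rewrite RtoC_mult. ring.
      * replace ((mu + 1) * (Ci * (PI / 2)%R))%C with (mu * (Ci * (PI / 2)%R) + Ci * (PI / 2)%R)%C by ring.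
        replace ((mu + 1) * (- Ci * (PI / 2)%R))%C with (- (mu * (Ci * (PI / 2)%R)) + - (Ci * (PI / 2)%R))%C by ring.
        rewrite !Cexp_plus, EI, EI', Ee'. fold e. field. repeat split; assumption.
    (* The same coefficients reproduce [fhat]: 1 / (2 pi) is its 1 / pi times the 1/2 in K, and the
       phases in nu come from [hankelA_macdonald]. *)
    + refine (is_abel_int_lincomb _ _ _ (/ (2 * PI) * e)%C (/ (2 * PI) * / e)%C _ _ _ B1 B2 _ eq_refl).
      intros x Hx.
      rewrite besselK_macdonald by (apply Rmult_lt_0_compat; assumption).
      replace (- Ci * (omega * (Ci * x)))%C with (RtoC (omega * x)).
      2:{ rewrite RtoC_mult. replace (- Ci * (omega * (Ci * x)))%C with (- (Ci * Ci) * (omega * x))%C by ring.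
          rewrite Ci_sqr. ring. }
      replace (- - Ci * (omega * (- Ci * x)))%C with (RtoC (omega * x)).
      2:{ rewrite RtoC_mult. replace (- - Ci * (omega * (- Ci * x)))%C with (- (Ci * Ci) * (omega * x))%C by ring.
          rewrite Ci_sqr. ring. }
      unfold fhat.
      replace (- (Ci * x))%C with (- Ci * x)%C by ring.
      set (g := Cexp (nu * (Ci * (PI / 2)%R))).
      assert (Hg : g <> 0) by apply Cexp_neq_0.
      replace ((mu - nu) * PI * Ci / 2)%C with (mu * (Ci * (PI / 2)%R) + - (nu * (Ci * (PI / 2)%R)))%C
        by (rewrite HPI2; field).
      replace ((nu - mu) * PI * Ci / 2)%C with (nu * (Ci * (PI / 2)%R) + - (mu * (Ci * (PI / 2)%R)))%C
        by (rewrite HPI2; field).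
      replace (- (nu * (- Ci * (PI / 2)%R)))%C with (nu * (Ci * (PI / 2)%R))%C by ring.
      rewrite !Cexp_plus, Ee', (Cexp_opp (nu * (Ci * (PI / 2)%R))). fold e. fold g.
      field. repeat split; assumption.
Qed.
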